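(* Let $G$ be a connected, transitive, infinite graph that is not a tree, and let $q\in(0,1)$. If $p_c(G)<1$, then the random $2$-lift $G_q$ of $G$ satisfies $$p_c(G_q)<p_c(G)\quad\text{almost surely.}$$
   Context: All base graphs are non-empty, simple, undirected, connected and locally finite. A graph is transitive if its automorphism group acts transitively on its vertices. For a graph $H$, $p_c(H)=\sup\{p\in[0,1]:$ Bernoulli bond percolation of parameter $p$ on $H$ has almost surely no infinite cluster$\}$. Random $2$-lift: let $G=(V,E)$, $q\in[0,1]$, and $V^\star=V\times\{0,1\}$; write $v_0,v_1$ for the two lifts of $v\in V$. Let $(\eta_e)_{e\in E}$ be i.i.d. Bernoulli variables with parameter $q$. For each $e=\{u,v\}\in E$ put in $E(\eta)$ the two edges $\{u_0,v_{\eta_e}\}$ and $\{u_1,v_{1-\eta_e}\}$. The random graph $G_q=(V^\star,E(\eta))$ is the random $2$-lift of $G$. ''Almost surely'' is with respect to $\eta$, and $p_c(G_q)$ is the critical parameter of the realization of $G_q$. *)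

(* Defs.v *)
From HB Require Import structures.
From mathcomp Require Import all_boot all_order all_algebra finmap.
From mathcomp Require Import all_classical all_reals all_analysis.

Set Implicit Arguments.
Unset Strict Implicit.
Unset Printing Implicit Defensive.

Import Order.TTheory GRing.Theory Num.Theory.

Local Open Scope classical_set_scope.
Local Open Scope ring_scope.

(** * Graphs *)

Record sgraph := SGraph {
  vertex :> choiceType;
  adj : rel vertex;
  adj_sym : symmetric adj;
  adj_irr : irreflexive adj }.

Definition is_edge (G : sgraph) (e : {fset G}) : bool :=
  `[< exists u v : G, adj u v /\ e = [fset u; v]%fset >].

Definition edge (G : sgraph) := {e : {fset G} | is_edge e}.

Definition reachable (V : eqType) (r : rel V) (u v : V) : Prop :=
  exists2 s : seq V, path r u s & last u s = v.

Definition connected_graph (G : sgraph) : Prop :=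
  forall u v : G, reachable (@adj G) u v.

Definition locally_finite (G : sgraph) : Prop :=
  forall v : G, finite_set [set u : G | adj v u].

Definition automorphism (G : sgraph) (f : G -> G) : Prop :=
  bijective f /\ {mono f : u v / adj u v}.

Definition transitive_graph (G : sgraph) : Prop :=
  forall u v : G, exists2 f : G -> G, automorphism f & f u = v.

Definition acyclic_graph (G : sgraph) : Prop :=
  forall c : seq G, (2 < size c)%N -> ~ ucycle (@adj G) c.

Definition is_tree (G : sgraph) : Prop :=
  connected_graph G /\ acyclic_graph G.

(** * Independent Bernoulli variables *)

Definition mutually_independent d (T : measurableType d) (R : realType)
    (P : probability T R) (I : choiceType) (X : I -> {RV P >-> bool}) : Prop :=
  forall (J : {fset I}) (B : I -> set bool),
    P (\bigcap_(i in [set` J]) X i @^-1` B i) =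
    (\prod_(i <- J) P (X i @^-1` B i))%E.

Definition iid_bernoulli d (T : measurableType d) (R : realType)
    (P : probability T R) (I : choiceType) (p : R)
    (X : I -> {RV P >-> bool}) : Prop :=
  (forall i, distribution P (X i) =1 bernoulli_prob p) /\
  mutually_independent X.

(** * Bernoulli bond percolation *)

Definition open_adj (G : sgraph) (omega : edge G -> bool) : rel G :=
  fun u v => `[< exists2 e : edge G, val e = [fset u; v]%fset & omega e >].

Definition cluster (G : sgraph) (omega : edge G -> bool) (u : G) : set G :=
  [set v | reachable (open_adj omega) u v].

Definition has_infinite_cluster (G : sgraph) (omega : edge G -> bool) : Prop :=
  exists u : G, infinite_set (cluster omega u).

(* The event depends on the variables only through their joint law, the product
   of the Bernoulli laws; it is therefore required for every realization of
   this law on a probability space. *)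
Definition as_no_infinite_cluster (R : realType) (G : sgraph) (p : R) : Prop :=
  forall d (T : measurableType d) (P : probability T R)
    (omega : edge G -> {RV P >-> bool}),
    iid_bernoulli p omega ->
    {ae P, forall t, ~ has_infinite_cluster (fun e => omega e t)}.

Definition p_c (R : realType) (G : sgraph) : R :=
  sup [set p : R | 0 <= p <= 1 /\ as_no_infinite_cluster G p].

(** * Random 2-lift *)

Section Lift.
Variables (G : sgraph) (eta : edge G -> bool).

(* (v, false) and (v, true) are the lifts v_0 and v_1.  For e = {u, v} the edges
   {u_0, v_(eta e)} and {u_1, v_(1 - eta e)} are the {u_i, v_(i xor eta e)}, so
   the choice of an ordering of e is immaterial. *)
Definition lift_adj : rel (G * bool)%type := fun x y =>
  `[< exists2 e : edge G, val e = [fset x.1; y.1]%fset & y.2 = x.2 (+) eta e >].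

Lemma lift_adj_sym : symmetric lift_adj.
Proof.
move=> x y; apply: asbool_equiv_eq; split=> -[e ee ->]; exists e.
- by rewrite ee fsetUC.
- by rewrite -addbA addbb addbF.
- by rewrite ee fsetUC.
- by rewrite -addbA addbb addbF.
Qed.

Lemma lift_adj_irr : irreflexive lift_adj.
Proof.
move=> x; apply/asboolP => -[e ee _].
have /asboolP[u [v [uv euv]]] := valP e.
have /esym uvx : val e = [fset u; v]%fset by [].
have ux : u = x.1.
  by apply/eqP; have := fset21 u v; rewrite uvx ee !inE orbb.
have vx : v = x.1.
  by apply/eqP; have := fset22 u v; rewrite uvx ee !inE orbb.
by move: uv; rewrite ux vx adj_irr.
Qed.

Definition lift2 : sgraph := SGraph lift_adj_sym lift_adj_irr.

End Lift.

(* Main.v *)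
Require Import Defs.
From HB Require Import structures.
From mathcomp Require Import all_boot all_order all_algebra finmap.
From mathcomp Require Import all_classical all_reals all_analysis.
From mathcomp Require Import measurable_realfun ring lra.

Set Implicit Arguments.
Unset Strict Implicit.
Unset Printing Implicit Defensive.

Import Order.TTheory GRing.Theory Num.Theory.

Local Open Scope classical_set_scope.
Local Open Scope ring_scope.

(* Fix eta and explore the cluster of a lifted vertex o_0 edge by edge, giving
   the first tested lift of e the bit w_e and the second one the bit w'_e. The
   projection of this cluster contains the cluster of o in an enhanced
   percolation on G: if u is reached and lies on a closed walk of edges with
   w = w' = 1 and odd eta-sum, then both lifts of u are reached, so that an edge
   at u may also be used when only w' = 1. As G is not a tree, each vertex lies
   at bounded distance from a cycle, and the argument of Aizenman and Grimmett
   applies: a modification of boundedly many bits turns a pivotal edge into a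
   pivotal enhancement. The target is a random set of green vertices of density
   h rather than the boundary of a large ball, so that no modification is
   obstructed by the target: a green vertex close to the pivotal edge can
   be made pivotal itself. Along the curve w ~ p1 - t, enhancement C t,
   h = h0 (1 + 2 C t), the probability of reaching a green vertex is therefore
   nondecreasing, and the annealed lift at some p < p_c(G) percolates because G
   does at some p1 > p_c(G). Changing eta at finitely many edges does not destroy
   the existence of an infinite cluster, so the 0-1 law makes this almost sure. *)

(** * Expectations over finitely many independent bits *)

(** The order of the choices makes the estimate uniform. The price [C] of a local modification
    depends on the degree, on the cycle length [k], on [L] and on a lower bound [d] for the
    densities, but neither on the green density nor on the volume. So the gain [T], and the lower
    bound [c] on the percolation probability at [p1], are fixed first. For each radius [m], [h0] is
    then taken so small that green vertices in the ball of radius [m] hardly count, and only then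
    [n] so large that a path of [n] steps meets a green vertex with probability at least 1/2.
    Enhancement and green bits have densities without lower bound, so modifications may turn them
    off but never on. A vertex made pivotal as a target is moreover green, which yields a factor
    [h]; it is absorbed because [h] at most doubles along the curve. Odd closed walks are cut at
    length [L] to make the enhancement local. All this involves finitely many bits, whose
    expectations are iterated averages, so Russo's formula is plain calculus. Measures enter only
    afterwards, to pass from exits of balls to infinite clusters. *)

Section FiniteExpectation.
Variables (R : realType) (I : eqType).
Implicit Types (r : I -> R) (x y : I -> bool) (F G : (I -> bool) -> R).
Implicit Types (s : seq I) (i j : I).

Definition upd x i b : I -> bool := fun j => if j == i then b else x j.

Definition avg r i F : (I -> bool) -> R :=
  fun x => r i * F (upd x i true) + (1 - r i) * F (upd x i false).

(** The result is again a function of the configuration, in which the bits outside [s] are frozen;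
    conditional expectations thus need no separate notion. As one-bit averages commute and are
    idempotent, order and repetitions in [s] are immaterial. *)
Definition Ex r s F : (I -> bool) -> R := foldr (avg r) F s.

Definition prob_weight r := forall i, 0 <= r i <= 1.

Definition depends_on (A : pred I) F :=
  forall x y, (forall i, A i -> x i = y i) -> F x = F y.

Lemma updE x i b : upd x i b i = b.
Proof. by rewrite /upd eqxx. Qed.

Lemma upd_upd x i b c : upd (upd x i b) i c = upd x i c.
Proof. by apply/funext => j; rewrite /upd; case: eqP. Qed.

Lemma updC x i j b c : i != j -> upd (upd x i b) j c = upd (upd x j c) i b.
Proof.
move=> ij; apply/funext => k; rewrite /upd.
by case: (k =P j) => // ->; rewrite eq_sym (negbTE ij).
Qed.

Lemma upd_id x i b : x i = b -> upd x i b = x.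
Proof. by move=> xi; apply/funext => j; rewrite /upd; case: eqP => // ->. Qed.

Lemma avgC r i j F : avg r i (avg r j F) = avg r j (avg r i F).
Proof.
have [->//|ij] := eqVneq i j; apply/funext => x; rewrite /avg.
by rewrite !(updC _ _ _ ij); ring.
Qed.

Lemma avgid r i F : avg r i (avg r i F) = avg r i F.
Proof. by apply/funext => x; rewrite /avg !upd_upd; ring. Qed.

Lemma Ex_cat r s1 s2 F : Ex r (s1 ++ s2) F = Ex r s1 (Ex r s2 F).
Proof. exact: foldr_cat. Qed.

Lemma Ex_avg r s j F : Ex r s (avg r j F) = avg r j (Ex r s F).
Proof. by elim: s => //= i s ->; rewrite avgC. Qed.

Lemma Ex_mem r s j F : j \in s -> Ex r s (avg r j F) = Ex r s F.
Proof.
rewrite Ex_avg; elim: s => //= i s IH; rewrite inE => /orP[/eqP->|/IH js].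
  by rewrite avgid.
by rewrite avgC js.
Qed.

Lemma Ex_subset r s s' F : {subset s <= s'} -> Ex r s' (Ex r s F) = Ex r s' F.
Proof.
elim: s => //= i s IH ss'; rewrite Ex_mem ?IH //.
  by move=> j js; apply: ss'; rewrite inE js orbT.
by apply: ss'; rewrite mem_head.
Qed.

Lemma Ex_rem r s j F : j \in s -> Ex r s F = avg r j (Ex r (rem j s) F).
Proof.
elim: s => //= i s IH; rewrite inE; have [->//|ij /= js] := eqVneq j i.
by rewrite IH // avgC.
Qed.

Lemma Ex_cst r s (c : R) : Ex r s (fun=> c) = fun=> c.
Proof. by elim: s => //= i s ->; apply/funext => x; rewrite /avg; ring. Qed.

Lemma Ex_depends r s (A : pred I) F : depends_on A F ->
  depends_on [predD A & mem s] (Ex r s F).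
Proof.
move=> FA; elim: s => [|i s IH] x y xy /=.
  by apply: FA => i Ai; apply: xy; exact/andP.
rewrite /avg; congr (_ * _ + _ * _); apply: IH => j /andP[/= js Aj].
  by rewrite /upd; case: eqP => // /eqP ji; apply: xy; rewrite /= !inE negb_or ji js.
by rewrite /upd; case: eqP => // /eqP ji; apply: xy; rewrite /= !inE negb_or ji js.
Qed.

Lemma Ex_full r s F x y : depends_on (mem s) F -> Ex r s F x = Ex r s F y.
Proof.
move=> Fs; have := @Ex_depends r s _ F Fs x y; apply => i /=.
by move=> /andP[/negbTE/= ->].
Qed.

Lemma Ex_widen r s s' F x y : {subset s <= s'} -> depends_on (mem s) F ->
  Ex r s' F x = Ex r s F y.
Proof.
move=> ss' Fs; rewrite -(Ex_subset _ _ ss').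
have -> : Ex r s F = fun=> Ex r s F y by apply/funext => z; exact: Ex_full.
by rewrite Ex_cst.
Qed.

Lemma avg_le r i F G x : 0 <= r i <= 1 -> (forall y, F y <= G y) ->
  avg r i F x <= avg r i G x.
Proof.
by move=> /andP[r0 r1] FG; rewrite /avg lerD// ler_wpM2l// subr_ge0.
Qed.

Lemma Ex_le r s F G x : prob_weight r -> (forall y, F y <= G y) ->
  Ex r s F x <= Ex r s G x.
Proof. by move=> r01 FG; elim: s x => //= i s IH x; apply: avg_le. Qed.

Lemma Ex_ge0 r s F x : prob_weight r -> (forall y, 0 <= F y) -> 0 <= Ex r s F x.
Proof. by move=> r01 F0; have := Ex_le s x r01 F0; rewrite Ex_cst. Qed.

Lemma Ex_le1 r s F x : prob_weight r -> (forall y, F y <= 1) -> Ex r s F x <= 1.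
Proof. by move=> r01 F1; have := Ex_le s x r01 F1; rewrite Ex_cst. Qed.

Lemma ExD r s F G : Ex r s (fun x => F x + G x) = fun x => Ex r s F x + Ex r s G x.
Proof. by elim: s => //= i s ->; apply/funext => x; rewrite /avg; ring. Qed.

Lemma ExZ r s c F : Ex r s (fun x => c * F x) = fun x => c * Ex r s F x.
Proof. by elim: s => //= i s ->; apply/funext => x; rewrite /avg; ring. Qed.

Lemma Ex_sum r s (J : Type) (l : seq J) (F : J -> (I -> bool) -> R) :
  Ex r s (fun x => \sum_(j <- l) F j x) = fun x => \sum_(j <- l) Ex r s (F j) x.
Proof.
elim: l => [|j l IH].
  rewrite (_ : (fun x => _) = fun=> 0); last first.
    by apply/funext => x; rewrite big_nil.
  by rewrite Ex_cst; apply/funext => x; rewrite big_nil.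
under eq_fun do rewrite big_cons.
by rewrite ExD IH; apply/funext => x; rewrite big_cons.
Qed.

Lemma eq_Ex r r' s F : {in s, r =1 r'} -> Ex r s F = Ex r' s F.
Proof.
elim: s => //= i s IH rr'; rewrite /avg rr' ?mem_head// IH// => j js.
by apply: rr'; rewrite inE js orbT.
Qed.

Lemma Ex_monotone_at r s F j : prob_weight r ->
  (forall x, F (upd x j false) <= F (upd x j true)) ->
  forall x, Ex r s F (upd x j false) <= Ex r s F (upd x j true).
Proof.
move=> r01 Fj; elim: s => //= i s IH x; rewrite /avg.
have [->|ij] := eqVneq i j; first by rewrite !upd_upd.
have /andP[r0 r1] := r01 i.
by rewrite !(updC x _ _ (_ : j != i)) 1?eq_sym// lerD// ler_wpM2l// subr_ge0.
Qed.

(** The densities are raised one bit at a time: [avg] is affine in its density, with slope the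
    effect of that bit on the remaining average. *)
Lemma Ex_le_weight r r' s F x : prob_weight r -> prob_weight r' ->
  {in s, forall i, r i <= r' i} ->
  {in s, forall i y, F (upd y i false) <= F (upd y i true)} ->
  Ex r s F x <= Ex r' s F x.
Proof.
move=> r01 r01'; elim: s x => //= i s IH x rr' Fi.
have irr : r i <= r' i by apply: rr'; rewrite mem_head.
apply: (@le_trans _ _ (avg r i (Ex r' s F) x)).
  apply: avg_le => // y; apply: IH => j js; [apply: rr'|apply: Fi];
    by rewrite inE js orbT.
rewrite /avg; have := Ex_monotone_at s r01' (Fi i (mem_head _ _)) x.
by nra.
Qed.

Lemma Ex_eq_mem r s s' F : s =i s' -> Ex r s F = Ex r s' F.
Proof.
move=> ss'; rewrite -(Ex_subset r F (s := s) (s' := s')); last by move=> i; rewrite ss'.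
rewrite -[LHS](Ex_subset r F (s := s') (s' := s)); last by move=> i; rewrite ss'.
by elim: s {ss'} => //= i s ->; rewrite Ex_avg.
Qed.

Lemma Ex_indep r s F i : (forall x b, F (upd x i b) = F x) ->
  forall x b, Ex r s F (upd x i b) = Ex r s F x.
Proof.
move=> Fi; elim: s => //= j s IH x b; rewrite /avg.
have [->|ij] := eqVneq j i; first by rewrite !upd_upd.
by rewrite !(updC x _ _ (_ : i != j)) 1?eq_sym// !IH.
Qed.

Lemma Ex_filter r s F (P : pred I) :
  (forall i x b, i \in s -> ~~ P i -> F (upd x i b) = F x) ->
  Ex r s F = Ex r [seq i <- s | P i] F.
Proof.
elim: s => //= i s IH Fi; rewrite IH; last first.
  by move=> j x b js; apply: Fi; rewrite inE js orbT.
case: ifP => //= nPi; apply/funext => x; rewrite /avg.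
have Hi y b : Ex r [seq i <- s | P i] F (upd y i b) = Ex r [seq i <- s | P i] F y.
  by apply: Ex_indep => z c; apply: Fi; rewrite ?mem_head ?nPi.
by rewrite !Hi; ring.
Qed.

Lemma Ex_ge_on r s F c x : prob_weight r ->
  (forall y, (forall i, i \notin s -> y i = x i) -> c <= F y) -> c <= Ex r s F x.
Proof.
move=> r01; elim: s x => [|i l IH] x Fc /=; first exact: Fc.
have /andP[r0 r1] := r01 i.
have H b : c <= Ex r l F (upd x i b).
  apply: IH => y yx; apply: Fc => j; rewrite inE negb_or => /andP[ji jl].
  by rewrite yx// /upd (negbTE ji).
have := H true; have := H false; rewrite /avg.
set A := Ex _ _ _ _; set B := Ex _ _ _ _ => cA cB.
by nra.
Qed.

Lemma Ex_le_on r s F G x : prob_weight r ->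
  (forall y, (forall i, i \notin s -> y i = x i) -> F y <= G y) ->
  Ex r s F x <= Ex r s G x.
Proof.
move=> r01 FG; rewrite -subr_ge0.
rewrite (_ : _ - _ = Ex r s (fun y => G y + (-1) * F y) x); last first.
  by rewrite ExD ExZ mulN1r.
by apply: Ex_ge_on => // y yx; rewrite mulN1r subr_ge0; exact: FG.
Qed.

Lemma eq_Ex_on r s F G x : prob_weight r ->
  (forall y, (forall i, i \notin s -> y i = x i) -> F y = G y) ->
  Ex r s F x = Ex r s G x.
Proof.
move=> r01 FG; apply/eqP; rewrite eq_le; apply/andP.
by split; apply: Ex_le_on => // y /FG->.
Qed.

Lemma Ex_product r s (A : seq I) (B : I -> pred bool) : uniq A -> {subset A <= s} ->
  Ex r s (fun x => (all (fun i => B i (x i)) A)%:R) =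
  fun=> \prod_(i <- A) (r i * (B i true)%:R + (1 - r i) * (B i false)%:R).
Proof.
elim: A => [|i A IH] /=.
  by move=> _ _; rewrite (_ : (fun x => _) = fun=> 1) ?Ex_cst//; apply/funext => x; rewrite big_nil.
move=> /andP[iA uA] As; rewrite -(Ex_mem r _ (As i (mem_head _ _))).
have {}IH := IH uA (fun j jA => As j (mem_behead (s := i :: A) jA)).
apply/funext => x; rewrite big_cons -(congr1 (@^~ x) IH).
rewrite -[RHS](congr1 (@^~ x) (ExZ r s _ _)).
congr (Ex r s _ x); apply/funext => y; rewrite /avg !updE.
have E c : all (fun j => B j (upd y i c j)) A = all (fun j => B j (y j)) A.
  apply: eq_in_all => j jA; rewrite /upd; have [ji|] := eqVneq j i; last by [].
  by move: iA; rewrite -ji jA.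
by rewrite !E; case: (B i true) => /=; case: (B i false) => /=; rewrite ?mulr0n ?mulr1n; ring.
Qed.

Lemma Ex_cylinder r s (A : seq I) (b : I -> bool) : uniq A -> {subset A <= s} ->
  Ex r s (fun x => (all (fun i => x i == b i) A)%:R) =
  fun=> \prod_(i <- A) (if b i then r i else 1 - r i).
Proof.
move=> uA As; rewrite (Ex_product r (fun i => pred1 (b i)) uA As).
apply/funext => x; apply: eq_bigr => i _ /=.
by case: (b i) => /=; ring.
Qed.

(** Collects the values of [F] after every admissible treatment of bit [i]: leave it, or set it to a
    value of weight at least [d]. Summing them avoids choosing one. *)
Definition mutate r (d : R) i F x : R :=
  F x + (d <= r i)%R%:R * F (upd x i true) + (d <= 1 - r i)%R%:R * F (upd x i false).

(** A value of weight at least [d] already contributes to the average of [F] with that weight, so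
    forcing it costs at most [d^-1]; the two forced values together cost [d^-1] times the average,
    not twice that. *)
Lemma Ex_mutate r s d i F x : prob_weight r -> 0 < d -> i \in s ->
  (forall y, 0 <= F y) ->
  Ex r s (mutate r d i F) x <= (1 + d^-1) * Ex r s F x.
Proof.
move=> r01 d0 si F0; have /andP[r0 r1] := r01 i.
rewrite -(Ex_mem r (mutate _ _ _ _) si) -(Ex_mem r F si).
rewrite -[leRHS](congr1 (@^~ x) (ExZ r s (1 + d^-1) (avg r i F))).
apply: Ex_le => // y; rewrite /avg /mutate !upd_upd.
set a := F (upd y i true); set b := F (upd y i false).
have a0 : 0 <= a by exact: F0.
have b0 : 0 <= b by exact: F0.
have ea : (d <= r i)%R%:R * a <= d^-1 * (r i * a).
  case: (leP d (r i)) => dr; last by rewrite mul0r !mulr_ge0// invr_ge0 ltW.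
  by rewrite mul1r mulrA ler_peMl// mulrC ler_pdivlMr// mul1r.
have eb : (d <= 1 - r i)%R%:R * b <= d^-1 * ((1 - r i) * b).
  case: (leP d (1 - r i)) => dr.
    by rewrite mul1r mulrA ler_peMl// mulrC ler_pdivlMr// mul1r.
  by rewrite mul0r !mulr_ge0// ?invr_ge0 ?subr_ge0// ltW.
set u := _ * a; set v := _ * b; move: ea eb; rewrite -/u -/v; by lra.
Qed.

Definition weight r i (b : bool) : R := if b then r i else 1 - r i.

Lemma mutate_ge0 r d i F y : (forall y, 0 <= F y) -> 0 <= mutate r d i F y.
Proof. by move=> F0; rewrite /mutate !addr_ge0// mulr_ge0. Qed.

Lemma foldr_mutate_ge0 r d (J : seq I) F y : (forall y, 0 <= F y) ->
  0 <= foldr (mutate r d) F J y.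
Proof. by move=> F0; elim: J y => //= i J IH y; apply: mutate_ge0. Qed.

(** The passage from [x] to [y] need not be injective: iterating [mutate] over [J] sums [G] over all
    admissible modifications, hence dominates [F] pointwise, and each bit of [J] costs one
    factor. *)
Lemma Ex_finite_modification r s (J : seq I) d F G x : prob_weight r -> 0 < d ->
  {subset J <= s} -> (forall y, 0 <= G y) ->
  (forall x, F x <= 0 \/ exists y, [/\ F x <= G y, (forall i, i \notin J -> y i = x i) &
     {in J, forall i, y i = x i \/ d <= weight r i (y i)}]) ->
  Ex r s F x <= (1 + d^-1) ^+ size J * Ex r s G x.
Proof.
move=> r01 d0 Js G0 FG.
have FM z : F z <= foldr (mutate r d) G J z.
  have [Fz0|[y [Fy yz yw]]] := FG z.
    by apply: le_trans Fz0 _; exact: foldr_mutate_ge0.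
  apply: le_trans Fy _; elim: J {Js FG} z yz yw => [|i J IH] z yz yw /=.
    by rewrite (_ : y = z)//; apply/funext => i; exact: yz.
  have le1 : G y <= foldr (mutate r d) G J (upd z i (y i)).
    apply: IH => j jJ; rewrite /upd; case: eqP => [->|/eqP ji] //.
    - by apply: yz; rewrite inE negb_or ji.
    - by left.
    - by apply: yw; rewrite inE jJ orbT.
  apply: le_trans le1 _; rewrite /mutate.
  have H0 w : 0 <= foldr (mutate r d) G J w by exact: foldr_mutate_ge0.
  have Z0 : 0 <= (d <= r i)%R%:R * foldr (mutate r d) G J (upd z i true).
    by rewrite mulr_ge0.
  have Z1 : 0 <= (d <= 1 - r i)%R%:R * foldr (mutate r d) G J (upd z i false).
    by rewrite mulr_ge0.
  have [yi|] := yw i (mem_head _ _).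
    by rewrite upd_id// -addrA lerDl addr_ge0.
  rewrite /weight; case: (y i) => -> /=; rewrite mul1r.
    by rewrite addrAC lerDr addr_ge0.
  by rewrite lerDr addr_ge0.
apply: le_trans (Ex_le _ _ r01 FM) _.
elim: J Js {FG FM} => [|i J IH] Js /=; first by rewrite expr0 mul1r.
apply: le_trans (Ex_mutate _ r01 d0 _ _) _.
- by apply: Js; rewrite mem_head.
- by move=> y; exact: foldr_mutate_ge0.
- have d1 : 0 <= 1 + d^-1 by rewrite addr_ge0// invr_ge0 ltW.
  by rewrite exprS -mulrA ler_wpM2l//; apply: IH => j jJ; apply: Js; rewrite inE jJ orbT.
Qed.

Definition bdiff i F x : R := F (upd x i true) - F (upd x i false).

Lemma Ex_bdiff r s i F : i \notin s -> Ex r s (bdiff i F) = bdiff i (Ex r s F).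
Proof.
elim: s => //= j s IH; rewrite inE negb_or => /andP[ij /IH->].
apply/funext => x; rewrite /avg /bdiff !(updC _ _ _ ij); ring.
Qed.

(** Russo's formula along a curve of product measures: by the product rule each bit contributes its
    speed times the mean of its discrete derivative [bdiff]. *)
Lemma is_derive_Ex (rho : R -> I -> R) (drho : I -> R) s F x (t : R) : uniq s ->
  (forall i, is_derive t 1 (rho ^~ i) (drho i)) ->
  is_derive t 1 (fun u => Ex (rho u) s F x)
    (\sum_(i <- s) drho i * Ex (rho t) s (bdiff i F) x).
Proof.
move=> + rhoD; elim: s x => [|i s IH] x /=; first by rewrite big_nil => _; exact: is_derive_cst.
move=> /andP[is_ us]; have D1 := IH (upd x i true) us; have D0 := IH (upd x i false) us.
have Di := rhoD i.
have DN := is_deriveB (is_derive_cst (1 : R) t 1) Di.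
have := is_deriveD (is_deriveM Di D1) (is_deriveM DN D0).
rewrite /avg => D.
have E : \sum_(j <- s) drho j * avg (rho t) i (Ex (rho t) s (bdiff j F)) x =
    rho t i * (\sum_(j <- s) drho j * Ex (rho t) s (bdiff j F) (upd x i true)) +
    (1 - rho t i) * (\sum_(j <- s) drho j * Ex (rho t) s (bdiff j F) (upd x i false)).
  by rewrite !mulr_sumr -big_split; apply: eq_bigr => j _ /=; rewrite /avg; ring.
apply: is_derive_eq; rewrite big_cons /= E (Ex_bdiff _ _ is_) /avg {3 4}/bdiff !upd_upd.
rewrite (_ : (cst 1 - rho^~ i) t = 1 - rho t i)// /GRing.scale /=; ring.
Qed.

End FiniteExpectation.

Lemma Ex_map (R : realType) (I I' : eqType) (phi : I -> I') (r : I' -> R) s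
    (F : (I -> bool) -> R) (x : I' -> bool) : injective phi ->
  Ex r (map phi s) (fun y => F (y \o phi)) x = Ex (r \o phi) s F (x \o phi).
Proof.
move=> phi_inj; elim: s x => //= i s IH x; rewrite /avg !IH.
have updphi b : upd x (phi i) b \o phi = upd (x \o phi) i b.
  by apply/funext => j; rewrite /upd /= (inj_eq phi_inj).
by rewrite !updphi.
Qed.

(** * Paths and balls *)

Section Paths.
Variables (T : eqType).
Implicit Types (r : rel T) (P : pred T) (u v : T) (s : seq T).

Lemma first_entry P u s : ~~ P u -> P (last u s) ->
  exists s1 v s2, [/\ s = s1 ++ v :: s2, P v & all (predC P) (u :: s1)].
Proof.
elim: s u => [|v s IH] u /= nPu; first by rewrite (negbTE nPu).
have [Pv _|nPv ls] := boolP (P v); first by exists [::], v, s; rewrite /= nPu.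
have [s1 [w [s2 [-> Pw /= /andP[? ?]]]]] := IH _ nPv ls.
by exists (v :: s1), w, s2; split => //=; apply/and3P.
Qed.

Lemma last_exit P u s : P u -> ~~ P (last u s) ->
  exists s1 v s2, [/\ s = s1 ++ v :: s2, P (last u s1) & all (predC P) (v :: s2)].
Proof.
move=> Pu; elim/last_ind: s => [|s v IH]; rewrite ?last_rcons /=; first by rewrite Pu.
move=> nPv; have [Pl|/IH[s1 [w [s2 [-> Pl al]]]]] := boolP (P (last u s)).
  by exists s, v, [::]; split; rewrite ?cats1//= nPv.
exists s1, w, (rcons s2 v); split => //; first by rewrite rcons_cat.
by move: al => /= /andP[-> ?]; rewrite all_rcons /= nPv.
Qed.

Definition reachn r n u v := exists s, [/\ path r u s, last u s = v & (size s <= n)%N].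

Lemma reachn_trans r m n u v w : reachn r m u v -> reachn r n v w ->
  reachn r (m + n) u w.
Proof.
move=> [s [ps ls ss]] [t [pt lt st]]; exists (s ++ t).
by rewrite cat_path ls last_cat ls ps size_cat leq_add.
Qed.

Lemma reachn_le r m n u v : (m <= n)%N -> reachn r m u v -> reachn r n u v.
Proof. by move=> mn [s [? ? ?]]; exists s; split => //; exact: leq_trans mn. Qed.

Lemma reachn_sym r n u v : symmetric r -> reachn r n u v -> reachn r n v u.
Proof.
move=> rsym [s [ps ls ss]]; exists (rev (belast u s)); split.
- by rewrite -ls rev_path (@eq_path _ _ r)// => x y; rewrite rsym.
- by rewrite -ls; case: s {ps ls ss} => //= v' s; rewrite rev_cons last_rcons.
- by rewrite size_rev size_belast.
Qed.

Lemma reachable_refl r u : reachable r u u.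
Proof. by exists [::]. Qed.

Lemma reachable_trans r u v w : reachable r u v -> reachable r v w -> reachable r u w.
Proof.
move=> [s ps ls] [t pt lt]; exists (s ++ t); first by rewrite cat_path ls ps.
by rewrite last_cat ls.
Qed.

Lemma reachable_step r u v w : reachable r u v -> r v w -> reachable r u w.
Proof. by move=> uv vw; apply: reachable_trans uv _; exists [:: w] => //=; rewrite vw. Qed.

Lemma reachable_sym r u v : symmetric r -> reachable r u v -> reachable r v u.
Proof.
move=> rsym [s ps ls]; have uv : reachn r (size s) u v by exists s.
by have [t [pt lt _]] := reachn_sym rsym uv; exists t.
Qed.

Lemma sub_reachable r r' u v : (forall a b, r a b -> r' a b) ->
  reachable r u v -> reachable r' u v.
Proof. by move=> rr' [s ps ls]; exists s => //; apply: sub_path ps. Qed.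

Lemma path_reachable r u s v : path r u s -> v \in u :: s -> reachable r u v.
Proof.
move=> ps; rewrite inE => /orP[/eqP->|]; first exact: reachable_refl.
move=> vs; move: ps; case/splitPr: vs => s1 s2; rewrite -cat_rcons cat_path => /andP[ps _].
by exists (rcons s1 v) => //; rewrite last_rcons.
Qed.

Lemma reachable_ind r u (Q : T -> Prop) : Q u ->
  (forall a b, Q a -> r a b -> Q b) -> forall v, reachable r u v -> Q v.
Proof.
move=> Qu Qr v [s]; elim: s u Qu => [|w s IH] u Qu /=; first by move=> _ <-.
by move=> /andP[uw ps] ls; apply: IH ps ls; exact: Qr uw.
Qed.

Lemma pairmapP (S : eqType) (f : T -> T -> S) u s e : e \in pairmap f u s ->
  exists s1 v s2, s = s1 ++ v :: s2 /\ e = f (last u s1) v.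
Proof.
elim: s u => //= v s IH u; rewrite inE => /orP[/eqP->|/IH[s1 [w [s2 [-> ->]]]]].
  by exists [::], v, s.
by exists (v :: s1), w, s2.
Qed.

End Paths.

Section Balls.
Variables (G : sgraph) (lf : locally_finite G).
Implicit Types (u v w : G).

Definition nbr u : {fset G} := fset_set [set v : G | adj u v].

Lemma in_nbr u v : (v \in nbr u) = adj u v.
Proof.
rewrite in_fset_set; last exact: lf.
by apply/idP/idP; rewrite in_setE.
Qed.

Fixpoint gball (n : nat) u : {fset G} :=
  if n is m.+1 then (gball m u `|` \bigcup_(v <- gball m u) nbr v)%fset
  else [fset u]%fset.

Lemma in_gballS n u w : w \in gball n.+1 u ->
  w \in gball n u \/ exists2 v, v \in gball n u & adj v w.
Proof.
rewrite /= inE => /orP[|/bigfcupP[v]]; first by left.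
by rewrite andbT in_nbr => vb vw; right; exists v.
Qed.

Lemma gballW n u w : w \in gball n u -> w \in gball n.+1 u.
Proof. by move=> wn; rewrite /= inE wn. Qed.

Lemma gball_step n u v w : v \in gball n u -> adj v w -> w \in gball n.+1 u.
Proof.
move=> vb vw; rewrite /= inE; apply/orP; right; apply/bigfcupP; exists v.
  by rewrite vb.
by rewrite in_nbr.
Qed.

Lemma gball_le m n u w : (m <= n)%N -> w \in gball m u -> w \in gball n u.
Proof.
move=> /subnK <-; elim: (n - m)%N => // k IH wm.
by rewrite addSn; apply: gballW; exact: IH.
Qed.

Lemma gball_center n u : u \in gball n u.
Proof. by apply: (@gball_le 0) => //; rewrite /= inE. Qed.

Lemma gball_trans m n u v w : v \in gball m u -> w \in gball n v -> w \in gball (m + n) u.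
Proof.
move=> vu; elim: n w => [|n IH] w; first by rewrite /= inE addn0 => /eqP->.
move=> /in_gballS[/IH wn|[w' /IH w'n ww]]; rewrite addnS; first exact: gballW.
exact: gball_step w'n ww.
Qed.

Lemma gball_sym n u v : v \in gball n u -> u \in gball n v.
Proof.
elim: n v => [|n IH] v; first by rewrite /= !inE eq_sym.
move=> /in_gballS[/IH|[w wu wv]]; first exact: gballW.
rewrite -add1n; apply: (@gball_trans _ _ _ w); last exact: IH.
by apply: (@gball_step _ _ v); rewrite ?gball_center// adj_sym.
Qed.

Lemma path_gball u s : path (@adj G) u s -> {subset u :: s <= gball (size s) u}.
Proof.
elim/last_ind: s => [|s v IH]; first by move=> _ w; rewrite /= !inE.
rewrite rcons_path size_rcons => /andP[/IH us lv] w.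
rewrite -rcons_cons mem_rcons inE => /orP[/eqP->|/us]; last exact: gballW.
by apply: gball_step lv; apply: us; rewrite mem_last.
Qed.

(** The list [s] leaves out the starting point: only [v] may lie on the outer sphere, so every edge
    of the path has an endpoint in the smaller ball and its bits may be modified. *)
Lemma descending_path n c v : v \in gball n.+1 c ->
  exists s, [/\ path (@adj G) v s, last v s = c, (size s <= n.+1)%N
    & {subset s <= gball n c}].
Proof.
elim: n v => [|n IH] v /in_gballS[].
- by rewrite /= inE => /eqP->; exists [::].
- rewrite /= => -[w]; rewrite inE => /eqP-> cv; exists [:: c]; split => //=.
    by rewrite adj_sym cv.
  by move=> x; rewrite !inE.
- move=> /IH[s [ps ls ss sub]]; exists s; split => //; first exact: leqW.
  by move=> w /sub; exact: gballW.
- move=> [w wn wv]; have [s [ps ls ss sub]] := IH _ wn; exists (w :: s); split => //.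
    by rewrite /= adj_sym wv.
  by move=> x; rewrite inE => /orP[/eqP->//|/sub]; exact: gballW.
Qed.

Lemma connected_gball (o v : G) : connected_graph G -> exists n, v \in gball n o.
Proof.
move=> /(_ o v)[s ps <-]; exists (size s).
by apply: (path_gball ps); rewrite mem_last.
Qed.

End Balls.

Arguments gball : simpl never.

(** * The enhanced percolation *)

Section StaticModel.
Variables (G : sgraph).
Implicit Types (u v w : G) (e : {fset G}) (i : bool).
Implicit Types (x y z : nat * {fset G} -> bool).

Definition ek u v : {fset G} := [fset u; v]%fset.

Lemma ekC u v : ek u v = ek v u.
Proof. exact: fsetUC. Qed.

Lemma ek_inj u v a b : ek u v = ek a b -> u = a /\ v = b \/ u = b /\ v = a.
Proof.
move=> E.
have /fset2P ua : u \in ek a b by rewrite -E fset21.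
have /fset2P va : v \in ek a b by rewrite -E fset22.
have /fset2P av : a \in ek u v by rewrite E fset21.
have /fset2P bv : b \in ek u v by rewrite E fset22.
case: ua va av bv => -> [] -> [] ? [] ?; subst; by [left|right].
Qed.

(* The bits of a configuration: (0, e) and (1, e) are the states of the first
   and of the second tested lift of e, (2, e) is eta_e, (3, {u}) thins the
   enhancement at u and (4, {u}) tells whether u is green. *)
Definition pstep x : rel (G * bool) := fun a b =>
  [&& adj a.1 b.1, x (0%N, ek a.1 b.1), x (1%N, ek a.1 b.1) &
      b.2 == a.2 (+) x (2%N, ek a.1 b.1)].

(** A closed walk at [u] has odd [eta]-sum exactly when its lift ends on the other sheet; the cutoff
    [L] makes this a local event. *)
Definition odd_at L x u := reachn (pstep x) L (u, false) (u, true).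

(** This relation is directed: the enhancement at [u] helps to leave [u], not to enter it. *)
Definition st L x : rel G := fun u v => adj u v &&
  (x (0%N, ek u v) ||
   [&& x (1%N, ek u v), x (3%N, [fset u]%fset) & `[< odd_at L x u >]]).

Definition hit L o x := exists2 t : G, reachable (st L x) o t & x (4%N, [fset t]%fset).

Lemma pstep_sym x : symmetric (pstep x).
Proof.
move=> [u i] [v j]; rewrite /pstep /= adj_sym (ekC v u); congr [&& _, _, _ & _].
by apply/eqP/eqP => ->; rewrite -addbA addbb addbF.
Qed.

(** Exchanging the two sheets is an automorphism of the lift. *)
Lemma pstep_flip x n u v i (j : bool) : reachn (pstep x) n (u, i) (v, j) ->
  reachn (pstep x) n (u, ~~ i) (v, ~~ j).
Proof.
move=> [s [ps ls ss]]; exists [seq (a.1, ~~ a.2) | a <- s]; split.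
- rewrite -[(u, ~~ i)]/((fun a : G * bool => (a.1, ~~ a.2)) (u, i)).
  rewrite path_map; apply: sub_path ps => -[a ai] [b bj]; rewrite /pstep /=.
  by move=> /and4P[-> -> -> /eqP->] /=; rewrite addNb.
- rewrite -[(u, ~~ i)]/((fun a : G * bool => (a.1, ~~ a.2)) (u, i)).
  by rewrite last_map ls.
- by rewrite size_map.
Qed.

Definition doubly_open x e := x (0%N, e) && x (1%N, e).

Lemma lift_path x u s i : path (@adj G) u s ->
  {in pairmap ek u s, forall e, doubly_open x e} ->
  exists j, reachn (pstep x) (size s) (u, i) (last u s, j).
Proof.
elim: s u i => [|v s IH] u i /=; first by exists i, [::].
move=> /andP[uv ps] dbl.
have [|j [t [pt lt st]]] := IH v (i (+) x (2%N, ek u v)) ps.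
  by move=> e es; apply: dbl; rewrite inE es orbT.
have /andP[x0 x1] := dbl _ (mem_head _ _).
exists j, ((v, i (+) x (2%N, ek u v)) :: t); split => //=.
by rewrite {1}/pstep /= uv x0 x1 eqxx.
Qed.

Lemma lift_path_even x u s i : path (@adj G) u s ->
  {in pairmap ek u s, forall e, doubly_open x e && ~~ x (2%N, e)} ->
  reachn (pstep x) (size s) (u, i) (last u s, i).
Proof.
elim: s u => [|v s IH] u /=; first by exists [::].
move=> /andP[uv ps] dbl.
have [|t [pt lt st]] := IH v ps.
  by move=> e es; apply: dbl; rewrite inE es orbT.
have /andP[/andP[x0 x1] /negbTE x2] := dbl _ (mem_head _ _).
exists ((v, i) :: t); split => //=.
by rewrite {1}/pstep /= uv x0 x1 x2 addbF eqxx.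
Qed.

Lemma cycle_key_once c v s : uniq (v :: s) -> last v s = c -> (1 < size s)%N ->
  ek c v \notin pairmap ek v s.
Proof.
move=> us ls ss; apply/negP => /pairmapP[s1 [w [s2 [Es Ek]]]].
subst s; move: us ls ss; rewrite last_cat /= cat_uniq /= negb_or.
move=> /andP[vs /and3P[us1 /andP[ws1 _] /andP[ws2 us2]]] ls ss.
have wv : w <> v by move=> wv; move: vs; rewrite wv mem_cat mem_head orbT.
have [[_ /esym//]|[/esym cw vl]] := ek_inj Ek.
have s20 : s2 = [::].
  case: s2 ls ws2 {ss vs us2 Ek} => //= a s2 ls; rewrite inE negb_or => /andP[wa ws2].
  suff : w \in a :: s2 by rewrite inE (negbTE wa) (negbTE ws2).
  by rewrite cw -ls mem_last.
have s10 : s1 = [::].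
  case: s1 vl vs {ss us1 ws1 ls Ek} => //= a s1 vl; rewrite inE mem_cat => /norP[va /norP[vs1 _]].
  suff : v \in a :: s1 by rewrite inE (negbTE va) (negbTE vs1).
  by rewrite {1}vl mem_last.
by subst.
Qed.

End StaticModel.

(** * Locality: changes near a vertex do not affect distant steps *)

Section LocalModification.
Variables (G : sgraph) (lf : locally_finite G) (k L : nat).
Implicit Types (u v w c : G) (e : {fset G}) (i : bool).
Implicit Types (x y z : nat * {fset G} -> bool).
Hypothesis Lk : (k.+1 + k + k + k.+1 + k <= L)%N.

Notation K := (nat * {fset G})%type.

Definition near_edges c : seq {fset G} := [seq ek a a' | a <- gball k c, a' <- nbr a].

Definition touches c e : bool := e \in near_edges c.

Lemma touches_ek c u v : adj u v ->
  touches c (ek u v) = (u \in gball k c) || (v \in gball k c).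
Proof.
move=> uv; apply/allpairsPdep/orP => [[a [a' [ab _ /ek_inj[][-> ->]]]]|[ub|vb]].
- by left.
- by right.
- by exists u, v; rewrite in_nbr.
- by exists v, u; rewrite in_nbr// adj_sym ekC.
Qed.

Lemma far_untouched c u v : adj u v -> u \notin gball k.+1 c -> ~~ touches c (ek u v).
Proof.
move=> uv ub; rewrite touches_ek// negb_or; apply/andP; split.
  by apply: contra ub; exact: gballW.
by apply: contra ub => vb; apply: (gball_step lf vb); rewrite adj_sym.
Qed.

Definition agree_off c x y := forall n e, ~~ touches c e -> (n < 3)%N -> x (n, e) = y (n, e).

(** A walk of length at most [L] that starts outside this radius cannot use an edge touching the
    ball of radius [k]. So no enhancement still switched on feels the bits that are about to be
    modified. *)
Definition quiet c x := forall u, u \in gball (k.+1 + L) c -> x (3%N, [fset u]%fset) = false.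

Lemma pstep_far c x y u i s : agree_off c x y -> u \notin gball (k.+1 + size s) c ->
  path (pstep x) (u, i) s -> path (pstep y) (u, i) s.
Proof.
move=> xy; elim: s u i => //= -[v j] s IH u i uf /andP[+ ps].
rewrite /pstep /= => /and4P[uv x0 x1 x2].
have nt : ~~ touches c (ek u v).
  by apply: far_untouched => //; apply: contra uf => ub; apply: (gball_le _ ub); rewrite leq_addr.
rewrite uv -(xy 0%N)// -(xy 1%N)// -(xy 2)// x0 x1 x2 /=; apply: IH ps.
by apply: contra uf => vf; rewrite addnS; apply: (gball_step lf vf); rewrite adj_sym.
Qed.

Lemma odd_at_far c x y u : agree_off c x y -> u \notin gball (k.+1 + L) c ->
  odd_at L x u -> odd_at L y u.
Proof.
move=> xy uf [s [ps ls ss]]; exists s; split => //.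
apply: pstep_far xy _ ps; apply: contra uf => ub; apply: (gball_le _ ub).
by rewrite leq_add2l.
Qed.

(** A plain step survives because its bits agree. A step using an enhancement starts outside the
    quiet ball, so its odd walk survives as well. *)
Lemma st_local c x y u v : quiet c x -> agree_off c x y ->
  (forall w, x (3%N, [fset w]%fset) -> y (3%N, [fset w]%fset)) ->
  ~~ touches c (ek u v) -> st L x u v -> st L y u v.
Proof.
move=> qx xy x3 nt /andP[uv stx]; rewrite /st uv -(xy 0%N)// -(xy 1%N)//=.
case/orP: stx => [->//|/and3P[x1 xu /asboolP odd]].
rewrite x1 (x3 _ xu) /=; apply/orP; right; apply/asboolP; apply: odd_at_far xy _ odd.
by apply/negP => ub; rewrite qx in xu.
Qed.

Lemma quiet_st c x u v : quiet c x -> u \in gball (k.+1 + L) c -> st L x u v -> x (0%N, ek u v).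
Proof. by move=> qx /qx ub /andP[_ /orP[//|/and3P[_]]]; rewrite ub. Qed.

(** The steps granted by the first bit alone: unlike those of [st], they can be reversed. *)
Definition wst x : rel G := fun u v => adj u v && x (0%N, ek u v).

Lemma wst_sym x : symmetric (wst x).
Proof. by move=> u v; rewrite /wst adj_sym ekC. Qed.

Lemma wst_st x u v : wst x u v -> st L x u v.
Proof. by move=> /andP[uv xuv]; rewrite /st uv xuv. Qed.

Lemma open_path x u s : path (@adj G) u s ->
  {in pairmap (@ek G) u s, forall e, x (0%N, e)} -> path (wst x) u s.
Proof.
elim: s u => //= v s IH u /andP[uv ps] op; rewrite /wst uv op ?mem_head//=.
by apply: IH => // e es; apply: op; rewrite inE es orbT.
Qed.

Lemma key_endpoint u s e v : e \in pairmap (@ek G) u s -> v \in e -> v \in u :: s.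
Proof.
move=> /pairmapP[s1 [w [s2 [-> ->]]]] /fset2P[]->.
  by rewrite -cat_cons mem_cat mem_last.
by rewrite inE mem_cat mem_head !orbT.
Qed.

Lemma key_touches c u s e : path (@adj G) u s -> {subset s <= gball k c} ->
  e \in pairmap (@ek G) u s -> touches c e.
Proof.
move=> + sb /pairmapP[s1 [w [s2 [E ->]]]]; rewrite E cat_path => /and3P[_ aw _].
rewrite touches_ek//; apply/orP; right.
by apply: sb; rewrite E mem_cat mem_head orbT.
Qed.

End LocalModification.

Lemma sub_path_belast (T : eqType) (r r' : rel T) (P : pred T) u s :
  (forall a b, P a -> r a b -> r' a b) -> all P (belast u s) -> path r u s -> path r' u s.
Proof.
move=> rr'; elim: s u => //= v s IH u /andP[Pu Ps] /andP[ruv ps].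
by rewrite rr'//= IH.
Qed.

(* All edges near c are closed, except a cycle through c and two paths: one from
   an entry point in the cluster C of o to c, whose edges and those of the cycle
   are doubly open with odd eta-sum around the cycle, and one, in w, from an exit
   point outside C towards c. The two are linked by a last edge uv on which only
   w' = 1, hence the enhancement at u is pivotal. *)
Section Gadget.
Variables (G : sgraph) (lf : locally_finite G) (k L : nat).
Hypothesis Lk : (k.+1 + k + k + k.+1 + k <= L)%N.
Variables (o c b v : G) (cyc : seq G) (y : nat * {fset G} -> bool).
Hypotheses (cb : adj c b) (pcyc : path (@adj G) c (v :: cyc)).
Hypotheses (lcyc : last v cyc = c) (ucyc : uniq (v :: cyc)).
Hypotheses (kcyc : size (v :: cyc) = k) (k3 : (2 < k)%N).
Hypotheses (qy : quiet k L c y)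
  (gy : forall t, t \in gball k.+1 c -> y (4, [fset t]%fset) = false).
Hypotheses (hy : hit L o y) (nhy : ~ hit L o (upd y (0%N, ek c b) false)).

Let z := upd y (0%N, ek c b) false.
Let C u := reachable (st L z) o u.
Let int := gball k c.

Let z_not0 n e : (n != 0)%N -> z (n, e) = y (n, e).
Proof. by move=> n0; rewrite /z /upd xpair_eqE (negbTE n0). Qed.

Let z_other e : e != ek c b -> z (0%N, e) = y (0%N, e).
Proof. by move=> ne; rewrite /z /upd xpair_eqE (negbTE ne) andbF. Qed.

Let qz : quiet k L c z.
Proof. by move=> u ub; rewrite z_not0//; exact: qy. Qed.

Let yz : agree_off k c y z.
Proof.
move=> n e nt _; rewrite /z /upd xpair_eqE; case: eqP => //= _; case: eqP => // ee.
by move: nt; rewrite ee touches_ek// gball_center.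
Qed.

(** Closing the edge could also destroy odd walks through it, but the enhancements which such walks
    support all lie in the quiet ball, where none is switched on. *)
Let st_yz u w : st L y u w -> ek u w <> ek c b -> st L z u w.
Proof.
move=> stu ne; have [uw _] := andP stu.
have [ub|nub] := boolP (u \in gball (k.+1 + L) c).
  by apply: wst_st; rewrite /wst uw z_other; [exact: quiet_st qy ub stu|exact/eqP].
apply: (st_local lf qy yz) => //.
apply: (far_untouched lf uw); apply: contra nub => ub.
by apply: (gball_le _ ub); rewrite leq_addr.
Qed.

Let nhz t : C t -> z (4, [fset t]%fset) = false.
Proof. by move=> Ct; apply/negP => zt; apply: nhy; exists t. Qed.

Let b_near u : u = c \/ u = b -> u \in gball k.+1 c.
Proof.
move=> [->|->]; first exact: gball_center.
by apply: (gball_step lf _ cb); exact: gball_center.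
Qed.

(** A successful path for [y] must leave the cluster [C] of [z], and can do so only through the edge
    from [c] to [b], in one direction or the other. After its last exit from [C] it no longer uses
    that edge, whose near end lies in [C]. *)
Let crossing : exists w w' t s, [/\ C w, w \in gball k.+1 c, w' \in gball k.+1 c
  & [/\ path (st L z) w' s, forall u, u \in w' :: s -> ~ C u, last w' s = t
     & z (4, [fset t]%fset)]].
Proof.
have [t [s ps ls] yt] := hy.
have zt : z (4, [fset t]%fset) by rewrite z_not0.
have Co : `[< C o >] by apply/asboolP; exact: reachable_refl.
have nCt : ~~ `[< C (last o s) >].
  by rewrite ls; apply/asboolPn => /nhz; rewrite zt.
have [s1 [w' [s2 [Es /asboolP Cw /= /andP[/asboolPn nCw' nCs2]]]]] :=
  @last_exit _ (fun u => `[< C u >]) _ _ Co nCt.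
move: ps ls; rewrite Es cat_path last_cat /= => /and3P[_ stw ps2] ls2.
have Ew : ek (last o s1) w' = ek c b.
  apply: contrapT => ne; apply: nCw'; apply: reachable_step Cw _.
  exact: st_yz stw ne.
have nC u : u \in w' :: s2 -> ~ C u.
  rewrite inE => /orP[/eqP->//|us2]; apply/asboolPn.
  exact: (allP nCs2 _ us2).
exists (last o s1), w', t, s2; split => //.
- by apply: b_near; have [[-> _]|[-> _]] := ek_inj Ew; [left|right].
- by apply: b_near; have [[_ ->]|[_ ->]] := ek_inj Ew; [right|left].
- split => //.
  have tail a a' : ~ C a -> ~ C a' -> st L y a a' -> st L z a a'.
    move=> nCa nCa' sta; apply: st_yz sta _; rewrite -Ew => /ek_inj[[aw _]|[_ aw]].
      by apply: nCa; rewrite aw.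
    by apply: nCa'; rewrite aw.
  move: nC ps2 {ls2 nCs2 stw nCw' Es Ew}.
  elim: s2 w' => //= a s2 IH w' nC /andP[wa pa].
  rewrite IH ?andbT //; last by move=> u us; apply: nC; rewrite inE us orbT.
  by rewrite tail//; apply: nC; rewrite !inE eqxx ?orbT.
Qed.

Let near u := u \in gball k.+1 c.

(** The target is not near [c], since no vertex there is green. The last near vertex [y1] of the
    tail thus has a neighbour farther out, so it lies on the boundary sphere and the edges by which
    the path continues are never modified. *)
Let entry_exit : exists x1 y1 p s t,
  [/\ path (st L z) o p, last o p = x1, all (predC near) (belast o p), near x1 & C x1] /\
  [/\ near y1, ~ C y1, path (st L z) y1 s, all (predC near) s & last y1 s = t] /\
  (y1 \notin int /\ z (4, [fset t]%fset)).
Proof.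
have [w [w' [t [s [Cw wn w'n [ps nC ls zt]]]]]] := crossing.
have [x1 [p [p1 p2 p3 p4 p5]]] : exists x1 p, [/\ path (st L z) o p, last o p = x1,
    all (predC near) (belast o p), near x1 & C x1].
  have [on|non] := boolP (near o).
    by exists o, [::]; split => //; exact: reachable_refl.
  have [p0 pp0 lp0] := Cw; rewrite -lp0 in wn.
  have [s1 [x1 [s2 [E nx1 al]]]] := @first_entry _ near _ _ non wn.
  move: pp0; rewrite E -cat_rcons cat_path => /andP[pp0 _].
  exists x1, (rcons s1 x1); split; rewrite ?last_rcons ?belast_rcons//.
  by exists (rcons s1 x1); rewrite ?last_rcons.
have nt : ~~ near (last w' s).
  rewrite ls; apply/negP => tn; have := gy tn.
  by rewrite -z_not0// zt.
have [s1 [a [s2 [E ny1 al]]]] := @last_exit _ near _ _ w'n nt.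
exists x1, (last w' s1), p, (a :: s2), t.
move: ps; rewrite E cat_path => /andP[_ ps2].
split; [by []|split]; first split => //.
- by apply: nC; rewrite E -cat_cons mem_cat mem_last.
- by rewrite -ls E last_cat.
- split=> //; move: al ps2 => /= /andP[an _] /andP[/andP[ya _] _].
  by apply: contra an => yint; exact: (gball_step lf yint ya).
Qed.

Lemma gadget : exists2 u, u \in gball k c & exists z1 : nat * {fset G} -> bool,
  [/\ hit L o (upd z1 (3%N, [fset u]%fset) true),
      ~ hit L o (upd z1 (3%N, [fset u]%fset) false) &
      forall n e, z1 (n, e) = y (n, e) \/ (n < 3)%N /\ touches k c e].
Proof.
have [x1 [y1 [p [s [t [[pp lp fp nx1 Cx1] [[ny1 nCy1 ps fs ls] [y1int zt]]]]]]]] := entry_exit.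
have [dx [pdx ldx sdx dxint]] := descending_path lf nx1.
have [dy [pdy ldy sdy dyint]] := descending_path lf ny1.
have cint : c \in int by exact: gball_center.
have vint : {subset v :: cyc <= int}.
  move=> a av; have := path_gball lf pcyc; rewrite kcyc; apply.
  by rewrite inE av orbT.
(* [D] is the part to be doubly open: the path from the entry point to [c], and the cycle. *)
pose D u := (u \in x1 :: dx) || (u \in v :: cyc).
have Dc : D c by rewrite /D -[X in X \in _]ldx mem_last.
have Dint a : D a -> a = x1 \/ a \in int.
  move=> /orP[|/vint]; last by right.
  by rewrite inE => /orP[/eqP|/dxint]; [left|right].
have intnear a : a \in int -> near a by exact: gballW.
have nDy1 : ~~ D y1.
  apply/negP => /Dint[yx|yi]; last by rewrite yi in y1int.
  by apply: nCy1; rewrite yx.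
have Ddy : D (last y1 dy) by rewrite ldy.
(* The descent from the exit point is stopped where it first meets [D]: its edges before [u] avoid
   [D], and its last edge, from [v0] to [u], is the link. *)
have [q [u [q2 [Edy Du Dq]]]] := @first_entry _ D _ _ nDy1 Ddy.
have uint : u \in int by apply: dyint; rewrite Edy mem_cat mem_head orbT.
have qint : {subset q <= int} by move=> a aq; apply: dyint; rewrite Edy mem_cat aq.
move: pdy; rewrite Edy cat_path /= => /and3P[pq adjqu _].
set v0 := last y1 q in adjqu.
have cyck e : e \in pairmap (@ek G) c (v :: cyc) -> touches k c e.
  by apply: key_touches.
have dxk e : e \in pairmap (@ek G) x1 dx -> touches k c e.
  by apply: key_touches.
have qk e : e \in pairmap (@ek G) y1 q -> touches k c e.
  by apply: key_touches.
pose ED := pairmap (@ek G) x1 dx ++ pairmap (@ek G) c (v :: cyc).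
pose EP := pairmap (@ek G) y1 q.
have EDk e : e \in ED -> touches k c e.
  by rewrite mem_cat => /orP[/dxk|/cyck].
(* The link carries the second bit but not the first. Among the modified edges [eta] is 1 only on
   the first edge of the cycle. *)
pose z1 (i : nat * {fset G}) := let: (n, e) := i in
  if touches k c e then
    match n with
    | 0 => e \in ED ++ EP
    | 1 => e \in ek v0 u :: ED
    | 2 => e == ek c v
    | _ => z (n, e)
    end
  else z (n, e).
have z13 e : z1 (3%N, e) = z (3%N, e) by rewrite /z1; case: ifP.
have z14 e : z1 (4%N, e) = z (4%N, e) by rewrite /z1; case: ifP.
have z1z : agree_off k c z z1 by move=> n e nt n3; rewrite /z1 (negbTE nt).
pose z2 := upd z1 (3%N, [fset u]%fset) true.
have z20 e : z2 (0%N, e) = z1 (0%N, e) by [].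
have z21 e : z2 (1%N, e) = z1 (1%N, e) by [].
have z22 e : z2 (2%N, e) = z1 (2%N, e) by [].
have z24 e : z2 (4%N, e) = z1 (4%N, e) by [].
have z2z : agree_off k c z z2.
  by move=> n e nt n3; rewrite (z1z _ _ nt n3) /z2 /upd; case: n n3 => [|[|[|]]].
have z2_3 a : z (3%N, [fset a]%fset) -> z2 (3%N, [fset a]%fset).
  by rewrite /z2 /upd; case: eqP => // _; rewrite z13.
have dblD e : e \in ED -> doubly_open z2 e.
  move=> eD; rewrite /doubly_open z20 z21 /z1 (EDk _ eD) mem_cat eD inE eD orbT.
  by [].
have far_step a a' : ~~ near a -> st L z a a' -> st L z2 a a'.
  move=> na sta; apply: (st_local lf qz z2z) => //.
  by apply: (far_untouched lf _ na); case/andP: sta.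
have reachD a : D a -> reachable (wst z2) x1 a.
  have pD : path (wst z2) x1 dx.
    apply: open_path => // e ed; have : e \in ED by rewrite mem_cat ed.
    by move=> /dblD/andP[].
  have pC : path (wst z2) c (v :: cyc).
    apply: open_path => // e ed; have : e \in ED by rewrite mem_cat ed orbT.
    by move=> /dblD/andP[].
  move=> /orP[ad|ac]; first exact: path_reachable pD ad.
  apply: (@reachable_trans _ _ _ c); first by exists dx.
  by apply: path_reachable pC _; rewrite inE ac orbT.
have to_center : exists j, reachn (pstep z2) (k.+1 + k) (u, false) (c, j).
  move: Du; rewrite /D => /orP[ud|uc].
    have : exists s1 s2, dx = s1 ++ s2 /\ last x1 s1 = u.
      by case/splitPl: ud => s1 s2 ?; exists s1, s2.
    move=> [s1 [s2 [Edx l1]]].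
    move: pdx ldx sdx; rewrite Edx cat_path last_cat size_cat l1 => /andP[_ ps2] l2 ss.
    have [|j ju] := @lift_path _ z2 u s2 false ps2.
      move=> e es2; apply: dblD; rewrite mem_cat Edx pairmap_cat mem_cat l1 es2.
      by rewrite orbT.
    exists j; rewrite -l2; apply: reachn_le ju; apply: leq_trans (leq_addr _ _).
    by apply: leq_trans ss; rewrite leq_addl.
  have ucc : u \in c :: v :: cyc by rewrite inE uc orbT.
  have : exists s1 s2, v :: cyc = s1 ++ s2 /\ last c s1 = u.
    by case/splitPl: ucc => s1 s2 ?; exists s1, s2.
  move=> [s1 [s2 [Ecy l1]]].
  have l2 : last u s2 = c by rewrite -l1 -last_cat -Ecy.
  have ps2 : path (@adj G) u s2 by move: pcyc; rewrite Ecy cat_path l1 => /andP[].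
  have [|j ju] := @lift_path _ z2 u s2 false ps2.
    by move=> e es2; apply: dblD; rewrite mem_cat Ecy pairmap_cat !mem_cat l1 es2 !orbT.
  exists j; rewrite -l2; apply: reachn_le ju; apply: leq_trans (leq_addl _ _).
  by rewrite -kcyc Ecy size_cat leq_addl.
have dblcv : ek c v \in ED by rewrite mem_cat mem_head orbT.
have around j : reachn (pstep z2) k (c, j) (c, ~~ j).
  have pv : path (@adj G) v cyc by case/andP: pcyc.
  have [|s' [ps' ls' ss']] := @lift_path_even _ z2 v cyc (~~ j) pv.
  - move=> e ec; have eD : e \in ED by rewrite mem_cat inE ec !orbT.
    rewrite dblD//= z22 /z1 EDk//; apply/negP => /eqP ee.
    have sc : (1 < size cyc)%N by rewrite -ltnS -[(size cyc).+1]/(size (v :: cyc)) kcyc.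
    by have := cycle_key_once ucyc lcyc sc; rewrite -ee ec.
  - exists ((v, ~~ j) :: s'); split => /=.
    + rewrite ps' andbT /pstep /=; have /andP[-> ->] := dblD _ dblcv.
      have /andP[-> _] := pcyc; rewrite z22 /z1 EDk// eqxx /=.
      by case: (j).
    + by rewrite ls' lcyc.
    + by rewrite -kcyc.
(* Walk to [c], once around the cycle, and back by the reversed walk on the other sheet; the parity
   of the approach cancels. The lengths add up to the lower bound assumed on [L]. *)
have odd_u : odd_at L z2 u.
  have [j uj] := to_center.
  have back := reachn_sym (@pstep_sym _ z2) (pstep_flip uj).
  have := reachn_trans (reachn_trans uj (around j)) back.
  by apply: reachn_le; apply: leq_trans Lk; rewrite !addnA.
exists u => //; exists z1; split.
- have wsub a a' : reachable (wst z2) a a' -> reachable (st L z2) a a'.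
    by apply: sub_reachable => ? ?; exact: wst_st.
  exists t; last by rewrite -/z2 z24 z14.
  have r1 : reachable (st L z2) o x1.
    by exists p => //; apply: sub_path_belast fp pp => a a' /=; exact: far_step.
  have r2 := reachable_trans r1 (wsub _ _ (reachD _ Du)).
  have r3 : reachable (st L z2) o v0.
    apply: reachable_step r2 _; rewrite /st adj_sym adjqu /=; apply/orP; right.
    rewrite z21 /z1 touches_ek ?(adj_sym u)// uint /= ekC mem_head /z2 updE /=.
    by apply/asboolP.
  have pq2 : path (wst z2) y1 q.
    apply: open_path => // e eq; rewrite z20 /z1 (qk _ eq) mem_cat.
    by apply/orP; right.
  have r4 : reachable (st L z2) o y1.
    apply: reachable_trans r3 (wsub _ _ _); apply: reachable_sym; first exact: wst_sym.
    by exists q.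
  apply: reachable_trans r4 _; exists s => //.
  move: ps fs {ls}; case: s => //= a s /andP[sta ps] /andP[na fs].
  have [ya _] := andP sta.
  apply/andP; split.
    apply: (st_local lf qz z2z) sta => //.
    rewrite touches_ek// negb_or y1int /=; apply: contra na; exact: intnear.
  elim: s a {sta ya} ps na fs => //= a' s IH a /andP[st1 ps] na /andP[na' fs].
  by rewrite far_step//= IH.
- have qz1 : quiet k L c z1 by move=> a an; rewrite z13 qz.
  have zz1 : agree_off k c z1 z by move=> n e nt n3; rewrite z1z.
  have uquiet : z1 (3%N, [fset u]%fset) = false.
    by apply: qz1; apply: (gball_le _ (intnear _ uint)); rewrite leq_addr.
  rewrite upd_id// => -[a oa]; rewrite z14 => za.
  (* Invariant of the cluster of [o] when the enhancement at [u] is off. Near [c] only first bits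
     matter: those of [D] do not lead out of [D], and those of the exit path start at a vertex which
     is neither in [D] nor in the part of [C] outside the ball. *)
  have : (C a /\ a \notin int) \/ D a.
    move: a oa {za}; apply: reachable_ind.
      have [on|non] := boolP (near o); last first.
        left; split; [exact: reachable_refl|by apply: contra non => /intnear].
      right; move: fp lp; case: (p) => [|a p'] /=; last by rewrite on.
      by move=> _ ->; rewrite /D mem_head.
    move=> a a' Qa sta.
    have [aa' _] := andP sta.
    have [te|nt] := boolP (touches k c (ek a a')).
      have anear : near a.
        by apply: contraT => na; have := far_untouched lf aa' na; rewrite te.
      have := quiet_st qz1 _ sta.
      rewrite (gball_le _ anear) ?leq_addr// => /(_ isT).
      rewrite /z1 te mem_cat => /orP[|eEP].
        rewrite mem_cat => eED; right; case/orP: eED => ee.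
          by rewrite /D (key_endpoint ee)// fset22.
        have := key_endpoint ee (fset22 _ _); rewrite inE => /orP[/eqP->//|ac].
        by rewrite /D ac orbT.
      exfalso; have := key_endpoint eEP (fset21 _ _) => aq.
      case: Qa => [[Ca aint]|Da]; last by have := allP Dq _ aq; rewrite /= Da.
      move: aq; rewrite inE => /orP[/eqP ay|/qint]; last by rewrite (negbTE aint).
      by apply: nCy1; rewrite -ay.
    left; have nt' := nt; rewrite touches_ek// negb_or in nt'.
    have [ai a'i] := andP nt'; split => //.
    have Ca : C a.
      by case: Qa => [[]//|/Dint[->//|ai']]; rewrite ai' in ai.
    apply: reachable_step Ca _; apply: (st_local lf qz1 zz1) nt sta => w.
    by rewrite z13.
  case=> [[Ca _]|Da]; first by rewrite nhz in za.
  have an : near a by case: (Dint _ Da) => [->//|/intnear].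
  by have := gy an; rewrite -z_not0// za.
- move=> n e; rewrite /z1; case: ifP => te.
    case: n => [|[|[|n]]]; [by right..|left]. by rewrite z_not0.
  left; rewrite /z /upd xpair_eqE; case: eqP => //= _; case: eqP => // ee.
  by rewrite ee touches_ek// cint in te.
Qed.

End Gadget.

(** * From a pivotal edge to a pivotal enhancement or a pivotal green vertex *)

Section TurnOff.
Variables (K : eqType) (P : (K -> bool) -> Prop).
Implicit Types (ks : seq K) (x z : K -> bool).

Definition off ks x : K -> bool := fun j => (j \notin ks) && x j.

Lemma off_cons i ks x : off (i :: ks) x = upd (off ks x) i false.
Proof.
apply/funext => j; rewrite /off /upd inE negb_or; case: (j == i) => //=.
Qed.

(** The bits are switched off one after the other; the one whose removal destroys [P] is pivotal at
    that moment. *)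
Lemma turn_off ks x : P x -> P (off ks x) \/ exists i z,
  [/\ i \in ks, z i, P z, ~ P (upd z i false) &
      forall j, z j = x j \/ (j \in ks) /\ z j = false].
Proof.
move=> Px; elim: ks => [|i ks [IH|[j [z [jks zj Pz nPz zx]]]]].
- by left; rewrite (_ : off [::] x = x)//; apply/funext.
- rewrite off_cons; have [|nP] := pselect (P (upd (off ks x) i false)); first by left.
  right; exists i, (off ks x); split => //; first by rewrite mem_head.
    by apply/negPn/negP => /negbTE z0; apply: nP; rewrite upd_id.
  move=> j; rewrite /off inE; case: (j \in ks) => /=; last by left.
  by right; rewrite orbT.
- right; exists j, z; split => //; first by rewrite inE jks orbT.
  move=> l; have [->|[lks ->]] := zx l; [by left|right].
  by rewrite inE lks orbT.
Qed.

End TurnOff.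

Section Pivotal.
Variables (G : sgraph) (L : nat) (o : G).
Implicit Types (x y z : nat * {fset G} -> bool).

Definition pivotal i x := hit L o (upd x i true) /\ ~ hit L o (upd x i false).

Lemma pivotal_upd i x b : pivotal i (upd x i b) <-> pivotal i x.
Proof. by rewrite /pivotal !upd_upd. Qed.

Lemma odd_at_mono x y u : (forall n e, (n < 2)%N -> x (n, e) -> y (n, e)) ->
  (forall e, x (2%N, e) = y (2%N, e)) -> odd_at L x u -> odd_at L y u.
Proof.
move=> xy xy2 [s [ps ls ss]]; exists s; split => //; apply: sub_path ps => a b.
by rewrite /pstep => /and4P[-> /xy-> // /xy-> //]; rewrite xy2.
Qed.

Lemma st_mono x y u v : (forall n e, (n != 2)%N -> x (n, e) -> y (n, e)) ->
  (forall e, x (2%N, e) = y (2%N, e)) -> st L x u v -> st L y u v.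
Proof.
move=> xy xy2 /andP[uv]; rewrite /st uv /= => /orP[/xy->//|/and3P[/xy-> // /xy-> //]].
move=> /asboolP odd; apply/orP; right; apply/asboolP; apply: odd_at_mono odd => // n e.
by case: n => [|[|]] // _; exact: xy.
Qed.

(** There is no monotonicity in the bits of [eta], which must agree; accordingly their density stays
    constant along the curve. *)
Lemma hit_mono x y : (forall n e, (n != 2)%N -> x (n, e) -> y (n, e)) ->
  (forall e, x (2%N, e) = y (2%N, e)) -> hit L o x -> hit L o y.
Proof.
move=> xy xy2 [t ot xt]; exists t; last exact: xy.
by apply: sub_reachable ot => a b; exact: st_mono.
Qed.

End Pivotal.

Section LocalModificationLemma.
Variables (G : sgraph) (lf : locally_finite G) (k L : nat).
Hypothesis Lk : (k.+1 + k + k + k.+1 + k <= L)%N.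
Hypothesis k3 : (2 < k)%N.
Variables (o c b v : G) (cyc : seq G).
Hypotheses (cb : adj c b) (pcyc : path (@adj G) c (v :: cyc)).
Hypotheses (lcyc : last v cyc = c) (ucyc : uniq (v :: cyc)).
Hypotheses (kcyc : size (v :: cyc) = k).

(** After opening the edge, the enhancements and then the green vertices near [c] are switched off.
    If the hit is lost on the way, the guilty bit is pivotal, and a guilty green vertex is still
    green; otherwise [gadget] applies. Bits of kinds 3 and 4 are only ever set to false, the value
    whose weight stays bounded below. *)
Lemma local_modification x : pivotal L o (0%N, ek c b) x ->
  exists y, ((exists2 u, u \in gball (k.+1 + L) c & pivotal L o (3%N, [fset u]%fset) y) \/
     (exists2 t, t \in gball k.+1 c &
        y (4%N, [fset t]%fset) /\ pivotal L o (4%N, [fset t]%fset) y)) /\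
  forall n e, [\/ y (n, e) = x (n, e), (n < 3)%N /\ touches k c e,
     [/\ n = 3, e \in [seq [fset u]%fset | u <- gball (k.+1 + L) c] & y (n, e) = false] |
     [/\ n = 4, e \in [seq [fset u]%fset | u <- gball k.+1 c] & y (n, e) = false] ].
Proof.
move=> [h1 h0]; set x1 := upd x _ true in h1.
have tcb : touches k c (ek c b) by rewrite touches_ek// gball_center.
have x1x n e : x1 (n, e) = x (n, e) \/ (n < 3)%N /\ touches k c e.
  by rewrite /x1 /upd; case: eqP => [[-> ->]|]; [right|left].
pose zs := [seq (3%N, [fset u]%fset) | u <- gball (k.+1 + L) c].
have [h2|[i [z [izs zi hz nhz zx]]]] := turn_off zs h1; last first.
  move: izs => /mapP[u uc ii]; exists z; split.
    left; exists u => //; rewrite -ii; split => //; by rewrite upd_id.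
  move=> n e; have [->|[/mapP[w wc [-> ->]] ->]] := zx (n, e).
    by have [->|] := x1x n e; [apply: Or41|move=> ?; apply: Or42].
  by apply: Or43; split => //; apply: map_f.
set x2 := off zs x1 in h2.
have x2x n e : [\/ x2 (n, e) = x (n, e), (n < 3)%N /\ touches k c e |
     [/\ n = 3, e \in [seq [fset u]%fset | u <- gball (k.+1 + L) c] & x2 (n, e) = false] ].
  have [|/negP] := boolP ((n, e) \in zs).
    move=> ez; have : x2 (n, e) = false by rewrite /x2 /off ez.
    by move: ez => /mapP[w wc [-> ->]] ->; apply: Or33; split => //; apply: map_f.
  move=> /negP/negbTE ez; rewrite /x2 /off ez /=.
  by have [->|] := x1x n e; [apply: Or31|move=> ?; apply: Or32].
pose gs := [seq (4%N, [fset u]%fset) | u <- gball k.+1 c].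
have [h3|[i [z [izs zi hz nhz zx]]]] := turn_off gs h2; last first.
  move: izs => /mapP[u uc ii]; exists z; split.
    right; exists u => //; rewrite -ii; split => //; split => //; by rewrite upd_id.
  move=> n e; have [->|[/mapP[w wc [-> ->]] ->]] := zx (n, e).
    by have [->|?|[? ? ->]] := x2x n e; [apply: Or41|apply: Or42|apply: Or43].
  by apply: Or44; split => //; apply: map_f.
set x3 := off gs x2 in h3.
have x3x n e : [\/ x3 (n, e) = x (n, e), (n < 3)%N /\ touches k c e,
     [/\ n = 3, e \in [seq [fset u]%fset | u <- gball (k.+1 + L) c] & x3 (n, e) = false] |
     [/\ n = 4, e \in [seq [fset u]%fset | u <- gball k.+1 c] & x3 (n, e) = false] ].
  have [|/negP] := boolP ((n, e) \in gs).
    move=> ez; have : x3 (n, e) = false by rewrite /x3 /off ez.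
    by move: ez => /mapP[w wc [-> ->]] ->; apply: Or44; split => //; apply: map_f.
  move=> /negP/negbTE ez; rewrite /x3 /off ez /=.
  by have [->|?|[? ? ->]] := x2x n e; [apply: Or41|apply: Or42|apply: Or43].
have x3le i : x3 i -> x1 i by move=> /andP[_ /andP[_]].
have q3 : quiet k L c x3.
  move=> u ub; apply/negbTE; rewrite /x3 /off /x2 /off !negb_and; apply/orP; right.
  by apply/orP; left; rewrite negbK; apply: map_f.
have g3 t : t \in gball k.+1 c -> x3 (4%N, [fset t]%fset) = false.
  move=> ub; apply/negbTE; rewrite /x3 /off !negb_and; apply/orP; left.
  by rewrite negbK; apply: map_f.
have h30 : ~ hit L o (upd x3 (0%N, ek c b) false).
  move=> h; apply: h0; apply: hit_mono h => [n e _|e].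
    rewrite /upd; case: eqP => // ne /x3le; rewrite /x1 /upd.
    by case: eqP.
  rewrite /upd /=; rewrite /x3 /x2 /off /x1 /upd /=.
  have -> : (2%N, e) \notin gs by apply/mapP => -[].
  by have -> : (2%N, e) \notin zs by apply/mapP => -[].
have [u ub [z1 [z1h z1n z1x]]] := gadget lf Lk cb pcyc lcyc ucyc kcyc k3 q3 g3 h3 h30.
exists z1; split.
  left; exists u; last by split.
  by apply: (gball_le _ (gballW ub)); rewrite leq_addr.
move=> n e; have [->|?] := z1x n e; last exact: Or42.
exact: x3x.
Qed.

End LocalModificationLemma.

Lemma ler_sum_uniq_sub (R : numDomainType) (T : eqType) (s1 s2 : seq T) (F : T -> R) :
  uniq s1 -> {subset s1 <= s2} -> (forall i, 0 <= F i) ->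
  \sum_(i <- s1) F i <= \sum_(i <- s2) F i.
Proof.
elim: s1 s2 => [|i s1 IH] s2 /=; first by move=> _ _ F0; rewrite big_nil sumr_ge0.
move=> /andP[is1 us1] s12 F0.
have is2 : i \in s2 by apply: s12; rewrite mem_head.
rewrite big_cons (perm_big _ (perm_to_rem is2)) /= big_cons lerD2l IH// => j js1.
have ji : j != i by apply: contraNneq is1 => <-.
have : j \in s2 by apply: s12; rewrite inE js1 orbT.
by rewrite (perm_mem (perm_to_rem is2)) inE (negbTE ji).
Qed.

Lemma Ex_coord (R : realType) (I : eqType) (r : I -> R) s i (F : (I -> bool) -> R) :
  i \in s -> (forall x b, F (upd x i b) = F x) ->
  Ex r s (fun x => (x i)%:R * F x) = fun x => r i * Ex r s F x.
Proof.
move=> si Fi; rewrite -(Ex_mem r _ si) -ExZ; congr (Ex r s _).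
by apply/funext => x; rewrite /avg !updE !Fi /= mulr1n mulr0n; ring.
Qed.

Section BallSizes.
Variables (G : sgraph) (D : nat).
Hypothesis degD : forall u : G, (#|` nbr u| <= D)%N.

Lemma card_gball n (u : G) : (#|` gball n u| <= D.+1 ^ n)%N.
Proof.
elim: n => [|n IH]; first by rewrite cardfs1.
rewrite -[gball _ _]/(gball n u `|` \bigcup_(v <- gball n u) nbr v)%fset.
have bnd (s : seq G) : (#|` \bigcup_(v <- s) nbr v|%fset <= size s * D)%N.
  elim: s => [|v s IHs]; first by rewrite big_nil cardfs0.
  rewrite big_cons /= mulSn; apply: leq_trans (leq_add (degD v) IHs).
  by rewrite cardfsU leq_subr.
apply: (@leq_trans (#|` gball n u| + size (gball n u) * D)).
  by apply: leq_trans (leq_add (leqnn _) (bnd _)); rewrite cardfsU leq_subr.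
by rewrite -mulnS expnSr leq_mul2r IH orbT.
Qed.

Lemma size_near_edges k (c : G) : (size (near_edges k c) <= D.+1 ^ k * D)%N.
Proof.
rewrite size_allpairs_dep sumnE big_map.
apply: (@leq_trans (\sum_(v <- gball k c) D)); first exact: leq_sum.
by rewrite big_const_seq iter_addn_0 count_predT mulnC leq_mul2r card_gball orbT.
Qed.

End BallSizes.

(** * The differential inequality *)

Section AizenmanGrimmett.
Variables (R : realType) (G : sgraph) (lf : locally_finite G) (k L D : nat) (o : G).
Hypothesis Lk : (k.+1 + k + k + k.+1 + k <= L)%N.
Hypothesis k3 : (2 < k)%N.
Hypothesis cycles : forall c : G, exists v cyc, [/\ path (@adj G) c (v :: cyc),
  last v cyc = c, uniq (v :: cyc) & size (v :: cyc) = k].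
Hypothesis degD : forall u : G, (#|` nbr u| <= D)%N.
Notation K := (nat * {fset G})%type.
Notation M := (k.+1 + L)%N.

Definition modified c : seq K :=
  [seq (n, e) | n <- [:: 0; 1; 2]%N, e <- near_edges k c] ++
  [seq (3%N, [fset u]%fset) | u <- gball M c] ++
  [seq (4%N, [fset u]%fset) | u <- gball k.+1 c].

Definition modified_bound : nat := (3 * (D.+1 ^ k * D) + (D.+1 ^ M + D.+1 ^ k.+1))%N.

Lemma size_modified c : (size (modified c) <= modified_bound)%N.
Proof.
rewrite !size_cat !size_map.
have sk := size_near_edges degD k c.
rewrite leq_add//; first by rewrite !mulSn mul0n; do 3!apply: leq_add => //.
by rewrite leq_add// card_gball.
Qed.

Definition pv (i : K) (x : K -> bool) : R := `[< pivotal L o i x >]%:R.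

Lemma pv_upd i x b : pv i (upd x i b) = pv i x.
Proof. by congr ((nat_of_bool _)%:R); apply: asbool_equiv_eq; exact: pivotal_upd. Qed.

Definition hit_ind (x : K -> bool) : R := `[< hit L o x >]%:R.

Lemma diff_hit n e : n != 2%N -> bdiff (n, e) hit_ind = pv (n, e).
Proof.
move=> n2; apply/funext => x; rewrite /bdiff /hit_ind /pv /pivotal.
have mono : hit L o (upd x (n, e) false) -> hit L o (upd x (n, e) true).
  apply: hit_mono => [m e' _|e'].
    by rewrite /upd; case: eqP.
  by rewrite /upd xpair_eqE eq_sym (negbTE n2).
have [h0|h0] := pselect (hit L o (upd x (n, e) false)).
  rewrite (asboolT h0) (asboolT (mono h0)) subrr.
  by rewrite asboolF// => -[].
rewrite (asboolF h0) subr0; congr ((nat_of_bool _)%:R).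
by apply: asbool_equiv_eq; split => [|[]].
Qed.

Variables (r : K -> R) (s : seq K) (d h : R) (x0 : K -> bool).
Hypotheses (r01 : prob_weight r) (d0 : 0 < d) (rh : forall e, r (4%N, e) = h).
Hypothesis rd : forall n e, (n < 3)%N -> d <= r (n, e) <= 1 - d.
Hypothesis rd3 : forall e, d <= 1 - r (3%N, e).
Hypothesis rd4 : d <= 1 - h.

Let K0 := (1 + d^-1) ^+ modified_bound.
Let a u := Ex r s (pv (3%N, [fset u]%fset)) x0.
Let g t := Ex r s (pv (4%N, [fset t]%fset)) x0.

Let a_ge0 u : 0 <= a u. Proof. exact: Ex_ge0. Qed.
Let g_ge0 u : 0 <= g u. Proof. exact: Ex_ge0. Qed.
Let h_ge0 : 0 <= h. Proof. by rewrite -(rh fset0); have /andP[] := r01 (4%N, fset0). Qed.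

(** Pivotality of a bit is independent of its state, so demanding that the pivotal vertex be green
    costs exactly [h]. Enhancements need no such factor: there only pivotality is required, not that
    the bit be on. *)
Lemma edge_pivotal_le c b : adj c b -> {subset modified c <= s} ->
  Ex r s (pv (0%N, ek c b)) x0 <=
  K0 * (\sum_(u <- gball M c) a u + h * \sum_(t <- gball k.+1 c) g t).
Proof.
move=> cb Js.
pose Gf (x : K -> bool) : R := \sum_(u <- gball M c) pv (3%N, [fset u]%fset) x +
  \sum_(t <- gball k.+1 c) (x (4%N, [fset t]%fset))%:R * pv (4%N, [fset t]%fset) x.
have Gf0 x : 0 <= Gf x by rewrite addr_ge0// sumr_ge0// => t _; rewrite mulr_ge0.
have EGf : Ex r s Gf x0 = \sum_(u <- gball M c) a u + h * \sum_(t <- gball k.+1 c) g t.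
  rewrite /Gf ExD !Ex_sum; congr (_ + _); rewrite mulr_sumr.
  apply: eq_big_seq => t tc; rewrite Ex_coord ?rh//; last by move=> x y; exact: pv_upd.
  by apply: Js; rewrite !mem_cat map_f ?orbT.
rewrite -EGf; apply: (@le_trans _ _ ((1 + d^-1) ^+ size (modified c) * Ex r s Gf x0)).
  apply: Ex_finite_modification => // x.
  have [px|px] := pselect (pivotal L o (0%N, ek c b) x); last first.
    by left; rewrite /pv asboolF.
  right; have [v [cyc [pc lc uc kc]]] := cycles c.
  have [y [Hy yx]] := local_modification lf Lk k3 cb pc lc uc kc px.
  exists y; split.
  - rewrite /pv asboolT// /Gf; case: Hy => [[u uc' pu]|[t tc [yt pt]]].
      rewrite (big_rem u)//= {1}/pv asboolT//= -addrA lerDl addr_ge0//.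
        by apply: sumr_ge0.
      by apply: sumr_ge0 => t _; rewrite mulr_ge0.
    rewrite [X in _ + X](big_rem t)//= {2}/pv yt asboolT// mul1r addrCA lerDl.
    rewrite addr_ge0//; first by apply: sumr_ge0.
    by apply: sumr_ge0 => t' _; rewrite mulr_ge0.
  - move=> [n e] nJ; have [//|[n3 te]|[n3 eu _]|[n4 eu _]] := yx n e; exfalso.
    + move/negP: nJ; apply; rewrite mem_cat; apply/orP; left.
      by apply/allpairsP; exists (n, e); split => //; case: n n3 => [|[|[|]]].
    + move/negP: nJ; apply; rewrite !mem_cat; apply/orP; right; apply/orP; left.
      by rewrite n3; move: eu => /mapP[u ub ->]; apply/mapP; exists u.
    + move/negP: nJ; apply; rewrite !mem_cat; apply/orP; right; apply/orP; right.
      by rewrite n4; move: eu => /mapP[u ub ->]; apply/mapP; exists u.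
  - move=> [n e] _; have [->|[n3 te]|[n3 eu ->]|[n4 eu ->]] := yx n e; [by left|right..].
    + have /andP[dr rd'] := rd e n3; rewrite /weight; case: ifP => _ //.
      by rewrite lerBrDl -lerBrDr.
    + by rewrite /weight n3.
    + by rewrite /weight n4 rh.
rewrite ler_wpM2r//; first exact: Ex_ge0.
by rewrite ler_weXn2l ?size_modified// lerDl invr_ge0 ltW.
Qed.

Lemma gball_sum_le n (f : G -> R) m : (m <= M)%N -> (forall u, 0 <= f u) ->
  \sum_(c <- gball n o) \sum_(u <- gball m c) f u <=
  (D.+1 ^ M)%:R * \sum_(u <- gball (n + M) o) f u.
Proof.
move=> mM f0.
apply: (@le_trans _ _ (\sum_(c <- gball n o)
    \sum_(u <- gball (n + M) o | u \in gball m c) f u)).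
  rewrite big_seq [leRHS]big_seq; apply: ler_sum => c cn.
  rewrite -[leRHS]big_filter; apply: ler_sum_uniq_sub => //.
  move=> u uc; rewrite mem_filter uc /=.
  exact: (gball_trans lf cn (gball_le mM uc)).
under eq_bigr do rewrite big_mkcond.
rewrite exchange_big /= mulr_sumr; apply: ler_sum => u _.
rewrite -big_mkcond /= big_const_seq iter_addr_0 -[leLHS]mulr_natl ler_wpM2r// ler_nat.
apply: leq_trans (_ : #|` gball m u| <= _)%N; last first.
  apply: leq_trans (card_gball degD _ _) _. exact: leq_pexp2l.
rewrite -size_filter; apply: uniq_leq_size; first by rewrite filter_uniq// fset_uniq.
by move=> c; rewrite mem_filter => /andP[uc _]; exact: gball_sym.
Qed.

Lemma edge_pivotal_sum_le n : (forall c, c \in gball n o -> {subset modified c <= s}) ->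
  \sum_(c <- gball n o) \sum_(b <- nbr c) Ex r s (pv (0%N, ek c b)) x0 <=
  D%:R * K0 * (D.+1 ^ M)%:R *
  (\sum_(u <- gball (n + M) o) a u + h * \sum_(t <- gball (n + M) o) g t).
Proof.
move=> Js.
have K00 : 0 <= K0 by rewrite exprn_ge0// addr_ge0// invr_ge0 ltW.
pose S c := \sum_(u <- gball M c) a u + h * \sum_(t <- gball k.+1 c) g t.
have S0 c : 0 <= S c by rewrite addr_ge0 ?sumr_ge0// mulr_ge0// sumr_ge0.
apply: (@le_trans _ _ (\sum_(c <- gball n o) D%:R * K0 * S c)).
  rewrite big_seq [leRHS]big_seq; apply: ler_sum => c cn.
  apply: (@le_trans _ _ (\sum_(b <- nbr c) K0 * S c)).
    rewrite big_seq [leRHS]big_seq; apply: ler_sum => b; rewrite in_nbr// => cb.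
    by apply: edge_pivotal_le => //; exact: Js.
  rewrite big_const_seq iter_addr_0 count_predT -[leLHS]mulr_natl -mulrA ler_wpM2r//.
    by rewrite mulr_ge0.
  by rewrite ler_nat; exact: degD.
rewrite -mulr_sumr -!mulrA ler_wpM2l// ler_wpM2l// big_split /= mulrDr.
apply: lerD; first exact: gball_sum_le.
rewrite -mulr_sumr mulrCA ler_wpM2l//; apply: gball_sum_le => //.
by rewrite leq_addr.
Qed.

End AizenmanGrimmett.

(** * Monotonicity of the hitting probability along the curve *)

Section Interpolation.
Variables (R : realType) (G : sgraph) (lf : locally_finite G) (k L D : nat) (o : G).
Hypothesis Lk : (k.+1 + k + k + k.+1 + k <= L)%N.
Hypothesis k3 : (2 < k)%N.
Hypothesis cycles : forall c : G, exists v cyc, [/\ path (@adj G) c (v :: cyc),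
  last v cyc = c, uniq (v :: cyc) & size (v :: cyc) = k].
Hypothesis degD : forall u : G, (#|` nbr u| <= D)%N.
Notation K := (nat * {fset G})%type.
Notation M := (k.+1 + L)%N.

Definition bits n : seq K := undup (
  [seq (j, e) | j <- [:: 0; 1; 2]%N, e <- near_edges n o] ++
  [seq (3%N, [fset u]%fset) | u <- gball n o] ++
  [seq (4%N, [fset u]%fset) | u <- gball n o]).

Lemma near_edgesP n (c : G) e : reflect (exists u v, [/\ u \in gball n c, adj u v & e = ek u v])
  (e \in near_edges n c).
Proof.
apply: (iffP allpairsPdep) => [[u [v [ub uv ->]]]|[u [v [ub uv ->]]]]; exists u, v.
  by rewrite in_nbr in uv.
by rewrite in_nbr.
Qed.

Lemma near_edges_sub m n (c : G) e : c \in gball m o -> e \in near_edges n c ->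
  e \in near_edges (m + n) o.
Proof.
move=> co /near_edgesP[u [v [uc uv ->]]]; apply/near_edgesP; exists u, v; split => //.
exact: (gball_trans lf co uc).
Qed.

Lemma near_edges_le m n e : (m <= n)%N -> e \in near_edges m o -> e \in near_edges n o.
Proof.
move=> mn /near_edgesP[u [v [uc uv ->]]]; apply/near_edgesP; exists u, v; split => //.
exact: (gball_le mn uc).
Qed.

Lemma mem_bits n j e : ((j, e) \in bits n) =
  [|| (j < 3)%N && (e \in near_edges n o),
      (j == 3%N) && (e \in [seq [fset u]%fset | u <- gball n o]) |
      (j == 4%N) && (e \in [seq [fset u]%fset | u <- gball n o]) ].
Proof.
rewrite mem_undup mem_cat [X in _ || X = _]mem_cat; congr [|| _, _ | _].
- apply/allpairsP/andP => [[[a b] [/= aj be [-> ->]]]|[j3 en]].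
    by split => //; move: aj; rewrite !inE => /or3P[]/eqP->.
  by exists (j, e); split => //; case: j j3 => [|[|[|]]].
- apply/mapP/andP => [[u un [-> ->]]|[/eqP-> /mapP[u un ->]]]; last by exists u.
  by rewrite eqxx map_f.
- apply/mapP/andP => [[u un [-> ->]]|[/eqP-> /mapP[u un ->]]]; last by exists u.
  by rewrite eqxx map_f.
Qed.

Lemma modified_bits n c : c \in gball n o -> {subset modified k L c <= bits (n + M)}.
Proof.
move=> cn [j e]; rewrite mem_bits mem_cat [X in _ || X]mem_cat => /or3P[].
- move=> /allpairsP[[a b] [/= aj be [-> ->]]]; apply/or3P/Or31.
  apply/andP; split; first by move: aj; rewrite !inE => /or3P[]/eqP->.
  apply: (@near_edges_le (n + k)); last exact: (near_edges_sub cn be).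
  by rewrite leq_add2l addSn -addnS leq_addr.
- move=> /mapP[u un [-> ->]]; apply/or3P/Or32; rewrite eqxx /=.
  by apply: map_f; exact: (gball_trans lf cn un).
- move=> /mapP[u un [-> ->]]; apply/or3P/Or33; rewrite eqxx /=.
  apply: map_f; apply: (gball_trans lf cn); apply: (gball_le _ un).
  by rewrite leq_addr.
Qed.

Variables (p1 pl q C h0 : R) (n : nat).

(* Outside the ball of radius n, the edges keep the constant density pl, so that
   every edge whose density varies has its local modification inside the finite
   region carrying the bits. *)
Definition rate (t : R) (i : K) : R :=
  match i.1 with
  | 0 => if i.2 \in near_edges n o then p1 - t else pl
  | 1 => pl
  | 2 => q
  | 3 => C * t
  | _ => h0 * (1 + 2 * C * t)
  end.

Definition drate (i : K) : R :=
  match i.1 with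
  | 0 => if i.2 \in near_edges n o then - 1 else 0
  | 1 | 2 => 0
  | 3 => C
  | _ => h0 * (2 * C)
  end.

Lemma is_derive_rate (t : R) (i : K) : is_derive t 1 (rate ^~ i) (drate i).
Proof.
have aff (a b : R) : is_derive t 1 (fun u : R => a + b * u) b.
  have H := is_deriveD (is_derive_cst a t 1) (is_deriveZ b (is_derive_id t 1)).
  apply: is_derive_eq; rewrite add0r /GRing.scale /=; ring.
case: i => [[|[|[|[|j]]]] e]; rewrite /rate /drate /=.
- case: ifP => _; last exact: is_derive_cst.
  rewrite (_ : (fun u => _) = fun u => p1 + - 1 * u); first exact: aff.
  by apply/funext => u; ring.
- exact: is_derive_cst.
- exact: is_derive_cst.
- rewrite (_ : (fun u => _) = fun u => 0 + C * u); first exact: aff.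
  by apply/funext => u; ring.
- rewrite (_ : (fun u => _) = fun u => h0 + h0 * (2 * C) * u); first exact: aff.
  by apply/funext => u; ring.
Qed.

Variables (d T : R).
Hypotheses (d0 : 0 < d) (d2 : d <= 1 / 2) (pld : d <= pl) (p1d : p1 <= 1 - d)
  (qd : d <= q <= 1 - d) (pT : pl <= p1 - T) (T0 : 0 <= T) (CT : 2 * C * T <= 1)
  (h00 : 0 <= h0) (h02 : 2 * h0 <= 1 / 2).
Hypothesis CE : C = D%:R * (1 + d^-1) ^+ modified_bound k L D * (D.+1 ^ M)%:R.

Let C0 : 0 <= C.
Proof. by rewrite CE !mulr_ge0// exprn_ge0// addr_ge0// invr_ge0 ltW. Qed.

Section AtTime.
Variables (t : R).
Hypotheses (t0 : 0 <= t) (tT : t <= T).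

Let Ct : C * t <= 1 / 2.
Proof. have : C * t <= C * T by rewrite ler_wpM2l. by move: CT; lra. Qed.

Let Ct0 : 0 <= C * t. Proof. exact: mulr_ge0. Qed.

Lemma rate_h : h0 <= h0 * (1 + 2 * C * t) <= 2 * h0.
Proof.
have e1 : 0 <= h0 * (C * t) by rewrite mulr_ge0.
have e2 : 0 <= h0 * (1 / 2 - C * t) by rewrite mulr_ge0// subr_ge0.
by apply/andP; split; nra.
Qed.

Lemma rate_bound j e : (j < 3)%N -> d <= rate t (j, e) <= 1 - d.
Proof.
case: j => [|[|[|j]]]//= _; rewrite /rate /=.
- by case: ifP => _; apply/andP; split; move: pld p1d pT T0 t0 tT; lra.
- by apply/andP; split; move: pld p1d pT T0 t0 tT; lra.
Qed.

Lemma rate_weight : prob_weight (rate t).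
Proof.
move=> [j e]; have [j3|j3] := ltnP j 3.
  by have /andP[a b] := rate_bound e j3; apply/andP; split; move: d0; lra.
case: j j3 => [|[|[|[|j]]]]//= _; rewrite /rate /=.
  by apply/andP; split => //; move: Ct; lra.
by have /andP[a b] := rate_h; apply/andP; split; move: h00 h02; lra.
Qed.

(** Russo's formula gives [C] times the pivotal enhancements plus [2 C h0] times the pivotal green
    vertices, minus the pivotal edges. The latter are at most [C] times the sum of the pivotal
    enhancements and of [h] times the pivotal green vertices, and [h] is at most [2 h0] at all times
    considered. *)
Lemma hit_derivative_ge0 (x0 : K -> bool) :
  0 <= \sum_(i <- bits (n + M)) drate i *
     Ex (rate t) (bits (n + M)) (bdiff i (hit_ind R L o)) x0.
Proof.
set s := bits (n + M); have us : uniq s by exact: undup_uniq.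
pose P i := Ex (rate t) s (pv R L o i) x0.
have P0 i : 0 <= P i by apply: Ex_ge0 => //; exact: rate_weight.
have split3 : \sum_(i <- s) drate i * Ex (rate t) s (bdiff i (hit_ind R L o)) x0 =
   C * \sum_(i <- s | i.1 == 3%N) P i + 2 * C * h0 * \sum_(i <- s | i.1 == 4%N) P i
   - \sum_(i <- s | (i.1 == 0%N) && (i.2 \in near_edges n o)) P i.
  rewrite !mulr_sumr -sumrN.
  rewrite [X in _ = X + _ + _]big_mkcond [X in _ = _ + X + _]big_mkcond.
  rewrite [X in _ = _ + _ + X]big_mkcond -!big_split /=.
  apply: eq_big_seq => -[j e] js.
  have [->|jn] := eqVneq j 2%N; first by rewrite /drate /=; ring.
  rewrite diff_hit// -/(P _); move: js; rewrite mem_bits /drate /=.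
  case: j jn => [|[|[|[|[|j]]]]] //= _ _; try (by ring).
  by case: ifP => _; ring.
rewrite split3.
have main := @edge_pivotal_sum_le R G lf k L D o Lk k3 cycles degD (rate t) s d
  (h0 * (1 + 2 * C * t)) x0 rate_weight d0 _ _ _ _ n (@modified_bits n).
have {}main := main (fun e => erefl) rate_bound.
have {}main : \sum_(c <- gball n o) \sum_(b <- nbr c) P (0%N, ek c b) <=
    C * (\sum_(u <- gball (n + M) o) P (3%N, [fset u]%fset) +
    h0 * (1 + 2 * C * t) * \sum_(t0 <- gball (n + M) o) P (4%N, [fset t0]%fset)).
  rewrite -CE in main; apply: main.
    by move=> e; rewrite /rate /=; move: d2 Ct; lra.
  by have /andP[_] := rate_h; move: h02 d2; lra.
have l0 : \sum_(i <- s | (i.1 == 0%N) && (i.2 \in near_edges n o)) P i <=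
    \sum_(c <- gball n o) \sum_(b <- nbr c) P (0%N, ek c b).
  rewrite -big_filter.
  rewrite -(big_allpairs_dep (h := fun c b => (0%N, ek c b) : K) (r1 := gball n o)
    (r2 := fun c => nbr c) (F := P)).
  apply: ler_sum_uniq_sub => //; first exact: filter_uniq.
  move=> [j e]; rewrite mem_filter /= => /andP[/andP[/eqP-> en] _].
  have /near_edgesP[u [v [un uv ->]]] := en.
  by apply/allpairsPdep; exists u, v; rewrite in_nbr.
have inj (j : nat) : injective (fun u : G => (j, [fset u]%fset) : K).
  by move=> u v [] /fset1_inj.
have l3 j : (j == 3%N) || (j == 4%N) -> \sum_(u <- gball (n + M) o) P (j, [fset u]%fset) <=
    \sum_(i <- s | i.1 == j) P i.
  move=> j34; rewrite -(big_map (fun u : G => (j, [fset u]%fset) : K) xpredT P).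
  rewrite -[leRHS]big_filter; apply: ler_sum_uniq_sub => //.
    by rewrite map_inj_uniq// fset_uniq.
  move=> _ /mapP[u un ->]; rewrite mem_filter /= eqxx mem_bits /=.
  by case/orP: j34 => /eqP-> /=; rewrite map_f// ?orbT.
have := l3 3%N isT; have := l3 4%N isT; move: main l0.
set S0 := \sum_(i <- s | _) _; set S4 := \sum_(i <- s | _) _; set S3 := \sum_(i <- s | _) _.
set A0 := \sum_(c <- _) _; set A3 := \sum_(u <- _) _; set A4 := \sum_(u <- _) _.
move=> main l0 l4 l3'.
have A40 : 0 <= A4 by apply: sumr_ge0 => ? _; exact: P0.
have e1 : C * A3 <= C * S3 by rewrite ler_wpM2l.
have e2 : C * (h0 * (1 + 2 * C * t) * A4) <= 2 * C * h0 * S4.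
  have /andP[_ hh] := rate_h.
  have f1 : h0 * (1 + 2 * C * t) * A4 <= 2 * h0 * S4.
    apply: (@le_trans _ _ (2 * h0 * A4)); first by rewrite ler_wpM2r.
    by rewrite ler_wpM2l// mulr_ge0.
  have -> : 2 * C * h0 * S4 = C * (2 * h0 * S4) by ring.
  by rewrite ler_wpM2l.
by rewrite subr_ge0; apply: le_trans l0 _; apply: le_trans main _; rewrite mulrDr lerD.
Qed.

End AtTime.

Lemma hit_interpolation (x0 : K -> bool) :
  Ex (rate 0) (bits (n + M)) (hit_ind R L o) x0 <=
  Ex (rate T) (bits (n + M)) (hit_ind R L o) x0.
Proof.
pose f t := Ex (rate t) (bits (n + M)) (hit_ind R L o) x0.
have fD (t : R) : is_derive t 1 f (\sum_(i <- bits (n + M)) drate i *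
    Ex (rate t) (bits (n + M)) (bdiff i (hit_ind R L o)) x0).
  by apply: is_derive_Ex; [exact: undup_uniq|exact: is_derive_rate].
apply: (@ger0_derive1_ndecr R f 0 T) => //.
- move=> t; rewrite in_itv /= => /andP[t0 tT]; rewrite derive1E.
  have Dt := fD t; rewrite derive_val.
  by apply: hit_derivative_ge0; exact: ltW.
- by apply: derivable_within_continuous => t _; have Dt := fD t; exact: ex_derive.
Qed.

End Interpolation.

Lemma fset2_inj (T : choiceType) (a b c d : T) : [fset a; b]%fset = [fset c; d]%fset ->
  a = c /\ b = d \/ a = d /\ b = c.
Proof.
move=> E.
have /fset2P ac : a \in [fset c; d]%fset by rewrite -E fset21.
have /fset2P bc : b \in [fset c; d]%fset by rewrite -E fset22.
have /fset2P ca : c \in [fset a; b]%fset by rewrite E fset21.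
have /fset2P da : d \in [fset a; b]%fset by rewrite E fset22.
case: ac bc ca da => -> [] -> [] ? [] ?; subst; by [left|right].
Qed.

(** * Exploration of the lift *)

Section LiftPercolation.
Variables (G : sgraph) (lf : locally_finite G) (eta : {fset G} -> bool).
Implicit Types (u v w : G) (i j : bool) (Om : {fset (G * bool)} -> bool).

Definition lk u i v : {fset (G * bool)} := [fset (u, i); (v, i (+) eta (ek u v))]%fset.

Lemma lkC u i v : lk v (i (+) eta (ek u v)) u = lk u i v.
Proof. by rewrite /lk (ekC v u) -addbA addbb addbF fsetUC. Qed.

Lemma lk_neq u i v : adj u v -> lk u i v != lk u (~~ i) v.
Proof.
move=> uv; apply/eqP => /fset2_inj[[[] ]|[[uv' _] _]]; first by case: i.
by move: uv; rewrite -uv' adj_irr.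
Qed.

Lemma lk_base u i v u' j v' : lk u i v = lk u' j v' -> ek u v = ek u' v'.
Proof. by move=> /fset2_inj[[[-> _] [-> _]]|[[-> _] [-> _]]]//; exact: ekC. Qed.

(** Read from its other endpoint, an edge with [eta] equal to 1 has its two lifts interchanged;
    hence the alternative. *)
Lemma lk_pair u i v u' j v' : ek u v = ek u' v' ->
  lk u i v = lk u' j v' /\ lk u (~~ i) v = lk u' (~~ j) v' \/
  lk u i v = lk u' (~~ j) v' /\ lk u (~~ i) v = lk u' j v'.
Proof.
move=> /ek_inj[[-> ->]|[-> ->]].
  by case: i; case: j; [left|right|right|left].
rewrite -(lkC v' i u') -(lkC v' (~~ i) u') addNb.
by case: (i (+) _); case: j; [left|right|right|left].
Qed.

Definition lst Om : rel (G * bool) := fun a b =>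
  [&& adj a.1 b.1, b.2 == a.2 (+) eta (ek a.1 b.1) & Om [fset a; b]%fset].

Lemma lst_lk Om u i v : adj u v -> Om (lk u i v) -> lst Om (u, i) (v, i (+) eta (ek u v)).
Proof. by move=> uv O; rewrite /lst /= uv eqxx. Qed.

Definition lexit (W : pred G) a Om := exists2 t, reachable (lst Om) a t & ~~ W t.1.

(** The enhancement without thinning and without length cutoff: the largest static model that the
    exploration of the lift is shown to dominate. *)
Definition sst (x : nat * {fset G} -> bool) : rel G := fun u v => adj u v &&
  (x (0%N, ek u v) || x (1%N, ek u v) && `[< reachable (pstep x) (u, false) (u, true) >]).

Definition sexit (W : pred G) o x := exists2 t, reachable (sst x) o t & ~~ W t.

Lemma st_sst L x u v : st L x u v -> sst x u v.
Proof.
move=> /andP[uv]; rewrite /sst uv /= => /orP[->//|/and3P[-> _ /asboolP[s [ps ls _]]]] /=.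
by apply/orP; right; apply/asboolP; exists s.
Qed.

Lemma lst_mono Om Om' a b : (forall k, Om k -> Om' k) -> lst Om a b -> lst Om' a b.
Proof. by move=> OO /and3P[ab e /OO O]; rewrite /lst ab e O. Qed.

Lemma reachable_flip x u i : reachable (pstep x) (u, false) (u, true) ->
  reachable (pstep x) (u, i) (u, ~~ i).
Proof.
move=> [s ps ls]; have H : reachn (pstep x) (size s) (u, false) (u, true) by exists s.
case: i; last by exists s.
by have [t [pt lt _]] := pstep_flip H; exists t.
Qed.

Variables (R : realType) (p : R) (o : G) (W : pred G).
Hypothesis p01 : 0 <= p <= 1.
Variable r : nat * {fset G} -> R.
Hypothesis r01 : prob_weight r.
Hypothesis rp : forall (n : nat) e, (n < 2)%N -> r (n, e) = p.

(* Ul and Ub list the untested keys of the lift and of the static model, Om and x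
   their states, closed by default on Ul. While both lifts of e are untested both
   its bits are free; after the first test (0, e) is fixed; after the second the
   two bits of e are the states of its two lifts, in some order. *)
Record exploration (Ul : seq {fset (G * bool)}) (Ub : seq (nat * {fset G}))
    (x : nat * {fset G} -> bool) Om : Prop := Exploration {
  ex_uniql : uniq Ul;
  ex_uniqb : uniq Ub;
  ex_kind : forall (n : nat) e, (n, e) \in Ub -> (n < 2)%N;
  ex_eta : forall e, x (2%N, e) = eta e;
  ex_closed : forall k, k \in Ul -> Om k = false;
  ex_reach : forall u i v, adj u v -> Om (lk u i v) -> reachable (lst Om) (o, false) (u, i);
  ex_fresh : forall u i v, adj u v -> lk u i v \in Ul -> lk u (~~ i) v \in Ul ->
    (0%N, ek u v) \in Ub /\ (1%N, ek u v) \in Ub;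
  ex_once : forall u i v, adj u v -> lk u i v \notin Ul -> lk u (~~ i) v \in Ul ->
    [/\ (0%N, ek u v) \notin Ub, (1%N, ek u v) \in Ub & x (0%N, ek u v) = Om (lk u i v)];
  ex_twice : forall u i v, adj u v -> lk u i v \notin Ul -> lk u (~~ i) v \notin Ul ->
    [/\ (0%N, ek u v) \notin Ub, (1%N, ek u v) \notin Ub &
        x (0%N, ek u v) = Om (lk u i v) /\ x (1%N, ek u v) = Om (lk u (~~ i) v) \/
        x (0%N, ek u v) = Om (lk u (~~ i) v) /\ x (1%N, ek u v) = Om (lk u i v)] }.

(** Each test of a lifted edge consumes one bit of the base edge: [j] is 0 if the other lift is
    untested and 1 otherwise. Both models thus read the same fresh bit [b]. *)
Lemma exploration_step Ul Ub x Om u i v b : exploration Ul Ub x Om ->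
  adj u v -> reachable (lst Om) (o, false) (u, i) -> lk u i v \in Ul ->
  let j := (lk u (~~ i) v \notin Ul) : nat in
  (j, ek u v) \in Ub /\
  exploration (rem (lk u i v) Ul) (rem (j, ek u v) Ub)
    (upd x (j, ek u v) b) (upd Om (lk u i v) b).
Proof.
move=> E uv ou kU j.
have jb : (j, ek u v) \in Ub.
  rewrite /j; have [k'U|k'U] := boolP (lk u (~~ i) v \in Ul).
    by have [] := ex_fresh E uv kU k'U.
  have := ex_once E uv k'U; rewrite negbK => /(_ kU)[] //.
split => //.
have OO k : Om k -> upd Om (lk u i v) b k.
  by rewrite /upd; case: eqP => // ->; rewrite (ex_closed E kU).
have rOO a c : reachable (lst Om) a c -> reachable (lst (upd Om (lk u i v) b)) a c.
  by apply: sub_reachable => ? ?; exact: lst_mono.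
have memUl k : (k \in rem (lk u i v) Ul) = (k != lk u i v) && (k \in Ul).
  by rewrite mem_rem_uniq ?inE//; exact: ex_uniql E.
have memUb k : (k \in rem (j, ek u v) Ub) = (k != (j, ek u v)) && (k \in Ub).
  by rewrite mem_rem_uniq ?inE//; exact: ex_uniqb E.
have kk' := lk_neq i uv.
split.
- by apply: rem_uniq; exact: ex_uniql E.
- by apply: rem_uniq; exact: ex_uniqb E.
- by move=> l e; rewrite memUb => /andP[_]; exact: (ex_kind E).
- move=> e; rewrite /upd xpair_eqE.
  have -> : (2%N == j) = false by rewrite /j; case: (_ \notin _).
  exact: (ex_eta E).
- by move=> k; rewrite memUl /upd => /andP[/negbTE-> /(ex_closed E)].
- move=> u2 i2 v2 uv2; rewrite {1}/upd; case: eqP => [Ek bt|_ O]; last first.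
    by apply: rOO; exact: (ex_reach E uv2 O).
  have step : lst (upd Om (lk u i v) b) (u, i) (v, i (+) eta (ek u v)).
    by apply: lst_lk => //; rewrite updE.
  case: (fset2_inj Ek) => [[[-> ->] _]|[[-> ->] _]]; first exact: rOO.
  by apply: reachable_step step; exact: rOO.
- move=> u2 i2 v2 uv2; rewrite !memUl => /andP[n1 k1] /andP[n2 k2].
  have ne : ek u2 v2 <> ek u v.
    move=> ee; have [[e1 _]|[_ e2]] := lk_pair i2 i ee.
      by rewrite e1 eqxx in n1.
    by rewrite e2 eqxx in n2.
  have [a0 a1] := ex_fresh E uv2 k1 k2.
  by rewrite !memUb !xpair_eqE a0 a1 !andbT (introF eqP ne) !andbF.
- move=> u2 i2 v2 uv2; rewrite !memUl negb_and negbK => n1 /andP[n2 k2].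
  have [ee|ne] := pselect (ek u2 v2 = ek u v).
    have [[e1 e2]|[_ e2]] := lk_pair i2 i ee; last by rewrite e2 eqxx in n2.
    have j0 : j = 0%N by rewrite /j -e2 k2.
    have [|a0 a1] := ex_fresh E uv kU; first by rewrite -e2.
    by rewrite !memUb j0 ee eqxx /= e1 !updE a1.
  have nk : lk u2 i2 v2 <> lk u i v by move=> /lk_base.
  move: n1; rewrite (introF eqP nk) /= => n1.
  have [a0 a1 a2] := ex_once E uv2 n1 k2.
  rewrite !memUb !xpair_eqE (negbTE a0) a1 !andbF (introF eqP ne) !andbF /=; split => //.
  by rewrite /upd xpair_eqE (introF eqP ne) andbF (introF eqP nk).
- move=> u2 i2 v2 uv2; rewrite !memUl !negb_and !negbK => n1 n2.
  have [ee|ne] := pselect (ek u2 v2 = ek u v).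
    have k'U : lk u (~~ i) v \notin Ul.
      have [[e1 e2]|[e1 e2]] := lk_pair i2 i ee.
        by move: n2; rewrite e2 eq_sym (negbTE kk').
      by move: n1; rewrite e1 eq_sym (negbTE kk').
    have j1 : j = 1%N by rewrite /j k'U.
    have := ex_once E uv k'U; rewrite negbK => /(_ kU)[a0 a1 a2].
    rewrite !memUb j1 ee !xpair_eqE eqxx /= (negbTE a0).
    have f1 : upd x (1%N, ek u v) b (0%N, ek u v) = upd Om (lk u i v) b (lk u (~~ i) v).
      by rewrite /upd xpair_eqE /= a2 eq_sym (negbTE kk').
    split => //.
    have [[e1 e2]|[e1 e2]] := lk_pair i2 i ee; rewrite e1 e2 f1 !updE; [by right|by left].
  have nk : lk u2 i2 v2 <> lk u i v by move=> /lk_base.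
  have nk' : lk u2 (~~ i2) v2 <> lk u i v by move=> /lk_base.
  move: n1 n2; rewrite (introF eqP nk) (introF eqP nk') /= => n1 n2.
  have [a0 a1 a2] := ex_twice E uv2 n1 n2.
  rewrite !memUb (negbTE a0) (negbTE a1) !andbF /=; split => //.
  by rewrite /upd !xpair_eqE (introF eqP ne) !andbF (introF eqP nk) (introF eqP nk').
Qed.

(** Once every lifted edge at a reached vertex has been tested, each vertex of the static cluster
    has a reached lift, whatever the values of the bits left untested. This is shown by following
    the static steps. *)
Lemma exploration_stuck Ul Ub x Om : exploration Ul Ub x Om ->
  (forall u i v, adj u v -> reachable (lst Om) (o, false) (u, i) -> lk u i v \notin Ul) ->
  forall y, (forall k, k \notin Ub -> y k = x k) -> sexit W o y -> lexit W (o, false) Om.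
Proof.
move=> E stuck y yx [t ot nWt].
pose Q u := exists i, reachable (lst Om) (o, false) (u, i).
suff [i ti] : Q t by exists (t, i).
have y2 e : y (2%N, e) = eta e.
  rewrite yx; last by apply/negP => /(ex_kind E).
  exact: (ex_eta E).
have step u i v : adj u v -> reachable (lst Om) (o, false) (u, i) -> Om (lk u i v) ->
    reachable (lst Om) (o, false) (v, i (+) eta (ek u v)).
  by move=> uv ou O; apply: reachable_step ou _; exact: lst_lk.
have open_step u v i : adj u v -> Om (lk u i v) -> Q v.
  move=> uv O; exists (i (+) eta (ek u v)); apply: step => //.
  exact: (ex_reach E uv O).
move: t ot {nWt}; apply: reachable_ind; first by exists false; exact: reachable_refl.
move=> u v [i ui] /andP[uv stuv].
have kU := stuck _ _ _ uv ui.
case/orP: stuv => [y0|/andP[y1 /asboolP walk]].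
  have [k'U|k'U] := boolP (lk u (~~ i) v \in Ul).
    have [b0 _ x0] := ex_once E uv kU k'U.
    by apply: (@open_step u v i) => //; rewrite -x0 -yx.
  have [b0 _ [[x0 _]|[x0 _]]] := ex_twice E uv kU k'U.
    by apply: (@open_step u v i) => //; rewrite -x0 -yx.
  by apply: (@open_step u v (~~ i)) => //; rewrite -x0 -yx.
(* Along the odd walk both bits of each edge are 1, so both of its lifts are open and the walk can
   be followed in the lift. Both lifts of [u] are then reached, and whichever lift of the edge [uv]
   is open can be used. *)
have ui' : reachable (lst Om) (o, false) (u, ~~ i).
  have := reachable_flip i walk.
  apply: (reachable_ind (Q := fun a => reachable (lst Om) (o, false) a)) => //.
  move=> [a ai] [b bi] oa /and4P[/= ab z0 z1 /eqP->]; rewrite y2.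
  apply: step => //; have aU := stuck _ _ _ ab oa.
  have [a'U|a'U] := boolP (lk a (~~ ai) b \in Ul).
    have [b0 _ x0] := ex_once E ab aU a'U.
    by rewrite -x0 -yx.
  have [b0 b1 [[x0 x1]|[x0 x1]]] := ex_twice E ab aU a'U.
    by rewrite -x0 -yx.
  by rewrite -x1 -yx.
have k'U := stuck _ _ _ uv ui'.
have [_ b1 [[_ x1]|[_ x1]]] := ex_twice E uv kU k'U.
  by apply: (@open_step u v (~~ i)) => //; rewrite -x1 -yx.
by apply: (@open_step u v i) => //; rewrite -x1 -yx.
Qed.

Definition sexit_ind x : R := `[< sexit W o x >]%:R.
Definition lexit_ind a Om : R := `[< lexit W a Om >]%:R.

(** Induction on the number of untested keys: as long as a test is possible, both sides average over
    the same bit with the same density [p]. When none is left, either the lift has already exited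
    and the right side is 1, or the static model cannot exit and the left side is 0. *)
Lemma exploration_le Ul Ub x Om : exploration Ul Ub x Om ->
  Ex r Ub sexit_ind x <= Ex (fun=> p) Ul (lexit_ind (o, false)) Om.
Proof.
have pw : prob_weight (fun=> p : R) by move=> ?.
move: {2}(size Ul) (erefl (size Ul)) => n; elim: n Ul Ub x Om => [|n IH] Ul Ub x Om sU E.
  have stuck u i v : adj u v -> reachable (lst Om) (o, false) (u, i) -> lk u i v \notin Ul.
    by rewrite (size0nil sU).
  have [lx|nlx] := pselect (lexit W (o, false) Om).
    rewrite (size0nil sU) /= /lexit_ind asboolT//; apply: Ex_le1 => // y.
    by rewrite /sexit_ind; case: asbool.
  apply: (@le_trans _ _ 0); last exact: Ex_ge0.
  rewrite -[leRHS](congr1 (@^~ x) (Ex_cst r Ub 0)).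
  apply: Ex_le_on => // y yx; rewrite /sexit_ind asboolF// => sx; apply: nlx.
  exact: exploration_stuck E stuck _ yx sx.
have [[u [i [v [uv ou kU]]]]|no] := pselect (exists u i v,
    [/\ adj u v, reachable (lst Om) (o, false) (u, i) & lk u i v \in Ul]).
  have [jU _] := exploration_step true E uv ou kU.
  rewrite (Ex_rem _ _ jU) (Ex_rem _ _ kU) /avg rp; last exact: (ex_kind E jU).
  have sr : size (rem (lk u i v) Ul) = n by rewrite size_rem// sU.
  have /andP[p0 p1] := p01.
  rewrite lerD// ler_wpM2l// ?subr_ge0//; apply: IH => //.
    by have [] := exploration_step true E uv ou kU.
  by have [] := exploration_step false E uv ou kU.
have stuck u i v : adj u v -> reachable (lst Om) (o, false) (u, i) -> lk u i v \notin Ul.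
  by move=> uv ou; apply/negP => kU; apply: no; exists u, i, v.
have [lx|nlx] := pselect (lexit W (o, false) Om).
  apply: (@le_trans _ _ 1).
    by apply: Ex_le1 => // y; rewrite /sexit_ind; case: asbool.
  apply: Ex_ge_on => // y yO; rewrite /lexit_ind asboolT//.
  have [t ot Wt] := lx; exists t => //; apply: sub_reachable ot => a b; apply: lst_mono.
  move=> k Ok; rewrite yO//; apply/negP => kU.
  by rewrite (ex_closed E kU) in Ok.
apply: (@le_trans _ _ 0); last exact: Ex_ge0.
rewrite -[leRHS](congr1 (@^~ x) (Ex_cst r Ub 0)).
apply: Ex_le_on => // y yx; rewrite /sexit_ind asboolF// => sx; apply: nlx.
exact: exploration_stuck E stuck _ yx sx.
Qed.

Definition lkeys n (c : G) : seq {fset (G * bool)} :=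
  undup ([seq lk u false v | u <- gball n c, v <- nbr u] ++
         [seq lk u true v | u <- gball n c, v <- nbr u]).

Lemma mem_lkeys n c u i v : adj u v ->
  (lk u i v \in lkeys n c) = (u \in gball n c) || (v \in gball n c).
Proof.
move=> uv; rewrite mem_undup mem_cat; apply/orP/orP.
  move=> [] /allpairsPdep[a [b [an _ E]]]; have /ek_inj[[-> _]|[_ ->]] := lk_base E;
    by [left|right].
have vu : adj v u by rewrite adj_sym.
move=> [un|vn].
  by case: i; [right|left]; apply/allpairsPdep; exists u, v; rewrite in_nbr.
rewrite -lkC.
by case: (i (+) _); [right|left]; apply/allpairsPdep; exists v, u; rewrite in_nbr.
Qed.

Definition two_bits n (c : G) : seq (nat * {fset G}) :=
  undup [seq (l, e) | l <- [:: 0; 1]%N, e <- near_edges n c].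

Lemma mem_two_bits n c l e :
  ((l, e) \in two_bits n c) = (l < 2)%N && (e \in near_edges n c).
Proof.
rewrite mem_undup; apply/allpairsP/andP => [[[a b] [/= aj be [-> ->]]]|[j3 en]].
  by split => //; move: aj; rewrite !inE => /orP[]/eqP->.
by exists (l, e); split => //; case: l j3 => [|[|]].
Qed.

Lemma coupling n c x : (forall e, x (0%N, e) = false) -> (forall e, x (1%N, e) = false) ->
  (forall e, x (2%N, e) = eta e) ->
  Ex r (two_bits n c) sexit_ind x <=
  Ex (fun=> p) (lkeys n c) (lexit_ind (o, false)) (fun=> false).
Proof.
move=> x0 x1 x2; apply: exploration_le; split => //.
- exact: undup_uniq.
- exact: undup_uniq.
- by move=> l e; rewrite mem_two_bits => /andP[].
- move=> u i v uv; rewrite mem_lkeys// -touches_ek// => t _.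
  by rewrite !mem_two_bits /= -[_ \in _]/(touches n c _) t.
- by move=> u i v uv; rewrite !mem_lkeys// => /negbTE->.
- move=> u i v uv; rewrite !mem_lkeys// -touches_ek// => nt _.
  rewrite !mem_two_bits /= -[_ \in _]/(touches n c _) nt; split => //.
  by left; rewrite x0 x1.
Qed.

End LiftPercolation.

(** * Exit probabilities of balls, in the base and in the lift *)

Section Percolation.
Variables (R : realType) (G : sgraph) (lf : locally_finite G).
Implicit Types (om eta : {fset G} -> bool) (W : pred G).

Definition gst om : rel G := fun u v => adj u v && om (ek u v).

Definition gexit W o om := exists2 t, reachable (gst om) o t & ~~ W t.

(** A path may be cut at its first vertex outside [W], so only steps issued from [W] matter. *)
Lemma exit_depends (T : choiceType) (r r' : rel T) (W : pred T) a t :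
  (forall u v, W u -> r u v -> r' u v) -> reachable r a t -> ~~ W t ->
  exists2 t', reachable r' a t' & ~~ W t'.
Proof.
move=> rr' [s ps ls] nWt; have [Wa|nWa] := boolP (W a); last first.
  by exists a => //; exact: reachable_refl.
have [||s1 [v [s2 [Es nWv al]]]] := @first_entry _ (predC W) a s; rewrite /= ?negbK ?ls//.
exists v => //; exists (rcons s1 v); last by rewrite last_rcons.
move: ps; rewrite Es -cat_rcons cat_path => /andP[ps _].
apply: sub_path_belast ps; first by move=> u w /=; exact: rr'.
rewrite belast_rcons; apply/allP => u us; have := allP al _ us.
by rewrite /= negbK.
Qed.

Definition perc (p : R) n o a : R := Ex (fun=> p) (near_edges n o)
  (fun om => `[< gexit (mem (gball n o)) a om >]%:R) (fun=> false).

Definition theta (p : R) m o eta a : R := Ex (fun=> p) (lkeys eta m o)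
  (lexit_ind eta R (mem (gball m o)) a) (fun=> false).

Lemma lexit_ind_depends eta m o a :
  depends_on (mem (lkeys eta m o)) (lexit_ind eta R (mem (gball m o)) a).
Proof.
move=> Om Om' OO; congr ((nat_of_bool _)%:R); apply: asbool_equiv_eq.
wlog suff H : Om Om' OO / lexit eta (mem (gball m o)) a Om -> lexit eta (mem (gball m o)) a Om'.
  by split; apply: H => // k kk; rewrite OO.
move=> [t ot Wt]; have := @exit_depends _ (lst eta Om) (lst eta Om')
  (fun x => x.1 \in gball m o) _ _ _ ot Wt.
apply=> -[u i] [v j] /= ub /and3P[/= uv /eqP-> O]; rewrite /lst /= uv eqxx /=.
by rewrite -OO//=; rewrite -/(lk eta u i v) mem_lkeys// ub.
Qed.

Lemma theta_widen p m n o eta a : (m <= n)%N ->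
  Ex (fun=> p) (lkeys eta n o) (lexit_ind eta R (mem (gball m o)) a) (fun=> false) =
  theta p m o eta a.
Proof.
move=> mn; apply: Ex_widen; last exact: lexit_ind_depends.
move=> k; rewrite mem_undup mem_cat => /orP[] /allpairsPdep[u [v [ub uv ->]]];
  rewrite in_nbr// in uv; rewrite mem_lkeys//; apply/orP; left; exact: (gball_le mn ub).
Qed.

Lemma theta_depends p m o a :
  depends_on (mem (near_edges m o)) (fun eta => theta p m o eta a).
Proof.
move=> eta eta' ee; rewrite /theta.
have lkE u i v : u \in gball m o -> adj u v -> lk eta u i v = lk eta' u i v.
  by move=> ub uv; rewrite /lk ee//; apply/near_edgesP => //; exists u, v.
rewrite (@Ex_eq_mem _ _ _ (lkeys eta m o) (lkeys eta' m o)).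
  congr (Ex _ _ _ _); apply/funext => Om; congr ((nat_of_bool _)%:R).
  apply: asbool_equiv_eq.
  wlog suff H : eta eta' ee {lkE} / lexit eta (mem (gball m o)) a Om ->
      lexit eta' (mem (gball m o)) a Om.
    by split; apply: H => // k kk; rewrite ee.
  move=> [t ot Wt]; have := @exit_depends _ (lst eta Om) (lst eta' Om)
    (fun x => x.1 \in gball m o) _ _ _ ot Wt.
  apply=> -[u i] [v j] /= ub /and3P[/= uv /eqP-> O]; rewrite /lst /= uv O ee ?eqxx//.
  by apply/near_edgesP => //; exists u, v.
wlog suff H : eta eta' {ee} lkE / {subset lkeys eta m o <= lkeys eta' m o}.
  by move=> k; apply/idP/idP; apply: H => // u i v ub uv; rewrite lkE.
move=> k; rewrite !mem_undup !mem_cat => /orP[] /allpairsPdep[u [v [ub uv ->]]];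
  apply/orP; [left|right]; apply/allpairsPdep; exists u, v; split => //;
  by apply: lkE => //; rewrite in_nbr in uv.
Qed.

Lemma gexit_depends n o a :
  depends_on (mem (near_edges n o))
    (fun om => `[< gexit (mem (gball n o)) a om >]%:R : R).
Proof.
move=> om om' omE; congr ((nat_of_bool _)%:R); apply: asbool_equiv_eq.
wlog suff H : om om' omE / gexit (mem (gball n o)) a om -> gexit (mem (gball n o)) a om'.
  by split; apply: H => // k kk; rewrite omE.
move=> [t ot Wt]; apply: (@exit_depends _ (gst om)) ot Wt => u v /= ub /andP[uv O].
rewrite /gst uv -omE//; apply/near_edgesP => //; by exists u, v.
Qed.

(** Erase the loops of the exiting path just before its first vertex outside the ball. The distinct
    vertices serve to find a green one, the distinct edges to count paths. *)
Lemma long_path n o om : gexit (mem (gball n o)) o om ->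
  exists s, [/\ path (gst om) o s, uniq (o :: s), (n <= size s)%N &
    {subset o :: s <= gball n o}].
Proof.
move=> [t [s ps ls] nt].
have oo : ~~ predC (mem (gball n o)) o by rewrite /= negbK gball_center.
rewrite -ls in nt.
have [s1 [v [s2 [Es nv al]]]] := first_entry oo nt.
move: ps; rewrite Es cat_path => /and3P[ps1 lv _].
move: lv; case/shortenP: ps1 => s' ps' us' sub lv.
exists s'; split => //.
- rewrite leqNgt; apply/negP => sn; move/negP: nv; apply.
  have /andP[lav _] := lv.
  have pa : path (@adj G) o s' by apply: sub_path ps' => ? ? /andP[].
  have := path_gball lf pa (mem_last _ _) => lb.
  exact: (gball_le sn (gball_step lf lb lav)).
- move=> u us; have : u \in o :: s1.
    by move: us; rewrite !inE => /orP[->//|/sub->]; rewrite orbT.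
  by move=> /(allP al) /=; rewrite negbK.
Qed.

End Percolation.

(** * Comparison at the two ends of the curve *)

Section Annealed.
Variables (R : realType) (G : sgraph) (lf : locally_finite G) (k L D : nat) (o : G).
Hypothesis Lk : (k.+1 + k + k + k.+1 + k <= L)%N.
Hypothesis k3 : (2 < k)%N.
Hypothesis cycles : forall c : G, exists v cyc, [/\ path (@adj G) c (v :: cyc),
  last v cyc = c, uniq (v :: cyc) & size (v :: cyc) = k].
Hypothesis degD : forall u : G, (#|` nbr u| <= D)%N.
Notation K := (nat * {fset G})%type.
Notation M := (k.+1 + L)%N.
Variables (p1 pl q C h0 : R) (n : nat).
Variables (d T : R).
Hypotheses (d0 : 0 < d) (d2 : d <= 1 / 2) (pld : d <= pl) (p1d : p1 <= 1 - d)
  (qd : d <= q <= 1 - d) (pT : pl <= p1 - T) (T0 : 0 <= T) (CT : 2 * C * T <= 1)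
  (h00 : 0 <= h0) (h02 : 2 * h0 <= 1 / 2).
Hypothesis CE : C = D%:R * (1 + d^-1) ^+ modified_bound k L D * (D.+1 ^ M)%:R.

Let rw t : 0 <= t -> t <= T -> prob_weight (rate o p1 pl q C h0 n t).
Proof. by move=> t0 tT; exact: (rate_weight o n d0 pld p1d qd pT T0 CT h00 h02 CE t0 tT). Qed.

Let x0 : K -> bool := fun=> false.

(** Given the edges, an exiting cluster contains a self-avoiding path with more than [n] vertices,
    each of them green independently with probability [h0]. *)
Lemma perc_le_hit : (1 - (1 - h0) ^+ n) * perc p1 n o o <=
  Ex (rate o p1 pl q C h0 n 0) (bits o (n + M)) (hit_ind R L o) x0.
Proof.
set r := rate _ _ _ _ _ _ _ _; set s := bits _ _.
have r01 : prob_weight r by exact: rw.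
pose s0 : seq K := [seq (0%N, e) | e <- near_edges n o].
pose s4 : seq K := [seq (4%N, [fset u]%fset) | u <- gball n o].
have r4 e : r (4%N, e) = h0 by rewrite /r /rate /= mulr0 addr0 mulr1.
have nE e : e \in near_edges n o -> e \in near_edges (n + M) o.
  by move=> en; apply: (near_edges_le lf _ en); rewrite leq_addr.
have s04 : {subset s0 ++ s4 <= s}.
  move=> i; rewrite mem_cat => /orP[] /mapP[e en ->]; rewrite mem_bits.
    by rewrite nE.
  by rewrite /= map_f//; apply: (gball_le _ en); rewrite leq_addr.
pose E (x : K -> bool) : R := `[< gexit (mem (gball n o)) o (fun e => x (0%N, e)) >]%:R.
have Edep : depends_on (mem s0) E.
  move=> x y xy; have := @gexit_depends R G lf n o o (fun e => x (0%N, e)) (fun e => y (0%N, e)).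
  by apply=> e en; apply: xy; exact: map_f.
have ES y : Ex r s0 E y = perc p1 n o o.
  rewrite (Ex_full r y x0 Edep) /perc.
  have inj : injective (fun e : {fset G} => (0%N, e)) by move=> ? ? [].
  have := @Ex_map R _ _ _ r (near_edges n o)
    (fun om => `[< gexit (mem (gball n o)) o om >]%:R) x0 inj.
  rewrite -/s0 => ->; congr (_ _); apply: eq_Ex => e en.
  by rewrite /r /rate /= en subr0.
rewrite -(Ex_subset r _ s04).
have lower y : (1 - (1 - h0) ^+ n) * perc p1 n o o <= Ex r (s0 ++ s4) (hit_ind R L o) y.
  rewrite Ex_cat -(ES y) -[leLHS](congr1 (@^~ y) (ExZ r s0 _ E)); apply: Ex_le => // z.
  rewrite /E; have [gz|ngz] :=
    pselect (gexit (mem (gball n o)) o (fun e => z (0%N, e))); last first.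
    by rewrite asboolF// mulr0 Ex_ge0.
  rewrite asboolT// mulr1; have [l [pl' uA nl Ab]] := long_path lf gz.
  pose A := o :: l; have nA : (n <= size A)%N by exact: leqW.
  have Ao u : u \in A -> reachable (gst (fun e => z (0%N, e))) o u.
    exact: path_reachable pl'.
  pose B : seq K := [seq (4%N, [fset u]%fset) | u <- A].
  have uB : uniq B by rewrite map_inj_uniq// => u v [] /fset1_inj.
  have Bs : {subset B <= s4} by move=> _ /mapP[u uA' ->]; rewrite map_f// Ab.
  have EB := Ex_cylinder r (fun=> false) uB Bs.
  pose N (x : K -> bool) : R := (all (fun i => x i == false) B)%:R.
  apply: (@le_trans _ _ (Ex r s4 (fun x => 1 + (-1) * N x) z)).
    rewrite (congr1 (@^~ z) (ExD r s4 (fun=> 1) (fun x => -1 * N x))) Ex_cst ExZ.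
    rewrite mulN1r EB lerD2l lerN2 big_map.
    under eq_bigr do rewrite r4.
    rewrite big_const_seq count_predT.
    rewrite -Monoid.iteropE.
    have : (1 - h0) ^+ size A <= (1 - h0) ^+ n.
      by apply: ler_wiXn2l => //; move: h00 h02; lra.
    by [].
  apply: Ex_le_on => // x xz; rewrite /N /hit_ind.
  have [aB|] := boolP (all _ B); first by rewrite mulN1r subrr.
  rewrite -has_predC => /hasP[_ /mapP[u uA' ->] /=]; rewrite eqbF_neg negbK => xu.
  rewrite asboolT ?mulr0 ?addr0//; exists u => //.
  apply: sub_reachable (Ao u uA') => a b /andP[ab]; rewrite -xz => [oab|]; last first.
    by apply/mapP => -[].
  by rewrite /st ab oab.
by rewrite -[leLHS](congr1 (@^~ x0) (Ex_cst r s _)); apply: Ex_le.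
Qed.

Lemma Ex_bit (I : eqType) (r : I -> R) s i x : i \in s ->
  Ex r s (fun y => (y i)%:R) x = r i.
Proof.
move=> si; have := @Ex_coord R I r s i (fun=> 1) si (fun _ _ => erefl).
rewrite Ex_cst mulr1 => /(congr1 (@^~ x)) <-.
by congr (Ex r s _ x); apply/funext => y; rewrite mulr1.
Qed.

Lemma sst_ext (x y : K -> bool) : (forall j e, (j < 3)%N -> x (j, e) = y (j, e)) ->
  sst x = sst y.
Proof.
move=> xy; have pE : pstep x = pstep y.
  by apply/funext => a; apply/funext => b; rewrite /pstep !xy.
by apply/funext => u; apply/funext => v; rewrite /sst pE !xy.
Qed.

Lemma sst_mono (x y : K -> bool) u v :
  (forall j e, (j < 2)%N -> x (j, e) -> y (j, e)) ->
  (forall e, x (2%N, e) = y (2%N, e)) -> sst x u v -> sst y u v.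
Proof.
move=> xy xy2 /andP[uv]; rewrite /sst uv /= => /orP[/xy->//|/andP[/xy-> // /asboolP walk]].
apply/orP; right; apply/asboolP; apply: sub_reachable walk => a b.
by rewrite /pstep => /and4P[-> /xy-> // /xy-> //]; rewrite xy2.
Qed.

(** A green vertex that is hit lies either outside the ball of radius [m], an exit dominated by the
    lift, or inside it, which the union bound controls. *)
Lemma hit_le_theta m : (m <= n + M)%N ->
  Ex (rate o p1 pl q C h0 n T) (bits o (n + M)) (hit_ind R L o) x0 <=
  Ex (fun=> q) (near_edges m o) (fun eta => theta (p1 - T) m o eta (o, false)) (fun=> false)
  + 2 * h0 * #|` gball m o|%:R.
Proof.
move=> mn; set r := rate _ _ _ _ _ _ _ _; set s := bits _ _.
have r01 : prob_weight r by exact: rw.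
pose W : pred G := mem (gball m o).
have h4 e : r (4%N, e) <= 2 * h0.
  have := rate_h d0 CT h00 CE T0 (lexx T).
  by move=> /andP[].
apply: (@le_trans _ _ (Ex r s (fun x => sexit_ind R o W x +
    \sum_(t <- gball m o) (x (4%N, [fset t]%fset))%:R) x0)).
  apply: Ex_le => // x; rewrite /hit_ind /sexit_ind.
  have [hx|nhx] := pselect (hit L o x); last first.
    by rewrite asboolF// addr_ge0// sumr_ge0.
  rewrite asboolT//; have [t ot xt] := hx.
  have ot' : reachable (sst x) o t by apply: sub_reachable ot => a b; exact: st_sst.
  have [tm|tm] := boolP (t \in gball m o).
    rewrite (big_rem t)//= xt addrCA lerDl addr_ge0// sumr_ge0//.
  by rewrite asboolT ?lerDl ?sumr_ge0//; exists t.
rewrite ExD Ex_sum lerD//; last first.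
  apply: (@le_trans _ _ (\sum_(t <- gball m o) 2 * h0)); last first.
    by rewrite big_const_seq count_predT iter_addr_0 -[leLHS]mulr_natr.
  rewrite big_seq [leRHS]big_seq; apply: ler_sum => t tm; rewrite Ex_bit//.
  by rewrite mem_bits /= map_f//; exact: gball_le tm.
(* The bits of [eta] come first: the inner expectation is then over the edge bits for a fixed [eta],
   as the exploration requires. *)
pose s' : seq K := [seq (2%N, e) | e <- near_edges (n + M) o] ++ two_bits (n + M) o.
have -> : Ex r s (sexit_ind R o W) = Ex r s' (sexit_ind R o W).
  rewrite (@Ex_filter _ _ r s _ (fun i => (i.1 < 3)%N)); last first.
    move=> [j e] x b _ /= j3; congr ((nat_of_bool _)%:R).
    rewrite /sexit (@sst_ext (upd x (j, e) b) x)// => l e' l3; rewrite /upd xpair_eqE.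
    by case: eqP => // lj; rewrite lj (negbTE j3) in l3.
  apply: Ex_eq_mem => -[j e]; rewrite mem_filter mem_bits mem_cat mem_two_bits /=.
  have -> : ((j, e) \in [seq (2%N, e) | e <- near_edges (n + M) o]) =
      (j == 2%N) && (e \in near_edges (n + M) o).
    by apply/mapP/andP => [[e' en [-> ->]]|[/eqP-> en]]; [|exists e].
  by case: j => [|[|[|[|[|j]]]]] //=; rewrite ?andbF ?orbF.
(* Both tests of an edge must have the same density. Those equal to [pl] are raised to [p1 - T],
   which is allowed since exits increase with these bits. *)
pose r' (i : K) := if (i.1 < 2)%N then p1 - T else r i.
have p2 : 0 <= p1 - T <= 1 by apply/andP; split; move: pT pld d0 p1d T0; lra.
have r'01 : prob_weight r' by move=> i; rewrite /r'; case: ifP.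
rewrite Ex_cat.
have inj : injective (fun e : {fset G} => (2%N, e)) by move=> ? ? [].
have thetaE := @Ex_map R _ _ _ r (near_edges (n + M) o)
  (fun eta => theta (p1 - T) m o eta (o, false)) x0 inj.
have -> : Ex (fun=> q) (near_edges m o)
    (fun eta => theta (p1 - T) m o eta (o, false)) (fun=> false) =
    Ex (fun=> q) (near_edges (n + M) o)
    (fun eta => theta (p1 - T) m o eta (o, false)) (fun=> false).
  symmetry; apply: Ex_widen; last exact: theta_depends.
  by move=> e; exact: near_edges_le.
have -> : Ex (fun=> q) (near_edges (n + M) o)
    (fun eta => theta (p1 - T) m o eta (o, false)) (fun=> false) =
   Ex r [seq (2%N, e) | e <- near_edges (n + M) o]
     (fun y => theta (p1 - T) m o (fun e => y (2%N, e)) (o, false)) x0.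
  by rewrite thetaE.
apply: Ex_le_on => // y yx.
apply: (@le_trans _ _ (Ex r' (two_bits (n + M) o) (sexit_ind R o W) y)).
  apply: Ex_le_weight => //.
    move=> [j e]; rewrite mem_two_bits /r' /= => /andP[j2 en]; rewrite j2.
    by case: j j2 => [|[|j]]//= _; rewrite /r /rate /=; first by case: ifP.
  move=> [j e]; rewrite mem_two_bits /= => /andP[j2 en] z.
  rewrite ler_nat; case: asboolP => // -[t ot Wt]; rewrite asboolT//; exists t => //.
  apply: sub_reachable ot => a b; apply: sst_mono => [l e' _|e'].
    by rewrite /upd; case: eqP.
  by rewrite /upd xpair_eqE; case: j j2 => [|[|]].
rewrite -(theta_widen lf (p1 - T) o (fun e => y (2%N, e)) (o, false) mn).
apply: coupling => //.
- by move=> j e j2; rewrite /r' /= j2.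
- by move=> e; rewrite yx//; apply/mapP => -[].
- by move=> e; rewrite yx//; apply/mapP => -[].
Qed.

Lemma annealed m : (m <= n + M)%N ->
  (1 - (1 - h0) ^+ n) * perc p1 n o o <=
  Ex (fun=> q) (near_edges m o) (fun eta => theta (p1 - T) m o eta (o, false)) (fun=> false)
  + 2 * h0 * #|` gball m o|%:R.
Proof.
move=> mn; apply: le_trans perc_le_hit _; apply: le_trans (hit_le_theta mn).
exact: (@hit_interpolation R G lf k L D o Lk k3 cycles degD p1 pl q C h0 n d T
  d0 d2 pld p1d qd pT T0 CT h00 h02 CE x0).
Qed.

End Annealed.

(** * From finite expectations to probabilities *)

Section BernoulliBits.
Context d (T : measurableType d) (R : realType) (P : probability T R).

Section Cylinders.
Variables (I : eqType) (p : R) (Z : I -> T -> bool).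
Implicit Types (s A : seq I) (F : (I -> bool) -> bool).

Definition depends_only s F := forall x y : I -> bool, {in s, x =1 y} -> F x = F y.

Lemma measurable_cylinder s F : {in s, forall i, measurable [set t | Z i t]} ->
  depends_only s F -> measurable [set t | F (Z ^~ t)].
Proof.
elim: s F => [|i s IH] F ms Fs.
  rewrite (_ : [set t | _] = [set t | F (fun=> false)]); last first.
    by apply/seteqP; split => t /=; rewrite (Fs (Z ^~ t) (fun=> false)).
  by case: (F _); rewrite ?set_true ?set_false.
pose Fi b x := F (upd x i b).
have Fis b : depends_only s (Fi b).
  move=> x y xy; apply: Fs => j; rewrite inE /upd; case: eqP => //= _; exact: xy.
have mi : measurable [set t | Z i t] by apply: ms; rewrite mem_head.
rewrite (_ : [set t | _] = ([set t | Z i t] `&` [set t | Fi true (Z ^~ t)]) `|`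
   (~` [set t | Z i t] `&` [set t | Fi false (Z ^~ t)])).
  have mF b : measurable [set t | Fi b (Z ^~ t)].
    by apply: IH => // j js; apply: ms; rewrite inE js orbT.
  by apply: measurableU; apply: measurableI => //; exact: measurableC.
apply/seteqP; split => t /=; rewrite /Fi.
  by case E : (Z i t) => Ft; [left|right]; split => //; rewrite upd_id.
by case=> -[ZE]; [|move: ZE => /negP/negbTE ZE]; rewrite upd_id.
Qed.

Section JointLaw.
Variable S : seq I.
Hypothesis uS : uniq S.
Hypothesis mS : {in S, forall i, measurable [set t | Z i t]}.
Hypothesis PS : forall b : I -> bool, P [set t | all (fun i => Z i t == b i) S] =
  (\prod_(i <- S) (if b i then p else 1 - p))%:E.

(** The bits of [s] are revealed one by one; splitting the event according to the next bit is
    exactly one [avg]. *)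
Lemma conditional_Ex A s (b : I -> bool) F : perm_eq (A ++ s) S -> depends_only S F ->
  P [set t | all (fun i => Z i t == b i) A && F (Z ^~ t)] =
  ((\prod_(i <- A) (if b i then p else 1 - p)) *
    Ex (fun=> p) s (fun x => (F x)%:R) b)%:E.
Proof.
move=> + FS; elim: s A b => [|i s IH] A b.
  rewrite cats0 => AS; have FA t : all (fun i => Z i t == b i) A -> F (Z ^~ t) = F b.
    move=> Zb; apply: FS => i; rewrite -(perm_mem AS) => iA.
    by have := allP Zb i iA => /eqP.
  have [Fb|nFb] := boolP (F b).
    rewrite /= Fb mulr1 (perm_big _ AS) -PS; congr (P _); apply/seteqP; split => t /=.
      by rewrite -(perm_all _ AS) => /andP[].
    by rewrite -(perm_all _ AS) => Zb; rewrite Zb FA.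
  rewrite /= (negbTE nFb) mulr0 (_ : [set t | _] = set0) ?measure0//; apply/seteqP; split => t //=.
  by move=> /andP[Zb]; rewrite FA// (negbTE nFb).
move=> pS; have pS' : perm_eq ((i :: A) ++ s) S.
  by apply: perm_trans pS; rewrite perm_sym; exact/permPl/(perm_catCA A [:: i] s).
have iA : i \notin A.
  have : uniq ((i :: A) ++ s) by rewrite (perm_uniq pS').
  by move=> /= /andP[+ _]; rewrite mem_cat negb_or => /andP[].
pose E c := [set t | all (fun j => Z j t == upd b i c j) (i :: A) && F (Z ^~ t)].
have EE : [set t | all (fun j => Z j t == b j) A && F (Z ^~ t)] = E true `|` E false.
  have eA c t : all (fun j => Z j t == upd b i c j) A = all (fun j => Z j t == b j) A.
    apply: eq_in_all => j jA; rewrite /upd; have [ji|//] := eqVneq j i.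
    by move: iA; rewrite -ji jA.
  rewrite /E; apply/seteqP; split => t /=; rewrite !eA !updE.
    by move=> /andP[ZA FZ]; case: (Z i t); [left|right]; rewrite ZA FZ.
  by case=> /andP[/andP[_ ZA] FZ]; rewrite ZA FZ.
have mE c : measurable (E c).
  apply: (@measurable_cylinder S
    (fun x => all (fun j => x j == upd b i c j) (i :: A) && F x)) => // x y xy.
  rewrite (FS x y xy); congr (_ && _); apply: eq_in_all => j jA.
  by rewrite xy// -(perm_mem pS') mem_cat jA.
have dE : E true `&` E false = set0.
  apply/seteqP; split => t //= -[/andP[/andP[/eqP e1 _] _] /andP[/andP[/eqP e2 _] _]].
  by move: e1 e2; rewrite !updE => ->.
have IHE c : P (E c) = ((\prod_(j <- i :: A) (if upd b i c j then p else 1 - p)) *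
    Ex (fun=> p) s (fun x => (F x)%:R) (upd b i c))%:E by exact: IH.
have PU : P (E true `|` E false) = (P (E true) + P (E false))%E by apply: measureU.
rewrite EE PU (IHE true) (IHE false) !big_cons !updE /avg -EFinD; congr (_%:E).
have prodE c : \prod_(j <- A) (if upd b i c j then p else 1 - p) =
    \prod_(j <- A) (if b j then p else 1 - p).
  apply: eq_big_seq => j jA; rewrite /upd; have [ji|//] := eqVneq j i.
  by move: iA; rewrite -ji jA.
by rewrite !prodE /= /avg; ring.
Qed.

Lemma law_Ex F x : depends_only S F ->
  P [set t | F (Z ^~ t)] = (Ex (fun=> p) S (fun x => (F x)%:R) x)%:E.
Proof.
move=> FS; have := @conditional_Ex [::] S x F (perm_refl _) FS.
by rewrite big_nil mul1r => <-.
Qed.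

End JointLaw.

(** The product law, stated on cylinders only. The predicate [good] is there because bits are
    indexed by all finite vertex sets, whereas random variables exist only on edges. *)
Definition bernoulli_bits (good : pred I) : Prop :=
  (forall i, good i -> measurable [set t | Z i t]) /\
  forall (A : seq I) (b : I -> bool), uniq A -> all good A ->
    P [set t | all (fun i => Z i t == b i) A] =
    (\prod_(i <- A) (if b i then p else 1 - p))%:E.

Section Bits.
Variable good : pred I.
Hypothesis p01 : 0 <= p <= 1.
Hypothesis HZ : bernoulli_bits good.

Lemma prob_Ex s F x : all good s -> depends_only s F ->
  P [set t | F (Z ^~ t)] = (Ex (fun=> p) s (fun x => (F x)%:R) x)%:E.
Proof.
move=> gs Fs; rewrite (@Ex_eq_mem _ _ _ s (undup s)); last by move=> i; rewrite mem_undup.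
have gu : all good (undup s) by apply/allP => i; rewrite mem_undup; exact: (allP gs).
apply: law_Ex; first exact: undup_uniq.
- by move=> i iu; apply: (proj1 HZ); exact: (allP gu).
- by move=> b; apply: (proj2 HZ) => //; exact: undup_uniq.
- by move=> y z yz; apply: Fs => i si; apply: yz; rewrite mem_undup.
Qed.

Lemma independent_cylinders s1 s2 F1 F2 : all good s1 -> all good s2 ->
  (forall i, i \in s1 -> i \notin s2) -> depends_only s1 F1 -> depends_only s2 F2 ->
  P [set t | F1 (Z ^~ t) && F2 (Z ^~ t)] =
  (P [set t | F1 (Z ^~ t)] * P [set t | F2 (Z ^~ t)])%E.
Proof.
move=> g1 g2 s12 D1 D2; pose x : I -> bool := fun=> false.
rewrite (prob_Ex (s := s1 ++ s2) (F := fun x => F1 x && F2 x) x); last 2 first.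
- by rewrite all_cat g1.
- move=> y z yz; rewrite (D1 y z) ?(D2 y z)// => i si; apply: yz; rewrite mem_cat si ?orbT//.
rewrite (prob_Ex x g1 D1) (prob_Ex x g2 D2) -EFinM; congr (_%:E).
rewrite Ex_cat.
have E2 y : Ex (fun=> p) s2 (fun z => (F1 z && F2 z)%:R : R) y =
    Ex (fun=> p) s2 (fun z => (F2 z)%:R) x * (F1 y)%:R.
  rewrite -(@Ex_full R I (fun=> p) s2 (fun z => (F2 z)%:R) y x); last first.
    by move=> u v uv; rewrite (D2 u v).
  rewrite mulrC -(congr1 (@^~ y) (ExZ (fun=> p) s2 (F1 y)%:R _)).
  apply: eq_Ex_on => [|z zy]; first by move=> ?.
  rewrite (D1 z y) => [|i si]; last exact/zy/s12.
  by rewrite -natrM mulnb.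
by rewrite (funext E2) ExZ mulrC.
Qed.

End Bits.
End Cylinders.
End BernoulliBits.

Section RandomVariables.
Context d (T : measurableType d) (R : realType) (P : probability T R).

Lemma measurable_bool_fun (f : T -> bool) : measurable [set t | f t] -> measurable_fun setT f.
Proof.
move=> mf; apply: (measurable_fun_bool true); rewrite setTI.
by rewrite (_ : _ @^-1` _ = [set t | f t])//; apply/seteqP.
Qed.

Definition bool_rv (f : T -> bool) (mf : measurable [set t | f t]) : {RV P >-> bool} :=
  HB.pack f (isMeasurableFun.Build _ _ T bool f (measurable_bool_fun mf)).

Lemma bernoulli_prob1 (p : R) b : 0 <= p <= 1 ->
  bernoulli_prob p [set b] = (if b then p else 1 - p)%:E.
Proof. by move=> p01; rewrite /bernoulli_prob p01 fsbig_set1. Qed.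

Lemma iid_bernoulli_bits (I : choiceType) (p : R) (X : I -> {RV P >-> bool}) :
  0 <= p <= 1 -> iid_bernoulli p X -> bernoulli_bits P p (fun i => X i : T -> bool) predT.
Proof.
move=> p01 [Xd Xi]; split => [i _|A b uA _].
  rewrite (_ : [set t | _] = X i @^-1` [set true]).
    by rewrite -[X in measurable X]setTI; apply: measurable_funPT.
  by apply/seteqP; split.
have := Xi [fset i in A]%fset (fun i => [set b i]).
have -> : \bigcap_(i in [set` [fset i in A]%fset]) X i @^-1` [set b i] =
   [set t | all (fun i => X i t == b i) A].
  apply/seteqP; split => t /=.
    by move=> H; apply/allP => i iA; apply/eqP; apply: H; rewrite /= inE.
  by move=> /allP H i; rewrite /= inE => /H/eqP.
move=> ->; rewrite -prodEFin.
rewrite (perm_big A) /=; last first.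
  by apply: uniq_perm => // i; rewrite inE.
apply: eq_bigr => i _; rewrite -[LHS]/(distribution P (X i) _) Xd.
exact: bernoulli_prob1.
Qed.

Lemma bits_iid_bernoulli (I : choiceType) (p : R) (Z : I -> T -> bool)
    (mZ : forall i, measurable [set t | Z i t]) :
  0 <= p <= 1 -> bernoulli_bits P p Z predT -> iid_bernoulli p (fun i => bool_rv (mZ i)).
Proof.
move=> p01 HZ; split => [i|J B].
  apply: eq_bernoulli; have := proj2 HZ [:: i] (fun=> true) isT isT.
  rewrite big_seq1 => <-; congr (P _); apply/seteqP; split => t /=.
    by move=> ->.
  by rewrite andbT => /eqP.
have dep (A : seq I) : depends_only A (fun x => all (fun i => x i \in B i) A).
  by move=> x y xy; apply: eq_in_all => i iA; rewrite xy.
have single i : P (Z i @^-1` B i) =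
    (p * (true \in B i)%:R + (1 - p) * (false \in B i)%:R)%:E.
  have := prob_Ex HZ (fun=> false) (isT : all predT [:: i]) (dep [:: i]).
  rewrite (Ex_product (fun=> p) (fun i => mem (B i)))// big_seq1 => <-.
  congr (P _); apply/seteqP; split => t /=; rewrite andbT; first by move/mem_set.
  by move/set_mem.
under eq_bigr do rewrite single.
rewrite prodEFin.
have := prob_Ex HZ (fun=> false) (all_predT _) (dep J).
rewrite (Ex_product (fun=> p) (fun i => mem (B i)))// => <-.
congr (P _); apply/seteqP; split => t /=.
  by move=> H; apply/allP => i iJ; apply/mem_set/H.
by move=> /allP H i iJ; apply/set_mem/H.
Qed.

Definition extend_bits (I : choiceType) (good : pred I) (Z : {i | good i} -> T -> bool) :
    I -> T -> bool :=
  fun i t => if insub i is Some j then Z j t else false.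

Lemma extend_bitsE (I : choiceType) (good : pred I) (Z : {i | good i} -> T -> bool) j t :
  extend_bits Z (val j) t = Z j t.
Proof. by rewrite /extend_bits valK. Qed.

Lemma bernoulli_bits_extend (I : choiceType) (good : pred I) p
    (Z : {i | good i} -> T -> bool) :
  bernoulli_bits P p Z predT -> bernoulli_bits P p (extend_bits Z) good.
Proof.
move=> [mZ HZ]; split => [i gi|A b uA gA].
  rewrite (_ : [set t | _] = [set t | Z (Sub i gi) t]); first exact: mZ.
  by apply: eq_set => t; rewrite -(extend_bitsE Z (Sub i gi)) SubK.
pose B := pmap insub A : seq {i | good i}.
have BA : [seq val j | j <- B] = A.
  rewrite pmap_filter; last exact: insubK.
  by apply/all_filterP; apply: sub_all gA => i gi; rewrite isSome_insub.
have uB : uniq B by rewrite pmap_sub_uniq.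
rewrite -[in RHS]BA big_map -(HZ B (b \o val) uB (all_predT _)).
congr (P _); apply: eq_set => t; rewrite -[in LHS]BA all_map /=.
by apply: congr1; apply: eq_all => j /=; rewrite extend_bitsE.
Qed.

Lemma bernoulli_bits_pullback (I I' : eqType) p (Z : I' -> T -> bool) (f : I -> I') :
  injective f -> bernoulli_bits P p Z predT ->
  bernoulli_bits P p (fun i => Z (f i)) predT.
Proof.
move=> finj [mZ HZ]; split => [i _|A b uA _]; first exact: mZ.
pose g j := if [pick i : 'I_(size A) | f (tnth (in_tuple A) i) == j] is Some i
  then b (tnth (in_tuple A) i) else false.
have gf i : i \in A -> g (f i) = b i.
  rewrite /g => iA; case: pickP => [k /eqP/finj->//|no].
  have sA : (index i A < size A)%N by rewrite index_mem.
  have := no (Ordinal sA); rewrite (tnth_nth i) /= nth_index// eqxx.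
  by [].
have := HZ (map f A) g; rewrite map_inj_uniq// => /(_ uA (all_predT _)).
rewrite big_map => H; transitivity (P [set t | all (fun j => Z j t == g j) (map f A)]).
  congr (P _); apply: eq_set => t; rewrite all_map; apply: congr1.
  by apply: eq_in_all => i iA /=; rewrite gf.
by rewrite H; congr (_%:E); apply: eq_big_seq => i iA; rewrite gf.
Qed.

End RandomVariables.

(** * A realization of independent Bernoulli variables on the unit interval *)

Section UniformDigits.
Variables (R : realType) (p : R).
Hypothesis p01 : 0 <= p <= 1.

(** A cell is given by its left end and its length. *)
Definition split_cell (c : R * R) (b : bool) : R * R :=
  if b then (c.1, p * c.2) else (c.1 + p * c.2, (1 - p) * c.2).

Fixpoint state n (x : R) : R * R :=
  if n is m.+1 then let c := state m x in split_cell c (x < c.1 + p * c.2) else (0, 1).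

(* The n-th digit of x in the base-p subdivision: at every step the current cell
   is cut in the proportions p and 1 - p. *)
Definition digit n x := x < (state n x).1 + p * (state n x).2.

Fixpoint cell n (b : nat -> bool) : R * R :=
  if n is m.+1 then split_cell (cell m b) (b m) else (0, 1).

Lemma state_cell n x : state n x = cell n (digit ^~ x).
Proof. by elim: n => //= n <-. Qed.

Lemma eq_cell n b b' : (forall i, (i < n)%N -> b i = b' i) -> cell n b = cell n b'.
Proof.
elim: n => //= n IH bb'; rewrite bb'// IH// => i im; apply: bb'.
exact: ltnW.
Qed.

Lemma cell_bounds n b :
  [/\ 0 <= (cell n b).1, 0 <= (cell n b).2 & (cell n b).1 + (cell n b).2 <= 1].
Proof.
have /andP[p0 p1] := p01.
elim: n => [|n [l0 w0 lw]] /=; first by split; rewrite ?add0r.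
have pw : 0 <= p * (cell n b).2 by rewrite mulr_ge0.
have pw' : 0 <= (1 - p) * (cell n b).2 by rewrite mulr_ge0// subr_ge0.
by rewrite /split_cell; case: (b n) => /=; split => //; lra.
Qed.

Lemma state_in n x : 0 <= x <= 1 ->
  (state n x).1 <= x <= (state n x).1 + (state n x).2.
Proof.
move=> x01; elim: n => [|n /andP[lx xw]] /=; first by rewrite add0r.
rewrite /split_cell; case: ltP => /= H; first by rewrite lx ltW.
by rewrite H /= -addrA -mulrDl subrKC mul1r.
Qed.

Lemma cell_digits n b x : (cell n b).1 <= x < (cell n b).1 + (cell n b).2 ->
  forall i, (i < n)%N -> digit i x = b i.
Proof.
have /andP[p0 p1] := p01.
elim: n => //= n IH xc.
have [l0 w0 lw] := cell_bounds n b.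
have pw : 0 <= p * (cell n b).2 by rewrite mulr_ge0.
have pw' : 0 <= (1 - p) * (cell n b).2 by rewrite mulr_ge0// subr_ge0.
have {}IH : forall i, (i < n)%N -> digit i x = b i.
  apply: IH; move: xc; rewrite /split_cell; case: (b n) => /= /andP[? ?];
    by apply/andP; split; lra.
move=> i; rewrite ltnS leq_eqVlt => /orP[/eqP->|]; last exact: IH.
rewrite /digit state_cell (eq_cell IH); move: xc; rewrite /split_cell.
by case: (b n) => /= /andP[? ?]; [|apply/negbTE; rewrite -leNgt].
Qed.

Lemma measurable_state n :
  measurable_fun setT (fun x => (state n x).1) /\ measurable_fun setT (fun x => (state n x).2).
Proof.
elim: n => [|n [m1 m2]] /=; first by split; exact: measurable_cst.
have mt : measurable_fun setT (fun x => (state n x).1 + p * (state n x).2).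
  by apply: measurable_funD => //; apply: measurable_funM.
have mlt : measurable_fun setT (fun x : R => x < (state n x).1 + p * (state n x).2).
  exact: measurable_fun_ltr.
split.
  rewrite (_ : (fun x => _) = fun x => if x < (state n x).1 + p * (state n x).2
      then (state n x).1 else (state n x).1 + p * (state n x).2).
    by apply: measurable_fun_ifT.
  by apply/funext => x; rewrite /split_cell; case: ifP.
rewrite (_ : (fun x => _) = fun x => if x < (state n x).1 + p * (state n x).2
      then p * (state n x).2 else (1 - p) * (state n x).2).
  by apply: measurable_fun_ifT => //; apply: measurable_funM.
by apply/funext => x; rewrite /split_cell; case: ifP.
Qed.

Lemma measurable_digit n : measurable [set x | digit n x].
Proof.
have [m1 m2] := measurable_state n.
have mlt : measurable_fun setT (digit n).
  by apply: measurable_fun_ltr => //; apply: measurable_funD => //; apply: measurable_funM.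
have := mlt measurableT [set true] I; rewrite setTI; congr measurable.
Qed.

Let U : probability (measurableTypeR R) R := uniform_prob (@ltr01 R).

Lemma uniform_itv (l r : R) (b1 b2 : bool) : 0 <= l -> l <= r -> r <= 1 ->
  U [set` Interval (BSide b1 l) (BSide b2 r)] = (r - l)%:E.
Proof.
move=> l0 lr r1; rewrite /U /= /uniform_prob integral_uniform_pdf setIidl; last first.
  move=> x /=; rewrite !in_itv /= => /andP[lx xr]; apply/andP; split.
    by apply: le_trans l0 _; move: lx; case: b1 => //= /ltW.
  by apply: le_trans r1; move: xr; case: b2 => //= /ltW.
rewrite (eq_integral (fun=> 1%E)); last first.
  move=> x; rewrite inE /= in_itv /= => /andP[lx xr]; rewrite /uniform_pdf.
  rewrite subr0 invr1 ifT//; apply/andP; split.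
    by apply: le_trans l0 _; move: lx; case: b1 => //= /ltW.
  by apply: le_trans r1; move: xr; case: b2 => //= /ltW.
rewrite integral_cst//= mul1e lebesgue_measure_itv /= lte_fin.
by move: lr; rewrite le_eqVlt => /orP[/eqP->|->]; rewrite ?ltxx ?subrr.
Qed.

Lemma digit_prefix n b :
  U [set x | all (fun i => digit i x == b i) (iota 0 n)] =
  (\prod_(i <- iota 0 n) (if b i then p else 1 - p))%:E.
Proof.
have -> : \prod_(i <- iota 0 n) (if b i then p else 1 - p) = (cell n b).2.
  elim: n => [|n IH]; first by rewrite big_nil.
  rewrite -[in iota _ _]addn1 iotaD big_cat add0n /= big_seq1 IH /split_cell.
  by case: (b n) => /=; rewrite mulrC.
set A := [set x | _]; have [l0 w0 lw] := cell_bounds n b.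
have mA : measurable A.
  by apply: (@measurable_cylinder _ _ _ digit (iota 0 n)
    (fun y => all (fun i => y i == b i) (iota 0 n))) => [i _|y z yz];
    [exact: measurable_digit|apply: eq_in_all => i ii; rewrite yz].
have lwl : (cell n b).1 <= (cell n b).1 + (cell n b).2 by rewrite lerDl.
(* The event lies between the half-open and the closed cell, up to points outside the unit interval;
   both cells have the same mass, so endpoints and empty cells need no separate treatment. *)
apply/eqP; rewrite eq_le; apply/andP; split.
  have -> : U A = U (A `&` `[0, 1]%classic).
    rewrite /U /= /uniform_prob integral_uniform_pdf [RHS]integral_uniform_pdf.
    by rewrite -setIA setIid.
  have := @uniform_itv (cell n b).1 ((cell n b).1 + (cell n b).2) true false l0 lwl lw.
  rewrite addrAC subrr add0r => <-; apply: le_measure; rewrite ?inE//.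
  - exact: measurableI.
  - move=> x [/= /allP Ax]; rewrite !in_itv /= => x01.
    have := state_in n x01; rewrite state_cell (@eq_cell _ _ b)// => i ii.
    by apply/eqP/Ax; rewrite mem_iota.
have := @uniform_itv (cell n b).1 ((cell n b).1 + (cell n b).2) true true l0 lwl lw.
rewrite addrAC subrr add0r => <-; apply: le_measure; rewrite ?inE//.
move=> x /=; rewrite in_itv /= => xc; apply/allP => i; rewrite mem_iota add0n => /andP[_ ii].
by rewrite (cell_digits xc).
Qed.

Lemma digit_bits : bernoulli_bits U p digit predT.
Proof.
split => [i _|A b uA _]; first exact: measurable_digit.
pose n := \max_(i <- A) i.+1.
have An : {subset A <= iota 0 n}.
  by move=> i iA; rewrite mem_iota add0n /n (big_rem i)//= leq_max leqnn.
have := @law_Ex _ _ _ U _ p digit (iota 0 n) (iota_uniq _ _)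
  (fun i _ => measurable_digit i) (digit_prefix n)
  (fun y => all (fun i => y i == b i) A) (fun=> false).
rewrite (Ex_cylinder (fun=> p) b uA An) => -> // y z yz.
by apply: eq_in_all => i /An/yz->.
Qed.

End UniformDigits.

(** As [as_no_infinite_cluster] quantifies over realizations, it can be contradicted only if one
    exists. *)
Lemma exists_bernoulli_bits (R : realType) (I : eqType) (p : R) (code : I -> nat) :
  0 <= p <= 1 -> injective code ->
  exists d (T : measurableType d) (P : probability T R) (Z : I -> T -> bool),
    bernoulli_bits P p Z predT.
Proof.
move=> p01 codeI.
exists _, (measurableTypeR R), (uniform_prob (@ltr01 R)), (fun i => digit p (code i)).
exact: (bernoulli_bits_pullback codeI (digit_bits p01)).
Qed.

(** * Percolation on transitive graphs *)

Section Transitivity.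
Variables (G : sgraph) (lf : locally_finite G).

Lemma automorphism_degree (f : G -> G) u : automorphism f -> #|` nbr (f u)| = #|` nbr u|.
Proof.
move=> [[g fK gK] fadj].
have -> : nbr (f u) = (f @` nbr u)%fset.
  apply/fsetP => w; rewrite in_nbr//; apply/idP/imfsetP => /= [fw|[v vu ->]].
    by exists (g w); rewrite ?gK// in_nbr// -fadj gK.
  by rewrite fadj -in_nbr.
by rewrite card_imfset//; exact: can_inj fK.
Qed.

Lemma transitive_degree o : transitive_graph G -> forall u : G, (#|` nbr u| <= #|` nbr (o : G)|)%N.
Proof. by move=> tr u; have [f fa <-] := tr o u; rewrite automorphism_degree. Qed.

(** Automorphisms carry one cycle of [G] through every vertex, so that a single length [k] serves
    everywhere. *)
Lemma transitive_cycles : connected_graph G -> transitive_graph G -> ~ is_tree G ->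
  exists2 k, (2 < k)%N & forall c : G, exists v cyc, [/\ path (@adj G) c (v :: cyc),
    last v cyc = c, uniq (v :: cyc) & size (v :: cyc) = k].
Proof.
move=> conn tr nt.
have [c [c2 /andP[pc uc]]] : exists c : seq G, (2 < size c)%N /\ ucycle (@adj G) c.
  apply: contrapT => no; apply: nt; split => // c c2 cc; apply: no; by exists c.
case: c c2 pc uc => // a c c2 pc uc; exists (size (a :: c)) => // v.
have [f [fb fadj] fa] := tr a v.
have E : map f (rcons c a) = f (head a c) :: behead (map f (rcons c a)) by case: (c).
exists (f (head a c)), (behead (map f (rcons c a))); rewrite -E.
have finj := bij_inj fb.
split.
- rewrite -fa path_map; by apply: sub_path pc => x y; rewrite /= fadj.
- have <- : last v (map f (rcons c a)) = last (f (head a c)) (behead (map f (rcons c a))).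
    by rewrite E.
  by rewrite map_rcons last_rcons.
- by rewrite map_inj_uniq// rcons_uniq -/(uniq (a :: c)).
- by rewrite size_map size_rcons.
Qed.

End Transitivity.

Section Countability.
Variables (G : sgraph) (lf : locally_finite G) (conn : connected_graph G).

Lemma countable_vertices : countable [set: G].
Proof.
have [[w _]|no] := pselect (exists o : G, True); last first.
  by rewrite (_ : setT = set0) ?countable0//; apply/seteqP; split => // v; case: no; exists v.
rewrite (_ : setT = \bigcup_n [set` gball n w]).
  apply: bigcup_countable => // n _; exact/finite_set_countable/finite_fset.
apply/seteqP; split => // v _; have [n vn] := connected_gball lf w v conn.
by exists n.
Qed.

Lemma vertex_code : exists f : G -> nat, injective f.
Proof.
have /countable_injP[f finj] := countable_vertices.
by exists f => u v; apply: finj; rewrite inE.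
Qed.

Lemma lift_key_code : exists f : {fset (G * bool)} -> nat, injective f.
Proof.
have [f finj] := vertex_code.
have pinj : injective (fun x : G * bool => (f x.1, x.2)).
  by move=> [u i] [v j] /= [/finj-> ->].
exists (fun e : {fset (G * bool)} =>
  choice.pickle ([seq (f x.1, x.2) | x <- e] : seq (nat * bool))).
move=> e e' /(pcan_inj choice.pickleK)/(inj_map pinj) ee.
by apply/fsetP => x; rewrite -[x \in e]/(x \in enum_fset e) ee.
Qed.

End Countability.

Section Clusters.
Variables (G : sgraph).

Definition keybits (omega : edge G -> bool) : {fset G} -> bool :=
  fun e => if insub e is Some j then omega j else false.

Lemma keybitsE omega (e : edge G) : keybits omega (val e) = omega e.
Proof. by rewrite /keybits valK. Qed.

Lemma gst_keybits omega u v : gst (keybits omega) u v = open_adj omega u v.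
Proof.
apply/idP/asboolP => [/andP[uv]|[e Ee eo]].
  by rewrite /keybits; case: insubP => // e _ Ee eo; exists e.
rewrite /gst -[ek u v]/[fset u; v]%fset -Ee keybitsE eo andbT.
have /asboolP[a [b [ab Eab]]] := valP e.
have : ek u v = ek a b by rewrite -[LHS]Ee.
by move=> /ek_inj[[-> ->]|[-> ->]]//; rewrite adj_sym.
Qed.

Lemma infinite_cluster_exit omega u n : infinite_set (Defs.cluster omega u) ->
  gexit (mem (gball n u)) u (keybits omega).
Proof.
move=> inf; apply: contrapT => no; apply: inf.
apply: (@sub_finite_set _ _ [set` gball n u]); last exact: finite_fset.
move=> v uv /=; apply: contrapT => /negP nv; apply: no; exists v => //.
by apply: sub_reachable uv => a b; rewrite gst_keybits.
Qed.

End Clusters.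

Section PercolationProbability.
Variables (R : realType) (G : sgraph) (lf : locally_finite G) (conn : connected_graph G).
Variables (p : R) (p01 : 0 <= p <= 1).
Variables (d : measure_display) (T : measurableType d) (P : probability T R).
Variables (omega : edge G -> {RV P >-> bool}) (iid : iid_bernoulli p omega).

Let Z t : {fset G} -> bool := keybits (fun e => omega e t).

Lemma edge_bernoulli_bits : bernoulli_bits P p (fun e t => Z t e) (@is_edge G).
Proof. exact: (bernoulli_bits_extend (iid_bernoulli_bits p01 iid)). Qed.

Lemma near_edges_good n (o : G) : all (@is_edge G) (near_edges n o).
Proof.
apply/allP => e /near_edgesP => /(_ lf)[u [v [_ uv ->]]].
by apply/asboolP; exists u, v.
Qed.

Lemma gexit_depends_only n (o a : G) : depends_only (near_edges n o)
  (fun om => `[< gexit (mem (gball n o)) a om >]).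
Proof.
move=> x y xy.
have near_key u v : u \in gball n o -> adj u v -> ek u v \in near_edges n o.
  by move=> ub uv; apply/near_edgesP => //; exists u, v.
apply/idP/idP => /asboolP[t ot nt]; apply/asboolP.
  apply: (exit_depends _ ot nt) => u v /= ub /andP[uv xuv].
  by rewrite /gst uv -xy// near_key.
apply: (exit_depends _ ot nt) => u v /= ub /andP[uv xuv].
by rewrite /gst uv xy// near_key.
Qed.

Lemma measurable_gexit n (o a : G) :
  measurable [set t | `[< gexit (mem (gball n o)) a (Z t) >]].
Proof.
apply: (@measurable_cylinder _ _ _ (fun e t => Z t e) (near_edges n o)
  (fun om => `[< gexit (mem (gball n o)) a om >])); last exact: gexit_depends_only.
move=> e en; apply: (proj1 edge_bernoulli_bits).
exact: (allP (near_edges_good n o)).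
Qed.

Lemma prob_gexit n (o a : G) :
  P [set t | `[< gexit (mem (gball n o)) a (Z t) >]] = (perc p n o a)%:E.
Proof.
exact: (prob_Ex edge_bernoulli_bits (fun=> false) (near_edges_good n o)
  (@gexit_depends_only n o a)).
Qed.

(** For each vertex the exits of all balls have intersection of probability zero, and there are
    countably many vertices. *)
Lemma ae_no_infinite_cluster :
  (forall (u : G) c, 0 < c -> exists n, perc p n u u < c) ->
  {ae P, forall t, ~ has_infinite_cluster (fun e => omega e t)}.
Proof.
move=> small.
pose E u := \bigcap_n [set t | `[< gexit (mem (gball n u)) u (Z t) >]].
have mE u : measurable (E u).
  by apply: bigcap_measurable => // n _; exact: measurable_gexit.
have E0 u : P (E u) = 0%E.
  apply/eqP/negPn/negP => PE; have PE0 : (0 < P (E u))%E by rewrite lt0e PE measure_ge0.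
  have fE : P (E u) \is a fin_num by exact: fin_num_measure.
  have [|n] := small u (fine (P (E u))).
    by rewrite fine_gt0// PE0 ltey_eq fE.
  rewrite -lte_fin fineK// -(prob_gexit n u u) ltNge => /negP; apply.
  apply: le_measure; rewrite ?inE//; first exact: measurable_gexit.
  by move=> t Et; exact: Et.
have [f finj] := vertex_code lf conn.
pose F k := [set t | exists2 u, f u = k & E u t].
have nF : P.-negligible (\bigcup_k F k).
  apply: negligible_bigcup => k.
  have [[u fu]|no] := pselect (exists u, f u = k).
    exists (E u); split; [exact: mE|exact: E0|move=> t [v fv]].
    by rewrite -fv in fu; rewrite (finj _ _ fu).
  by exists set0; split => // t [u fu _]; apply: no; exists u.
apply: negligibleS nF => t /= /contrapT[u inf]; exists (f u) => //.
by exists u => // n _; apply/asboolP; exact: infinite_cluster_exit.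
Qed.

End PercolationProbability.

(** * A priori bounds around the critical parameter *)

Section CriticalBounds.
Variables (R : realType) (G : sgraph) (lf : locally_finite G) (conn : connected_graph G).

(** Above the critical parameter one only knows that the almost sure statement fails for some
    realization; [perc] does not depend on the realization, hence a uniform bound at some vertex. *)
Lemma perc_lower_bound (p : R) : 0 <= p <= 1 -> ~ as_no_infinite_cluster G p ->
  exists o c, 0 < c /\ forall n, c <= perc p n o (o : G).
Proof.
move=> p01 nas; apply: contrapT => no; apply: nas => d T P omega iid.
apply: (ae_no_infinite_cluster lf conn p01 iid) => u c c0; apply: contrapT => big; apply: no.
exists u, c; split => // n; rewrite leNgt; apply/negP => lt; apply: big.
by exists n.
Qed.

Fixpoint walks n (u : G) : seq (seq G) :=
  if n is m.+1 then [seq v :: s | v <- nbr u, s <- walks m v] else [:: [::]].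

Lemma mem_walks u s : path (@adj G) u s -> s \in walks (size s) u.
Proof.
elim: s u => //= v s IH u /andP[uv ps]; apply/allpairsPdep; exists v, s.
by rewrite in_nbr// uv IH.
Qed.

Variable D : nat.
Hypothesis degD : forall u : G, (#|` nbr u| <= D)%N.

Lemma size_walks n u : (size (walks n u) <= D ^ n)%N.
Proof.
elim: n u => //= n IH u; rewrite size_allpairs_dep sumnE big_map.
apply: (@leq_trans (\sum_(v <- nbr u) D ^ n)); first by apply: leq_sum => v _.
by rewrite big_const_seq iter_addn_0 count_predT mulnC expnS leq_mul2r degD orbT.
Qed.

Lemma uniq_keys u (s : seq G) : uniq (u :: s) -> uniq (pairmap (@ek G) u s).
Proof.
elim: s u => //= v s IH u /andP[us uvs]; rewrite IH// andbT.
apply/negP => /key_endpoint/(_ (fset21 _ _)) uv; by rewrite uv in us.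
Qed.

(** Path counting: an exit forces one of at most [D ^ n] walks to be self-avoiding and open, and its
    [n] distinct edges are all open with probability [p ^+ n]. *)
Lemma perc_upper_bound (p : R) n (o : G) : 0 <= p <= 1 ->
  perc p n o o <= (D%:R * p) ^+ n.
Proof.
move=> p01; pose Q (s : seq G) (om : {fset G} -> bool) : R :=
  (uniq (o :: s) && all (mem (near_edges n o)) (pairmap (@ek G) o s))%:R *
  (all (fun e => om e == true) (pairmap (@ek G) o s))%:R.
have pw : prob_weight (fun=> p : R) by move=> ?.
apply: (@le_trans _ _ (Ex (fun=> p) (near_edges n o)
    (fun om => \sum_(s <- walks n o) Q s om) (fun=> false))).
  apply: Ex_le => // om; have Q0 s : 0 <= Q s om by rewrite mulr_ge0.
  have [gx|ngx] := pselect (gexit (mem (gball n o)) o om); last first.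
    by rewrite asboolF// sumr_ge0.
  rewrite asboolT//; have [s [ps us ns sb]] := long_path lf gx.
  pose s' := take n s; have ss' : size s' = n by rewrite size_takel.
  have ps' : path (gst om) o s'.
    by move: ps; rewrite -{1}(cat_take_drop n s) cat_path => /andP[].
  have us' : uniq (o :: s').
    by move: us; rewrite -{1}(cat_take_drop n s) -cat_cons cat_uniq => /andP[].
  have sb' : {subset o :: s' <= gball n o}.
    move=> u us'u; apply: sb; move: us'u; rewrite !inE => /orP[->//|/mem_take->].
    by rewrite orbT.
  have ws : s' \in walks n o.
    rewrite -ss'; apply: mem_walks; apply: sub_path ps' => ? ? /andP[]//.
  have E : Q s' om = 1.
    rewrite /Q us' /=.
    have -> : all (mem (near_edges n o)) (pairmap (@ek G) o s').
      apply/allP => e /pairmapP[s1 [v [s2 [Es ->]]]]; apply/near_edgesP => //.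
      exists (last o s1), v; split => //.
        by apply: sb'; rewrite Es -cat_cons mem_cat mem_last.
      by move: ps'; rewrite Es cat_path => /and3P[_ /andP[]].
    have -> : all (fun e => om e == true) (pairmap (@ek G) o s').
      apply/allP => e /pairmapP[s1 [v [s2 [Es ->]]]].
      by move: ps'; rewrite Es cat_path => /and3P[_ /andP[_ ->]].
    by rewrite mulr1.
  by rewrite (big_rem s')//= E lerDl sumr_ge0.
rewrite Ex_sum; have /andP[p0 p1] := p01.
apply: (@le_trans _ _ (\sum_(s <- walks n o) p ^+ n)).
  rewrite big_seq [leRHS]big_seq; apply: ler_sum => s ws.
  rewrite /Q ExZ; case: (boolP (uniq _ && _)) => [/andP[us As]|_]; last first.
    by rewrite mul0r exprn_ge0.
  rewrite mul1r Ex_cylinder; [|exact: uniq_keys|by move=> e /(allP As)].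
  have ss : size s = n.
    elim: n o s ws {Q us As} => [|n IH] o' s /=; first by rewrite inE => /eqP->.
    by move=> /allpairsPdep[v [s' [_ /IH <- ->]]].
  rewrite big_const_seq count_predT size_pairmap ss.
  by rewrite -Monoid.iteropE.
rewrite big_const_seq count_predT iter_addr_0 -[leLHS]mulr_natl exprMn ler_wpM2r ?exprn_ge0//.
by rewrite -natrX ler_nat size_walks.
Qed.

(** The choice of [p] makes [D p] at most 1/2 in the path count. This shows that the critical
    parameter is positive and that the set defining it is non-empty. *)
Lemma subcritical_parameter : exists2 p : R, 0 < p & p <= 1 /\ as_no_infinite_cluster G p.
Proof.
pose p : R := (2 * D.+1%:R)^-1.
have p0 : 0 < p by rewrite invr_gt0 mulr_gt0.
have D1 : 1 <= D.+1%:R :> R by rewrite ler1n.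
have p1 : p <= 1 by rewrite invf_le1 ?mulr_gt0//; lra.
exists p => //; split => // d T P omega iid.
have p01 : 0 <= p <= 1 by rewrite p1 ltW.
apply: (ae_no_infinite_cluster lf conn p01 iid) => u c c0.
have Dp : D%:R * p <= 2^-1.
  rewrite /p invfM mulrCA ler_piMr// ler_pdivrMr ?mul1r//; by rewrite ler_nat.
have [n nc] : exists n, (2^-1 : R) ^+ n < c.
  have := @cvg_expr R 2^-1; rewrite ger0_norm// invf_lt1// ltr1n => /(_ isT).
  move=> /cvgrPdist_lt/(_ c c0)[n _ /(_ n (leqnn n))] /=.
  rewrite sub0r normrN ger0_norm ?exprn_ge0// => H; by exists n.
exists n; apply: le_lt_trans nc; apply: le_trans (perc_upper_bound n u p01) _.
by rewrite lerXn2r// ?nnegrE ?mulr_ge0 ?invr_ge0// ltW.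
Qed.

End CriticalBounds.

Section MonotoneLimits.
Context d (T : measurableType d) (R : realType) (P : probability T R).
Implicit Types (B : set T) (E : nat -> set T).

Let cvg_cap E : (forall n, measurable (E n)) -> (forall n, E n.+1 `<=` E n) ->
  P \o E @ \oo --> P (\bigcap_n E n).
Proof.
move=> mE dE; apply: nonincreasing_cvg_mu => //.
- by apply: le_lt_trans (probability_le1 P (mE 0%N)) _; rewrite ltry.
- by apply: bigcap_measurable.
- by apply/nonincreasing_seqP => n; apply/subsetPset.
Qed.

Let cvg_cup E : (forall n, measurable (E n)) -> (forall n, E n `<=` E n.+1) ->
  P \o E @ \oo --> P (\bigcup_n E n).
Proof.
move=> mE dE; apply: nondecreasing_cvg_mu => //.
- by apply: bigcup_measurable.
- by apply/nondecreasing_seqP => n; apply/subsetPset.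
Qed.

Lemma probability_bigcap_ge (E : nat -> set T) (c : \bar R) : (forall n, measurable (E n)) ->
  (forall n, E n.+1 `<=` E n) -> (forall n, (c <= P (E n))%E) ->
  (c <= P (\bigcap_n E n))%E.
Proof.
move=> mE dE cE; apply: cvge_ge (cvg_cap mE dE).
by apply: nearW => n; exact: cE.
Qed.

Lemma bigcap_independent B E : measurable B -> (forall n, measurable (E n)) ->
  (forall n, E n.+1 `<=` E n) -> (forall n, P (B `&` E n) = (P B * P (E n))%E) ->
  P (B `&` \bigcap_n E n) = (P B * P (\bigcap_n E n))%E.
Proof.
move=> mB mE dE ind.
have fB : P B \is a fin_num by exact: fin_num_measure.
have c1 := cvgeZl fB (cvg_cap mE dE).
have c2 : P \o (fun n => B `&` E n) @ \oo --> P (\bigcap_n (B `&` E n)).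
  apply: cvg_cap => n; first exact: measurableI.
  by apply: setIS.
rewrite (_ : P \o _ = fun n => (P B * (P \o E) n)%E) in c2; last first.
  by apply/funext => n /=; rewrite ind.
have -> : B `&` \bigcap_n E n = \bigcap_n (B `&` E n).
  apply/seteqP; split => t /=; first by move=> [Bt Et] n _; split => //; exact: Et.
  by move=> H; split => [|n _]; [have [] := H 0%N I|have [] := H n I].
exact: (cvg_unique _ c2 c1).
Qed.

Lemma bigcup_independent B E : measurable B -> (forall n, measurable (E n)) ->
  (forall n, E n `<=` E n.+1) -> (forall n, P (B `&` E n) = (P B * P (E n))%E) ->
  P (B `&` \bigcup_n E n) = (P B * P (\bigcup_n E n))%E.
Proof.
move=> mB mE dE ind.
have fB : P B \is a fin_num by exact: fin_num_measure.
have c1 := cvgeZl fB (cvg_cup mE dE).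
have c2 : P \o (fun n => B `&` E n) @ \oo --> P (\bigcup_n (B `&` E n)).
  apply: cvg_cup => n; first exact: measurableI.
  by apply: setIS.
rewrite (_ : P \o _ = fun n => (P B * (P \o E) n)%E) in c2; last first.
  by apply/funext => n /=; rewrite ind.
rewrite setI_bigcupr.
exact: (cvg_unique _ c2 c1).
Qed.

End MonotoneLimits.

(** * Infinite clusters of the lift and the 0-1 law *)

Section LiftClusters.
Variables (G : sgraph) (lf : locally_finite G) (conn : connected_graph G) (o : G).
Implicit Types (eta : {fset G} -> bool) (Om : {fset (G * bool)} -> bool).

Definition inf_lift eta Om := exists a, infinite_set [set v | reachable (lst eta Om) a v].

Lemma lexit_infinite eta Om a : (forall m, lexit eta (mem (gball m o)) a Om) ->
  infinite_set [set v | reachable (lst eta Om) a v].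
Proof.
move=> ex /finite_fsetP[A EA].
have [N AN] : exists N, forall v, v \in enum_fset A -> v.1 \in gball N o.
  elim: (enum_fset A) => [|v s [N sN]]; first by exists 0%N.
  have [n vn] := connected_gball lf o v.1 conn.
  exists (maxn n N) => w; rewrite inE => /orP[/eqP->|/sN wN].
    by apply: gball_le vn; rewrite leq_maxl.
  by apply: gball_le wN; rewrite leq_maxr.
have [t ot /negP] := ex N; apply.
by apply: AN; have : [set v | reachable (lst eta Om) a v] t by []; rewrite EA.
Qed.

Lemma infinite_lexit eta Om a m : infinite_set [set v | reachable (lst eta Om) a v] ->
  lexit eta (mem (gball m o)) a Om.
Proof.
move=> inf; apply: contrapT => no; apply: inf.
pose B := [seq (u, i) | u <- gball m o, i <- [:: false; true]].
apply: (@sub_finite_set _ _ [set` B]); last exact: finite_seq.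
move=> [v i] ov /=; apply/allpairsP; exists (v, i); split => //=; last by case: i {ov}.
by apply: contrapT => /negP nv; apply: no; exists (v, i).
Qed.

(* Every vertex of the cluster is joined to a, or to an endpoint of a changed
   edge, by a path using no changed edge. *)
Lemma inf_lift_tail eta eta' (F : seq {fset G}) Om :
  (forall e, e \notin F -> eta e = eta' e) -> inf_lift eta Om -> inf_lift eta' Om.
Proof.
move=> ee [a inf]; apply: contrapT => no; apply: inf.
pose X : seq (G * bool) := a ::
  flatten [seq [seq (v, i) | v <- enum_fset e, i <- [:: false; true]] | e : {fset G} <- F].
have XF v i e : v \in e -> e \in F -> (v, i) \in X.
  move=> ve eF; rewrite inE; apply/orP; right; apply/flattenP.
  exists [seq (v, i) | v <- enum_fset e, i <- [:: false; true]]; first by apply/mapP; exists e.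
  by apply/allpairsP; exists (v, i); split => //=; case: (i).
apply: (@sub_finite_set _ _ (\bigcup_(z in [set` X]) [set v | reachable (lst eta' Om) z v])).
  move=> v [s ps ls] /=.
  have [vX|nvX] := boolP (v \in X); first by exists v => //; exact: reachable_refl.
  rewrite -ls in nvX.
  have [s1 [w [s2 [Es lX al]]]] := @last_exit _ (mem X) a s (mem_head _ _) nvX.
  exists (last a s1) => //=.
  move: ps; rewrite Es cat_path => /andP[_ ps2].
  exists (w :: s2); last by rewrite -ls Es last_cat.
  have step x y : y \notin X -> lst eta Om x y -> lst eta' Om x y.
    move=> yX /and3P[xy e O]; rewrite /lst xy O andbT -ee//.
    by apply: contra yX => eF; case: y {O e} xy eF => y j /= xy; apply: XF; exact: fset22.
  move: al ps2 {Es}; elim: (w :: s2) (last a s1) => //= x l IH z /andP[xX lX'] /andP[zx pl].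
  by rewrite step//= IH.
apply: bigcup_finite; first exact: finite_seq.
move=> z _; apply: contrapT => infz; apply: no; by exists z.
Qed.

End LiftClusters.

Section Theta.
Variables (R : realType) (G : sgraph) (lf : locally_finite G) (conn : connected_graph G) (o : G).
Implicit Types (eta : {fset G} -> bool) (Om : {fset (G * bool)} -> bool).

Lemma lexit_ind_mono eta m a Om k :
  lexit_ind eta R (mem (gball m o)) a (upd Om k false) <=
  lexit_ind eta R (mem (gball m o)) a (upd Om k true).
Proof.
rewrite ler_nat; case: asboolP => // -[t ot Wt]; rewrite asboolT//; exists t => //.
by apply: sub_reachable ot => a' b; apply: lst_mono => l; rewrite /upd; case: eqP.
Qed.

Lemma theta_le (p p' : R) m eta a : 0 <= p -> p <= p' -> p' <= 1 ->
  theta p m o eta a <= theta p' m o eta a.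
Proof.
move=> p0 pp p1; apply: Ex_le_weight.
- by move=> k; rewrite p0 (le_trans pp p1).
- by move=> k; rewrite p1 (le_trans p0 pp).
- by [].
- by move=> k _ Om; exact: lexit_ind_mono.
Qed.

Variable p : R.
Hypothesis p01 : 0 <= p <= 1.

Lemma theta_decreasing m n eta a : (m <= n)%N -> theta p n o eta a <= theta p m o eta a.
Proof.
move=> mn; rewrite -(theta_widen lf p o eta a mn); apply: Ex_le => // Om.
rewrite /lexit_ind ler_nat; case: asboolP => // -[t ot Wt]; rewrite asboolT//.
exists t => //; apply: contra Wt; exact: gball_le.
Qed.

(** For fixed [eta], positive probability of an infinite cluster, expressed by finite expectations
    so that it becomes a measurable condition on [eta]. *)
Definition percolates eta : Prop :=
  exists a j, forall m, (j.+1%:R)^-1 <= theta p m o eta a.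

Definition starts J : seq (G * bool) := [seq (u, i) | u <- gball J o, i <- [:: false; true]].

Lemma mem_starts J a : (a \in starts J) = (a.1 \in gball J o).
Proof.
case: a => u i; apply/allpairsP/idP => [[[v j] [/= vJ _ [-> _]]]//|uJ].
by exists (u, i); split => //=; case: (i).
Qed.

(* Finitely many starting points and a fixed radius: this event depends on
   finitely many edges. *)
Definition percolates_to J m eta : bool :=
  has (fun a => (J.+1%:R)^-1 <= theta p m o eta a) (starts J).

Lemma percolates_toS J m eta : percolates_to J m.+1 eta -> percolates_to J m eta.
Proof.
move=> /hasP[a aJ le]; apply/hasP; exists a => //; apply: le_trans le _.
exact: theta_decreasing.
Qed.

Lemma percolates_to_le J J' m eta : (J <= J')%N -> percolates_to J m eta -> percolates_to J' m eta.
Proof.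
move=> JJ /hasP[a aJ le]; apply/hasP; exists a; last first.
  by apply: le_trans le; rewrite lef_pV2 ?posrE// ler_nat.
by move: aJ; rewrite !mem_starts; exact: gball_le.
Qed.

(** Exchange of quantifiers: exit probabilities decrease with the radius, so if each of finitely
    many starting points fails at some radius, all fail at the largest one. *)
Lemma percolatesP eta : percolates eta <-> exists J, forall m, percolates_to J m eta.
Proof.
split=> [[[u i] [j H]]|[J H]].
  have [n un] := connected_gball lf o u conn.
  exists (maxn n j) => m; apply: (@percolates_to_le (maxn n j)) => //.
  apply/hasP; exists (u, i); last first.
    by apply: le_trans (H m); rewrite lef_pV2 ?posrE// ler_nat ltnS leq_maxr.
  by rewrite mem_starts /=; apply: (gball_le _ un); rewrite leq_maxl.
apply: contrapT => no.
have small a : exists m, ~~ ((J.+1%:R)^-1 <= theta p m o eta a).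
  apply: contrapT => big; apply: no; exists a, J => m.
  by apply: contrapT => /negP nm; apply: big; exists m.
have [M HM] : exists M, ~~ has (fun a => (J.+1%:R)^-1 <= theta p M o eta a) (starts J).
  elim: (starts J) => [|a s [M HM]]; first by exists 0%N.
  have [m nm] := small a; exists (maxn m M); rewrite /= negb_or; apply/andP; split.
    by apply: contra nm => le; apply: le_trans le _; apply: theta_decreasing; rewrite leq_maxl.
  apply: contra HM => /hasP[b bs le]; apply/hasP; exists b => //.
  by apply: le_trans le _; apply: theta_decreasing; rewrite leq_maxr.
by move: (H M); rewrite /percolates_to (negbTE HM).
Qed.

Lemma percolates_to_depends J m : depends_only (near_edges m o) (percolates_to J m).
Proof.
move=> x y xy; apply: eq_in_has => a _; congr (_ <= _).
exact: (theta_depends lf).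
Qed.

Variables (d : measure_display) (T : measurableType d) (P : probability T R).
Variable Y : {fset (G * bool)} -> T -> bool.
Hypothesis Ybits : bernoulli_bits P p Y predT.

Lemma lexit_depends_only eta m a : depends_only (lkeys eta m o)
  (fun Om => `[< lexit eta (mem (gball m o)) a Om >]).
Proof.
move=> x y xy; have /eqP := @lexit_ind_depends R G lf eta m o a x y xy.
by rewrite /lexit_ind eqr_nat => /eqP; do 2!case: asbool.
Qed.

Lemma prob_lexit eta m a :
  P [set t | `[< lexit eta (mem (gball m o)) a (Y ^~ t) >]] = (theta p m o eta a)%:E.
Proof.
exact: (prob_Ex Ybits (fun=> false) (all_predT _) (@lexit_depends_only eta m a)).
Qed.

Lemma measurable_lexit eta m a :
  measurable [set t | `[< lexit eta (mem (gball m o)) a (Y ^~ t) >]].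
Proof.
apply: (@measurable_cylinder _ _ _ Y (lkeys eta m o)
  (fun Om => `[< lexit eta (mem (gball m o)) a Om >])); last exact: lexit_depends_only.
by move=> k _; exact: (proj1 Ybits).
Qed.

(** Continuity from above turns a bound on all exit probabilities into an infinite cluster with
    positive probability; the converse uses that there are countably many starting points. *)
Lemma percolates_inf_lift eta : percolates eta <->
  ~ P.-negligible [set t | inf_lift eta (Y ^~ t)].
Proof.
pose E a m := [set t | `[< lexit eta (mem (gball m o)) a (Y ^~ t) >]].
have mE a m : measurable (E a m) by exact: measurable_lexit.
have dE a m : E a m.+1 `<=` E a m.
  move=> t /asboolP[v ov Wv]; apply/asboolP; exists v => //.
  by apply: contra Wv; exact: gballW.
have mcap a : measurable (\bigcap_m E a m) by exact: bigcap_measurable.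
split=> [[a [j H]]|].
  case=> B [mB PB sB].
  have : ((j.+1%:R)^-1%:E <= P (\bigcap_m E a m))%E.
    apply: probability_bigcap_ge => // m; rewrite prob_lexit lee_fin; exact: H.
  have : (P (\bigcap_m E a m) <= P B)%E.
    apply: le_measure; rewrite ?inE// => t Et; apply: sB; exists a.
    apply: lexit_infinite => // m; exact/asboolP/Et.
  by rewrite PB => le0 ge; have := le_trans ge le0; rewrite lee_fin leNgt invr_gt0 ltr0Sn.
move=> nn; apply: contrapT => np; apply: nn.
have [f finj] := vertex_code lf conn.
have E0 a : P (\bigcap_m E a m) = 0%E.
  apply/eqP/negPn/negP => PE; have PE0 : (0 < P (\bigcap_m E a m))%E by rewrite lt0e PE measure_ge0.
  have fE : P (\bigcap_m E a m) \is a fin_num by exact: fin_num_measure.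
  have c0 : 0 < fine (P (\bigcap_m E a m)) by rewrite fine_gt0// PE0 ltey_eq fE.
  (* For positive [x], the successor of the integer part of [x^-1] exceeds [x^-1], so its inverse is
     at most [x]. *)
  apply: np; exists a, (Num.truncn (fine (P (\bigcap_m E a m)))^-1) => m.
  apply: (@le_trans _ _ (fine (P (\bigcap_m E a m)))).
    by rewrite -[leRHS]invrK lef_pV2 ?posrE ?invr_gt0//; apply/ltW/truncnS_gt.
  rewrite -lee_fin fineK// -prob_lexit; apply: le_measure; rewrite ?inE//.
    exact: measurable_lexit.
  by move=> t Et; exact: Et.
pose F k := [set t | exists2 a : G * bool, ((f a.1).*2 + a.2)%N = k & (\bigcap_m E a m) t].
have ginj : injective (fun a : G * bool => (f a.1).*2 + a.2)%N.
  move=> [u i] [v j] /= E'; have eij : i = j.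
    by have /(congr1 odd) := E'; rewrite !oddD !odd_double /=; case: (i); case: (j).
  by move: E'; rewrite eij => /addIn/double_inj/finj->.
have nF : P.-negligible (\bigcup_k F k).
  apply: negligible_bigcup => k.
  have [[a fa]|no] := pselect (exists a : G * bool, ((f a.1).*2 + a.2)%N = k).
    exists (\bigcap_m E a m); split; [exact: mcap|exact: E0|move=> t [b fb]].
    by rewrite -fb in fa; rewrite (ginj _ _ fa).
  by exists set0; split => // t [a fa _]; apply: no; exists a.
apply: negligibleS nF => t /= [a inf]; exists ((f a.1).*2 + a.2)%N => //.
exists a => // m _; apply/asboolP; exact: infinite_lexit.
Qed.

(** The probabilities [theta] do change with finitely many values of [eta]; the existence of an
    infinite cluster does not, for each fixed percolation configuration. *)
Lemma percolates_tail eta eta' (F : seq {fset G}) :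
  (forall e, e \notin F -> eta e = eta' e) -> percolates eta -> percolates eta'.
Proof.
move=> ee /percolates_inf_lift nn; apply/percolates_inf_lift => neg; apply: nn.
by apply: negligibleS neg => t /=; exact: (inf_lift_tail ee).
Qed.

End Theta.

Section ZeroOne.
Variables (R : realType) (G : sgraph) (lf : locally_finite G) (conn : connected_graph G) (o : G).
Variables (p q : R).
Hypotheses (p01 : 0 <= p <= 1) (q01 : 0 <= q <= 1).
Variables (d : measure_display) (T : measurableType d) (P : probability T R).
Variable Z : {fset G} -> T -> bool.
Hypothesis HZ : bernoulli_bits P q Z (@is_edge G).

Let perc_set : set T := [set t | percolates o p (Z ^~ t)].
Let C J m : set T := [set t | percolates_to o p J m (Z ^~ t)].

Lemma measurable_edge_event m F : depends_only (near_edges m o) F ->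
  measurable [set t | F (Z ^~ t)].
Proof.
move=> FD; apply: measurable_cylinder FD => e em; apply: (proj1 HZ).
exact: (allP (near_edges_good lf m o)).
Qed.

Let mC J m : measurable (C J m).
Proof. apply: (measurable_edge_event (m := m)); exact: percolates_to_depends. Qed.

Let perc_setE : perc_set = \bigcup_J \bigcap_m C J m.
Proof.
apply/seteqP; split => t /=.
  by move=> /(percolatesP lf conn o p01)[J H]; exists J => // m _; exact: H.
by move=> [J _ H]; apply/(percolatesP lf conn o p01); exists J => m; exact: H.
Qed.

Lemma measurable_percolates : measurable perc_set.
Proof.
by rewrite perc_setE; apply: bigcup_measurable => J _; apply: bigcap_measurable.
Qed.

Lemma percolates_off F t : percolates o p (off F (Z ^~ t)) <-> percolates o p (Z ^~ t).
Proof.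
have [code codeI] := lift_key_code lf conn.
have [dY [TY [PY [Y HY]]]] := exists_bernoulli_bits p01 codeI.
split; apply: (percolates_tail lf conn HY (F := F)) => e eF.
  by rewrite /off eF.
by rewrite /off eF.
Qed.

(** Putting [eta] to false on the finite set [F] does not alter [perc_set], which is thereby a
    monotone limit of events reading no edge of [F]. *)
Let cylinder_independent J' m' : P (C J' m' `&` perc_set) = (P (C J' m') * P perc_set)%E.
Proof.
pose F := near_edges m' o.
pose C' J m : set T := [set t | percolates_to o p J m (off F (Z ^~ t))].
have D' J m : depends_only [seq e <- near_edges m o | e \notin F]
    (fun eta => percolates_to o p J m (off F eta)).
  move=> x y xy; apply: (percolates_to_depends lf p J (m := m)) => e em; rewrite /off.
  by case: (boolP (e \in F)) => //= eF; apply: xy; rewrite mem_filter eF.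
have good' m : all (@is_edge G) [seq e <- near_edges m o | e \notin F].
  apply/allP => e; rewrite mem_filter => /andP[_].
  exact: (allP (near_edges_good lf m o)).
have mC' J m : measurable (C' J m).
  apply: measurable_cylinder (D' J m) => e em; apply: (proj1 HZ).
  exact: (allP (good' m)).
have E : perc_set = \bigcup_J \bigcap_m C' J m.
  apply/seteqP; split => t /=.
    move=> At; have At' := proj2 (percolates_off F t) At.
    have [J H] := proj1 (percolatesP lf conn o p01 _) At'.
    by exists J => // m _; exact: H.
  move=> [J _ H]; apply: (proj1 (percolates_off F t)).
  by apply: (proj2 (percolatesP lf conn o p01 _)); exists J => m; exact: H.
rewrite E; apply: bigcup_independent => //.
- by move=> J; apply: bigcap_measurable.
- by move=> J t H m _; apply: (percolates_to_le (leqnSn J)); exact: H.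
move=> J; apply: bigcap_independent => //.
  by move=> m t; exact: (percolates_toS lf p01).
move=> m; have := @independent_cylinders _ _ _ P _ q Z _ q01 HZ
  (near_edges m' o) _ _ _ (near_edges_good lf m' o) (good' m) _
  (percolates_to_depends lf p J' (m := m')) (D' J m).
move=> <-; first by congr (P _); apply/seteqP; split => t /= /andP.
by move=> e em'; rewrite mem_filter /= em'.
Qed.

(** Approximating one copy of [perc_set] by cylinder events makes it independent of itself, so its
    probability equals its square. *)
Lemma percolates_zero_one : P perc_set = 0%E \/ P perc_set = 1%E.
Proof.
have self : P (perc_set `&` perc_set) = (P perc_set * P perc_set)%E.
  rewrite {2 4}perc_setE; apply: bigcup_independent.
  - exact: measurable_percolates.
  - by move=> J; apply: bigcap_measurable.
  - by move=> J t H m _; apply: (percolates_to_le (leqnSn J)); exact: H.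
  move=> J; apply: bigcap_independent => //; first exact: measurable_percolates.
    by move=> m t; exact: (percolates_toS lf p01).
  by move=> m; rewrite setIC cylinder_independent muleC.
rewrite setIid in self.
have fin : P perc_set \is a fin_num by apply: fin_num_measure; exact: measurable_percolates.
move: self; rewrite -(fineK fin) -EFinM => -[] /eqP.
rewrite -[X in X == _]mulr1 -subr_eq0 -mulrBr mulf_eq0 subr_eq0.
by move=> /orP[/eqP->|/eqP <-]; [left|right].
Qed.

End ZeroOne.

(** * From percolation of the lift to its critical parameter *)

Section LiftCriticalPoint.
Variables (R : realType) (G : sgraph) (lf : locally_finite G) (conn : connected_graph G) (o : G).
Variables (eta : edge G -> bool).

Lemma lst_open_adj (Y : {fset (G * bool)} -> bool) (a b : G * bool) :
  lst (keybits eta) Y a b -> open_adj (fun e : edge (lift2 eta) => Y (val e)) a b.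
Proof.
move=> /and3P[ab /eqP b2 Yab].
have eG : is_edge [fset a.1; b.1]%fset by apply/asboolP; exists a.1, b.1.
have ladj : lift_adj eta a b.
  pose e : edge G := exist (@is_edge G) _ eG.
  by apply/asboolP; exists e => //; rewrite b2 -(keybitsE eta e).
have eL : is_edge (G := lift2 eta) [fset a; b]%fset by apply/asboolP; exists a, b.
by apply/asboolP; exists (exist (@is_edge (lift2 eta)) _ eL).
Qed.

(** Percolation at [p] persists at every larger [r], where an explicit realization then contradicts
    the absence of infinite clusters. *)
Lemma lift_critical_point (p : R) : 0 <= p <= 1 -> percolates o p (keybits eta) ->
  p_c R (lift2 eta) <= p.
Proof.
move=> p01 [a [j perc_a]]; have /andP[p0 p1] := p01.
have ub (r : R) : 0 <= r <= 1 /\ as_no_infinite_cluster (lift2 eta) r -> r <= p.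
  move=> [r01 none]; rewrite leNgt; apply/negP => pr; have /andP[r0 r1] := r01.
  have [code codeI] := lift_key_code lf conn.
  have [dY [TY [PY [Y HY]]]] := exists_bernoulli_bits r01 codeI.
  have val_inj' : injective (fun e : edge (lift2 eta) => val e) by exact: val_inj.
  have HYe : bernoulli_bits PY r
      (fun e : edge (lift2 eta) => Y (val e)) predT.
    exact: (bernoulli_bits_pullback val_inj' HY).
  have iid := @bits_iid_bernoulli _ _ _ _ _ r (fun e : edge (lift2 eta) => Y (val e))
    (fun e => proj1 HYe e isT) r01 HYe.
  have := none _ _ _ _ iid.
  have : percolates o r (keybits eta).
    exists a, j => m; apply: le_trans (perc_a m) _; apply: theta_le => //; exact: ltW.
  move=> /(percolates_inf_lift lf conn o HY) nn ae; apply: nn.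
  apply: negligibleS ae => t /= [b inf]; apply: contrapT => /contrapT; apply.
  exists b => fin; apply: inf; apply: sub_finite_set fin => v.
  by apply: sub_reachable => x y; exact: lst_open_adj.
rewrite /p_c; set S := [set r : R | _].
(* The supremum of the empty set is 0 by convention, hence at most [p]. *)
have [S0|S0] := pselect (S !=set0); first by apply: ge_sup => // r; exact: ub.
by rewrite sup_out// => -[].
Qed.

End LiftCriticalPoint.

(* The annealed estimate with parameters p_c + T / 2 and p_c - T / 2. *)
Lemma annealed_below_p_c (R : realType) (G : sgraph) (q : R) :
  connected_graph G -> locally_finite G -> transitive_graph G ->
  infinite_set [set: G] -> ~ is_tree G -> 0 < q < 1 -> p_c R G < 1 ->
  exists p (o : G) c, [/\ 0 <= p <= 1, p < p_c R G, 0 < c &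
    forall m, c <= Ex (fun=> q) (near_edges m o)
      (fun eta => theta p m o eta (o, false)) (fun=> false)].
Proof.
move=> conn lf tr infG nt /andP[q0 q1] pc1.
have [u0 _] : exists u0 : G, True.
  apply: contrapT => no; apply: infG.
  rewrite (_ : setT = set0); first exact: finite_set0.
  by apply/seteqP; split => // v; case: no; exists v.
pose D := #|` nbr u0|; have degD := transitive_degree lf u0 tr.
have [k k3 cycles] := transitive_cycles conn tr nt.
pose L := (k.+1 + k + k + k.+1 + k)%N.
set pc := p_c R G in pc1 *.
pose S := [set p : R | 0 <= p <= 1 /\ as_no_infinite_cluster G p].
have supS : has_sup S.
  have [p p0 [p1 np]] := subcritical_parameter R lf conn degD.
  split; last by exists 1 => r [/andP[_ r1] _].
  by exists p; split => //; apply/andP; split => //; exact: ltW.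
have Spc r : S r -> r <= pc by move=> Sr; apply: ub_le_sup => //; case: supS.
have pc0 : 0 < pc.
  have [p p0 [p1 np]] := subcritical_parameter R lf conn degD.
  apply: (lt_le_trans p0); apply: Spc; split => //; first by rewrite (ltW p0) p1.
(* [d] bounds from below the edge densities, which lie between [pc / 2] and [p1], the density [q],
   and their complements. *)
pose d := Num.min (Num.min (pc / 2) ((1 - pc) / 2)) (Num.min q (1 - q)).
have [d1 d2] : d <= pc / 2 /\ d <= (1 - pc) / 2.
  by split; rewrite /d !ge_min lexx ?orbT.
have [d3 d4] : d <= q /\ d <= 1 - q.
  by split; rewrite /d !ge_min lexx ?orbT.
have d0 : 0 < d by rewrite /d !lt_min; apply/andP; split; apply/andP; split; lra.
pose C := D%:R * (1 + d^-1) ^+ modified_bound k L D * (D.+1 ^ (k.+1 + L))%:R.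
have C0 : 0 <= C by rewrite /C !mulr_ge0// exprn_ge0// addr_ge0// invr_ge0 ltW.
(* The first bound keeps [2 C T] at most 1, so that [h] at most doubles; the other two keep [p1 - T]
   above [pc / 2] and [p1] below [1 - d]. *)
pose T := Num.min ((2 * C + 1)^-1) (Num.min (pc / 4) ((1 - pc) / 4)).
have [T1 T2 T3] : [/\ T <= (2 * C + 1)^-1, T <= pc / 4 & T <= (1 - pc) / 4].
  by split; rewrite /T !ge_min lexx ?orbT.
have T0 : 0 < T.
  by rewrite /T !lt_min invr_gt0; apply/andP; split; [|apply/andP; split]; lra.
have CT : 2 * C * T <= 1.
  apply: (@le_trans _ _ (2 * C * (2 * C + 1)^-1)); first by rewrite ler_wpM2l// mulr_ge0.
  by rewrite ler_pdivrMr; lra.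
pose p1 := pc + T / 2.
have p101 : 0 <= p1 <= 1 by apply/andP; split; rewrite /p1; lra.
have np1 : ~ as_no_infinite_cluster G p1.
  by move=> no; have := Spc p1 (conj p101 no); rewrite /p1; lra.
have [root [c [c0 cp]]] := perc_lower_bound lf conn p101 np1.
exists (p1 - T), root, (c / 4); split.
- by apply/andP; split; rewrite /p1; lra.
- by rewrite /p1; lra.
- by rewrite divr_gt0.
move=> m; set E := Ex _ _ _ _.
pose B : R := #|` gball m root|%:R.
have B0 : 0 <= B by [].
pose h0 := Num.min (1 / 4) (c / (8 * (B + 1))).
have [h1 h2] : h0 <= 1 / 4 /\ h0 <= c / (8 * (B + 1)).
  by split; rewrite /h0 !ge_min lexx ?orbT.
have h00 : 0 < h0.
  rewrite /h0 lt_min; apply/andP; split; first by lra.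
  by rewrite divr_gt0// mulr_gt0//; lra.
have hB : 2 * h0 * B <= c / 4.
  have : h0 * (8 * (B + 1)) <= c by rewrite -ler_pdivlMr// mulr_gt0//; lra.
  by nra.
have [n [mn hn]] : exists n, (m <= n)%N /\ (1 - h0) ^+ n <= 1 / 2.
  have a1 : `|1 - h0| < 1 by rewrite ger0_norm; lra.
  have half0 : 0 < 1 / 2 :> R by lra.
  have /cvgrPdist_le/(_ (1 / 2) half0)[N _ HN] := cvg_expr a1.
  exists (maxn m N); split; first by rewrite leq_maxl.
  have := HN (maxn m N) (leq_maxr _ _); rewrite sub0r normrN ger0_norm//.
  by apply: exprn_ge0; lra.
have h02 : 2 * h0 <= 1 / 2 by lra.
have pld : d <= pc / 2 by [].
have p1d : p1 <= 1 - d by rewrite /p1; lra.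
have qd : d <= q <= 1 - d by apply/andP; split; lra.
have pT : pc / 2 <= p1 - T by rewrite /p1; lra.
have dhalf : d <= 1 / 2 by lra.
have := @annealed R G lf k L D root (leqnn _) k3 cycles degD p1 (pc / 2) q C h0 n d T
  d0 dhalf pld p1d qd pT (ltW T0) CT (ltW h00) h02 erefl m (leq_trans mn (leq_addr _ _)).
rewrite -/E -/B => main.
have : (1 - 1 / 2) * c <= (1 - (1 - h0) ^+ n) * perc p1 n root root.
  by apply: ler_pM => //; lra.
by move: main hB; lra.
Qed.

Theorem theorem1p2 (R : realType) (G : sgraph) (q : R)
    (d : measure_display) (T : measurableType d) (P : probability T R)
    (eta : edge G -> {RV P >-> bool}) :
  connected_graph G ->
  locally_finite G ->
  transitive_graph G ->
  infinite_set [set: G] ->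
  ~ is_tree G ->
  0 < q < 1 ->
  iid_bernoulli q eta ->
  p_c R G < 1 ->
  {ae P, forall t, p_c R (lift2 (fun e => eta e t)) < p_c R G}.
Proof.
move=> conn lf tr infG nt q01 iid pc1.
have [p [root [c [p01 ppc c0 anneal]]]] := annealed_below_p_c conn lf tr infG nt q01 pc1.
have q01' : 0 <= q <= 1 by move: q01 => /andP[q0 q1]; apply/andP; split; lra.
pose Z (e : {fset G}) (t : T) := keybits (fun e => eta e t) e.
have HZ : bernoulli_bits P q Z (@is_edge G) by exact: edge_bernoulli_bits.
have mA := measurable_percolates lf conn root p01 HZ.
set A := [set t | _] in mA.
have PA : P A = 1%E.
  have [PA0|//] := percolates_zero_one lf conn root p01 q01' HZ.
  (* As [theta] is at most 1, a mean of at least [c] forces it to exceed [c / 2] with probability at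
     least [c / 2]. These events decrease in [m], and their intersection lies in [A]. *)
  exfalso; pose F m (om : {fset G} -> bool) := c / 2 <= theta p m root om (root, false).
  have FD m : depends_only (near_edges m root) (F m).
    by move=> x y xy; congr (_ <= _); exact: (theta_depends lf).
  have mF m : measurable [set t | F m (Z ^~ t)] by exact: (measurable_edge_event lf HZ (FD m)).
  have PF m : ((c / 2)%:E <= P [set t | F m (Z ^~ t)])%E.
    rewrite (prob_Ex HZ (fun=> false) (near_edges_good lf m root) (FD m)) lee_fin.
    have qw : @prob_weight R {fset G} (fun=> q) by move=> ?.
    have : c <= c / 2 + Ex (fun=> q) (near_edges m root) (fun om => (F m om)%:R) (fun=> false).
      apply: le_trans (anneal m) _.
      have := ExD (fun=> q) (near_edges m root) (fun=> c / 2) (fun om => (F m om)%:R).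
      rewrite Ex_cst => /(congr1 (@^~ (fun=> false))) <-; apply: Ex_le => // om.
      rewrite /F; have [_|/ltW lt] := leP (c / 2) (theta p m root om (root, false)); last first.
        by rewrite mulr0n addr0.
      apply: (@le_trans _ _ 1); last by rewrite lerDr divr_ge0// ltW.
      apply: Ex_le1 => [k|Om]; first exact: p01.
      by rewrite /lexit_ind; case: asbool.
    by lra.
  have : ((c / 2)%:E <= P (\bigcap_m [set t | F m (Z ^~ t)]))%E.
    apply: probability_bigcap_ge => // m t; rewrite /F /= => le.
    by apply: le_trans le _; exact: theta_decreasing.
  have : (P (\bigcap_m [set t | F m (Z ^~ t)]) <= P A)%E.
    apply: le_measure; rewrite ?inE//; first exact: bigcap_measurable.
    move=> t Ft; exists (root, false), (Num.truncn (c / 2)^-1) => m.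
    apply: le_trans (Ft m I); rewrite -[leRHS]invrK lef_pV2 ?posrE ?invr_gt0 ?divr_gt0//.
    exact/ltW/truncnS_gt.
  by rewrite PA0 => le0 ge; have := le_trans ge le0; rewrite lee_fin; lra.
exists (~` A); split; first exact: measurableC.
  by rewrite probability_setC// PA subee.
move=> t /= npc At; apply: npc.
apply: le_lt_trans ppc; apply: lift_critical_point p01 At => //.
Qed.
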